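(* Let $V_1$ be a nonzero finite-dimensional complex superspace with $\dim V_1=m_1+n_1\varepsilon$, let $n\ge1$ and $V=V_1\otimes\Lambda(n)$. 1) The Lie superalgebra $\mathfrak g=\mathfrak{gl}(V_1)\otimes\Lambda(n)\rtimes\mathfrak{vect}(0|n)$ is a maximal Lie subsuperalgebra of $\mathfrak{sl}(V)$ in all cases except a) $\dim V_1=1+\varepsilon$, or b) $n=1$ and $m_1\ne n_1$. 2) If $n=1$, $m_1\ne n_1$ and $m_1+n_1>1$, then $\mathfrak g$ is a maximal Lie subsuperalgebra of $\mathfrak{gl}(V)$. In this case the Lie superalgebra $\mathfrak{sg}:=\mathfrak{gl}(V_1)\otimes\Lambda(1)\rtimes\mathrm{Span}(\partial)$ is maximal in $\mathfrak{sl}(V)$.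
   Context: The superdimension of $V=V_{\bar0}\oplus V_{\bar1}$ is written $\dim V=\dim V_{\bar0}+\varepsilon\dim V_{\bar1}$, $\varepsilon^2=1$. $\Lambda(n)=\Lambda(\xi_1,\dots,\xi_n)$ is the Grassmann superalgebra, $\mathfrak{vect}(0|n)=\mathfrak{der}\,\Lambda(n)$, and for $n=1$, $\partial=\partial_{\xi}$. $\mathfrak a\rtimes\mathfrak b$ denotes a semidirect sum with ideal $\mathfrak a$. $\mathfrak g$ is the semidirect sum of the ideal $\mathfrak{gl}(V_1)\otimes\Lambda(n)$ and $\mathfrak{vect}(0|n)$ with natural action on the ideal; it is identified with its image in $\mathfrak{gl}(V)$ under the faithful representation $(A\otimes\varphi)(v\otimes\psi)=(-1)^{p(\varphi)p(v)}Av\otimes\varphi\psi$, $D(v\otimes\psi)=(-1)^{p(D)p(v)}v\otimes D(\psi)$. $\mathfrak{sl}(V)$ consists of the operators with zero supertrace. Maximal means proper and not contained in a strictly larger proper Lie subsuperalgebra. *)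

(* Defs.v *)
From HB Require Import structures.
From mathcomp Require Import all_boot all_order all_algebra.
From mathcomp Require Export complex reals.

Set Implicit Arguments.
Unset Strict Implicit.
Unset Printing Implicit Defensive.

Import GRing.Theory.
Local Open Scope ring_scope.

(* The parity is a boolean: false is the even part, true the odd part, and
   addition of parities is (+). *)
Record superspace (F : fieldType) := Superspace {
  scarrier :> vectType F;
  part : bool -> {vspace scarrier};
  part_add : (part false + part true = fullv)%VS;
  part_cap : (part false :&: part true = 0)%VS }.
Arguments part {F} s a.

Section LinearMaps.
Variables (F : fieldType) (aT rT : vectType F).

Lemma linfunE (f : aT -> rT) : linear f -> linfun f =1 f.
Proof.
move=> lf v; pose L : {linear aT -> rT} :=
  HB.pack f (GRing.isLinear.Build F aT rT *:%R f lf).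
exact: (lfunE L v).
Qed.

Lemma memv_bigcap (I : finType) (U : I -> {vspace aT}) v :
  reflect (forall i, v \in U i) (v \in \bigcap_i U i)%VS.
Proof.
rewrite memvE; apply: (iffP subv_bigcapP) => H i.
  by rewrite memvE; apply: H.
by move=> _; rewrite -memvE; apply: H.
Qed.
End LinearMaps.

Section Projections.
Variables (F : fieldType) (V : superspace F).

Definition proj (a : bool) : 'End(V) := daddv_pi (part V a) (part V (~~ a)).

Lemma part_capN a : (part V a :&: part V (~~ a) = 0)%VS.
Proof. by case: a; rewrite /= ?part_cap // capvC part_cap. Qed.

Lemma part_addN a : (part V a + part V (~~ a) = fullv)%VS.
Proof. by case: a; rewrite /= ?part_add // addvC part_add. Qed.

Lemma proj_in a v : proj a v \in part V a.
Proof. exact: memv_pi. Qed.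

Lemma proj_add a v : proj a v + proj (~~ a) v = v.
Proof.
rewrite /proj negbK daddv_pi_add ?part_capN //.
by rewrite part_addN memvf.
Qed.

Lemma proj_id a v : v \in part V a -> proj a v = v.
Proof. by move=> va; rewrite /proj daddv_pi_id ?part_capN. Qed.

Lemma proj_N a v : v \in part V a -> proj (~~ a) v = 0.
Proof.
by move=> va; apply: (addrI (proj a v)); rewrite proj_add addr0 proj_id.
Qed.

Lemma proj_eq0 a v : (proj (~~ a) v == 0) = (v \in part V a).
Proof.
apply/eqP/idP => [v0|/proj_N //].
by rewrite -(proj_add a v) v0 addr0 proj_in.
Qed.

(* signop a v = (-1) ^ (a p(v)) v for homogeneous v *)
Definition signop (a : bool) : 'End(V) := proj false + (-1) ^+ a *: proj true.

Lemma signopE a b v : v \in part V b -> signop a v = (-1) ^+ (a && b) *: v.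
Proof.
rewrite /signop add_lfunE scale_lfunE; case: b => vb.
  by rewrite (proj_N vb) (proj_id vb) add0r andbT.
by rewrite (proj_N vb) (proj_id vb) scaler0 addr0 andbF expr0 scale1r.
Qed.

End Projections.

(* gl(V) = End V: an operator has parity a when it maps V_b to V_{a+b}, that
   is, when its block from V_b to V_{a+b+1} vanishes for both b. *)
Section GeneralLinear.
Variables (F : fieldType) (V : superspace F).

Definition gl_part (a : bool) : {vspace 'End(V)} :=
  (\bigcap_(b : bool)
     lker (linfun (fun f : 'End(V) =>
                     (proj V (~~ (a (+) b)) \o f \o proj V b)%VF)))%VS.

Lemma gl_partP a (f : 'End(V)) :
  f \in gl_part a <->
  (forall b v, v \in part V b -> f v \in part V (a (+) b)).
Proof.
have lin b : linear (fun f : 'End(V) =>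
    (proj V (~~ (a (+) b)) \o f \o proj V b)%VF).
  move=> c u w; apply/lfunP => v.
  by rewrite !(comp_lfunE, add_lfunE, scale_lfunE, linearP).
split=> [/memv_bigcap fa b v vb | fa].
  move: (fa b); rewrite memv_ker linfunE // => /eqP/lfunP/(_ v).
  rewrite !comp_lfunE zero_lfunE (proj_id vb) => /eqP.
  by rewrite proj_eq0.
apply/memv_bigcap => b; rewrite memv_ker linfunE //; apply/eqP/lfunP => v.
rewrite !comp_lfunE zero_lfunE; apply/eqP; rewrite proj_eq0.
by apply: fa; apply: proj_in.
Qed.

Lemma gl_part_add : (gl_part false + gl_part true = fullv)%VS.
Proof.
apply/eqP; rewrite eqEsubv subvf; apply/subvP => f _.
pose h a := \sum_(b : bool) (proj V (a (+) b) \o f \o proj V b)%VF.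
have hP a : h a \in gl_part a.
  apply/gl_partP => b v vb; rewrite /h sum_lfunE; apply: rpred_sum => c _.
  rewrite !comp_lfunE; have [->|/negP nbc] := eqVneq c b; first exact: proj_in.
  have -> : c = ~~ b by case: (c) (b) nbc => [] [].
  by rewrite (proj_N vb) !linear0 mem0v.
have -> : f = h false + h true.
  apply/lfunP => v; rewrite add_lfunE /h !sum_lfunE !big_bool !comp_lfunE /=.
  rewrite -[in LHS](proj_add false v) linearD /=.
  rewrite -[in LHS](proj_add false (f (proj V false v))).
  rewrite -[in LHS](proj_add true (f (proj V true v))) /=.
  by rewrite addrACA; congr (_ + _); rewrite addrC.
by rewrite memv_add.
Qed.

Lemma gl_part_cap : (gl_part false :&: gl_part true = 0)%VS.
Proof.
apply/eqP; rewrite -subv0; apply/subvP => f /memv_capP[/gl_partP f0 /gl_partP f1].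
rewrite memv0; apply/eqP/lfunP => v; rewrite zero_lfunE.
have z b w : w \in part V b -> f w = 0.
  move=> wb; apply/eqP; rewrite -memv0 -(part_capN V b) memv_cap.
  by move: (f0 b w wb) (f1 b w wb) => /= -> ->.
rewrite -(proj_add false v) linearD /=.
by rewrite (z _ _ (proj_in false v)) (z _ _ (proj_in true v)) addr0.
Qed.

Definition gl : superspace F := Superspace gl_part_add gl_part_cap.

(* supercommutator of operators of parities a and b *)
Definition sbracket (a b : bool) (f g : gl) : gl :=
  (f \o g - (-1) ^+ (a && b) *: (g \o f))%VF.

(* trace of the diagonal block V_a -> V_a *)
Definition block_trace (a : bool) (f : gl) : F :=
  \sum_(i < \dim (part V a))
     coord (vbasis (part V a)) i (proj V a (f (vbasis (part V a))`_i)).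

Definition supertrace (f : gl) : F^o := block_trace false f - block_trace true f.

Definition sl : {vspace gl} := lker (linfun supertrace).

Lemma mem_sl (f : gl) : (f \in sl) = (supertrace f == 0).
Proof.
have lin a : scalar (block_trace a).
  move=> c u w; rewrite /block_trace mulr_sumr -big_split /=.
  by apply: eq_bigr => i _; rewrite add_lfunE scale_lfunE !linearP.
rewrite memv_ker linfunE // => c u w.
by rewrite /supertrace !lin opprD addrACA -mulrBr.
Qed.

Definition Lie_subsuperalgebra (U : {vspace gl}) : Prop :=
  (U = U :&: part gl false + U :&: part gl true)%VS /\
  (forall a b f g, f \in (U :&: part gl a)%VS -> g \in (U :&: part gl b)%VS ->
     sbracket a b f g \in U).

(* U is maximal among the proper Lie subsuperalgebras of G. *)
Definition maximal_Lie_subsuperalgebra (U G : {vspace gl}) : Prop :=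
  [/\ Lie_subsuperalgebra U, (U <= G)%VS, U <> G &
      forall W : {vspace gl}, Lie_subsuperalgebra W ->
        (U <= W)%VS -> (W <= G)%VS -> W = U \/ W = G].

End GeneralLinear.
Arguments maximal_Lie_subsuperalgebra {F} V U G.

(* An element of E (x) Lambda(n) is w = \sum_I w_I (x) xi_I, encoded by the
   family of its coefficients w_I; here xi_I is the product of the xi_i, i in I,
   in increasing order. *)
Section TensorGrassmann.
Variables (F : fieldType) (E : superspace F) (n : nat).
Let T : vectType F := {ffun {set 'I_n} -> E}.

Definition tens_part (c : bool) : {vspace T} :=
  (\bigcap_(I : {set 'I_n})
     linfun (fun w : T => w I) @^-1: part E (c (+) odd #|I|))%VS.

Lemma tens_partP c (w : T) :
  w \in tens_part c <-> forall I : {set 'I_n}, w I \in part E (c (+) odd #|I|).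
Proof.
have E1 (I : {set 'I_n}) : linear (fun w : T => w I) by move=> a u v; rewrite !ffunE.
split=> [/memv_bigcap H I|H].
  by have := H I; rewrite -memv_preim linfunE.
by apply/memv_bigcap => I; rewrite -memv_preim linfunE.
Qed.

Lemma tens_part_add : (tens_part false + tens_part true = fullv)%VS.
Proof.
apply/eqP; rewrite eqEsubv subvf; apply/subvP => w _.
pose h c : T := [ffun I : {set 'I_n} => proj E (c (+) odd #|I|) (w I)].
have -> : w = h false + h true.
  by apply/ffunP => I; rewrite !ffunE /= proj_add.
by apply: memv_add; apply/tens_partP => I; rewrite ffunE proj_in.
Qed.

Lemma tens_part_cap : (tens_part false :&: tens_part true = 0)%VS.
Proof.
apply/eqP; rewrite -subv0; apply/subvP => w /memv_capP[/tens_partP w0 /tens_partP w1].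
rewrite memv0; apply/eqP/ffunP => I; rewrite ffunE; apply/eqP.
by rewrite -memv0 -(part_capN E (odd #|I|)) memv_cap; move: (w0 I) (w1 I) => /= -> ->.
Qed.

Definition tensL : superspace F := Superspace tens_part_add tens_part_cap.
Definition coefL (w : tensL) (I : {set 'I_n}) : E := (w : T) I.

End TensorGrassmann.

Section Grassmann.
Variables (F : fieldType) (n : nat).

Definition line_part (a : bool) : {vspace F^o} := if a then 0%VS else fullv.

Lemma line_part_add : (line_part false + line_part true = fullv)%VS.
Proof. exact: addv0. Qed.

Lemma line_part_cap : (line_part false :&: line_part true = 0)%VS.
Proof. exact: capv0. Qed.

Definition Lambda : superspace F :=
  tensL (Superspace line_part_add line_part_cap) n.

Definition xi (I : {set 'I_n}) : Lambda := [ffun J => (J == I)%:R].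

(* xi_I xi_J = (-1) ^ (inversions I J) xi_(I :|: J) for disjoint I and J *)
Definition inversions (I J : {set 'I_n}) : nat :=
  #|[set ij in setX I J | (ij.2 < ij.1)%N]|.

Definition gmul (phi psi : Lambda) : Lambda :=
  [ffun K : {set 'I_n} => \sum_(I : {set 'I_n} | I \subset K)
     (-1) ^+ inversions I (K :\: I) * (coefL phi I * coefL psi (K :\: I))].

(* The Leibniz rule for a superderivation of parity a; by bilinearity it is
   enough to impose it on the xi_I, see vectP. *)
Definition leibniz_defect (a : bool) (phi psi : Lambda) (D : gl Lambda) : Lambda :=
  D (gmul phi psi) - (gmul (D phi) psi
    + gmul (signop Lambda a phi) (D psi)).

Definition vect (a : bool) : {vspace gl Lambda} :=
  (part (gl Lambda) a :&:
   \bigcap_(I : {set 'I_n}) \bigcap_(J : {set 'I_n})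
      lker (linfun (leibniz_defect a (xi I) (xi J))))%VS.

Lemma coefL_lin (E : superspace F) (c : F) (u w : tensL E n) I :
  coefL (c *: u + w) I = c *: coefL u I + coefL w I.
Proof. by rewrite /coefL !ffunE. Qed.

Lemma coefL_gmul phi psi K :
  coefL (gmul phi psi) K = \sum_(I : {set 'I_n} | I \subset K)
     (-1) ^+ inversions I (K :\: I) * (coefL phi I * coefL psi (K :\: I)).
Proof. by rewrite /coefL ffunE. Qed.

Lemma gmul_linl psi : linear (gmul^~ psi).
Proof.
move=> c u w; apply/ffunP => K; rewrite !ffunE scaler_sumr -big_split /=.
apply: eq_bigr => I _; rewrite coefL_lin mulrDl mulrDr; congr (_ + _).
by rewrite /GRing.scale /= -mulrA mulrCA.
Qed.

Lemma gmul_linr phi : linear (gmul phi).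
Proof.
move=> c u w; apply/ffunP => K; rewrite !ffunE scaler_sumr -big_split /=.
apply: eq_bigr => I _; rewrite coefL_lin mulrDr mulrDr; congr (_ + _).
by rewrite /GRing.scale /= !(mulrCA c).
Qed.

Lemma gmulZl c phi psi : gmul (c *: phi) psi = c *: gmul phi psi.
Proof. by rewrite -!(linfunE (gmul_linl psi)) linearZ. Qed.

Lemma Lambda_decomp (phi : Lambda) :
  phi = \sum_(I : {set 'I_n}) coefL phi I *: xi I.
Proof.
apply/ffunP => K; rewrite sum_ffunE (bigD1 K) //= !ffunE eqxx.
rewrite big1 ?addr0; first by rewrite /GRing.scale /= mulr1.
by move=> I IK; rewrite !ffunE eq_sym (negPf IK) scaler0.
Qed.

Lemma xi_part I : xi I \in part Lambda (odd #|I|).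
Proof.
apply/tens_partP => J; rewrite ffunE; case: eqVneq => [->|_]; last exact: mem0v.
by rewrite addbb memvf.
Qed.

Lemma vectP a (D : gl Lambda) :
  D \in vect a <->
  D \in part (gl Lambda) a /\
  (forall b phi psi, phi \in part Lambda b ->
     D (gmul phi psi) =
     gmul (D phi) psi + (-1) ^+ (a && b) *: gmul phi (D psi)).
Proof.
have addK4 (x y z x' y' z' : Lambda) :
    (x + x') - ((y + y') + (z + z')) = (x - (y + z)) + (x' - (y' + z')).
  by rewrite [y + y' + _]addrACA opprD addrACA.
have linD phi psi : linear (leibniz_defect a phi psi).
  move=> c u w; rewrite /leibniz_defect !add_lfunE !scale_lfunE.
  by rewrite gmul_linl gmul_linr addK4 scalerBr scalerDr.
have linl psi : linear (fun phi => leibniz_defect a phi psi D).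
  move=> c u w; rewrite /leibniz_defect gmul_linl !linearP !gmul_linl.
  by rewrite addK4 scalerBr scalerDr.
have linr phi : linear (fun psi => leibniz_defect a phi psi D).
  move=> c u w; rewrite /leibniz_defect gmul_linr !linearP !gmul_linr.
  by rewrite addK4 scalerBr scalerDr.
split=> [/memv_capP[Da H] | [Da H]].
  have H0 I J : leibniz_defect a (xi I) (xi J) D = 0.
    by move/memv_bigcap/(_ I)/memv_bigcap/(_ J): H; rewrite memv_ker linfunE // => /eqP.
  have H1 I psi : leibniz_defect a (xi I) psi D = 0.
    rewrite -(linfunE (linr (xi I))) [psi]Lambda_decomp linear_sum big1 // => J _.
    by rewrite linearZ /= (linfunE (linr (xi I))) H0 scaler0.
  have H2 phi psi : leibniz_defect a phi psi D = 0.
    rewrite -(linfunE (linl psi)) [phi]Lambda_decomp linear_sum big1 // => I _.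
    by rewrite linearZ /= (linfunE (linl psi)) H1 scaler0.
  split=> // b phi psi phib; move/eqP: (H2 phi psi).
  by rewrite subr_eq0 (signopE _ phib) gmulZl => /eqP.
apply/memv_capP; split=> //; apply/memv_bigcap => I; apply/memv_bigcap => J.
rewrite memv_ker linfunE // /leibniz_defect (H _ _ _ (xi_part I)).
by rewrite (signopE _ (xi_part I)) gmulZl subrr.
Qed.

End Grassmann.
Arguments vect {F} n a.

(* The ideal gl(V1) (x) Lambda(n) and the subalgebra vect(0|n) acting on
   V1 (x) Lambda(n); see rho_glE and rho_vectE. *)
Section Representation.
Variables (F : fieldType) (V1 : superspace F) (n : nat).

Definition pure (E : superspace F) (v : E) (phi : Lambda F n) : tensL E n :=
  [ffun I : {set 'I_n} => coefL phi I *: v].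

Lemma coefL_pure (E : superspace F) (v : E) phi I :
  coefL (pure v phi) I = coefL phi I *: v.
Proof. by rewrite /coefL ffunE. Qed.

Definition rho_gl_fun (X : tensL (gl V1) n) (w : tensL V1 n) : tensL V1 n :=
  [ffun K : {set 'I_n} => \sum_(I : {set 'I_n} | I \subset K)
     (-1) ^+ inversions I (K :\: I) *:
       coefL X I (signop V1 (odd #|I|) (coefL w (K :\: I)))].

Definition rho_gl (X : tensL (gl V1) n) : gl (tensL V1 n) :=
  linfun (rho_gl_fun X).

Definition rho_vect_fun (a : bool) (D : gl (Lambda F n)) (w : tensL V1 n) :
    tensL V1 n :=
  \sum_(J : {set 'I_n}) pure (signop V1 a (coefL w J)) (D (xi F J)).

Definition rho_vect (a : bool) (D : gl (Lambda F n)) : gl (tensL V1 n) :=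
  linfun (rho_vect_fun a D).

Lemma rho_gl_fun_lin X : linear (rho_gl_fun X).
Proof.
move=> c u w; apply/ffunP => K; rewrite !ffunE scaler_sumr -big_split /=.
by apply: eq_bigr => I _; rewrite coefL_lin !linearP.
Qed.

Lemma rho_gl_lin : linear rho_gl.
Proof.
move=> c X Y; apply/lfunP => w; rewrite add_lfunE scale_lfunE.
rewrite !(linfunE (rho_gl_fun_lin _)); apply/ffunP => K.
rewrite !ffunE scaler_sumr -big_split /=; apply: eq_bigr => I _.
by rewrite coefL_lin add_lfunE scale_lfunE scalerDr !scalerA [_ * c]mulrC.
Qed.

Lemma rho_glE a b (A : gl V1) (phi psi : Lambda F n) (v : V1) :
  phi \in part (Lambda F n) b -> v \in part V1 a ->
  rho_gl (pure (A : gl V1) phi) (pure v psi) =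
    (-1) ^+ (b && a) *: pure (A v) (gmul phi psi).
Proof.
move=> /tens_partP phib va; rewrite (linfunE (rho_gl_fun_lin _)).
apply/ffunP => K; rewrite !ffunE coefL_gmul scaler_suml scaler_sumr.
apply: eq_bigr => I _; rewrite !coefL_pure linearZ /= (signopE _ va).
rewrite scale_lfunE !linearZ /= !scalerA.
have [->|nz] := eqVneq (coefL phi I) 0; first by rewrite !(mul0r, mulr0, scale0r).
have -> : odd #|I| = b.
  move: (phib I) nz; rewrite -/(coefL phi I) /=; case: b {phib}; case: odd => //=;
  by rewrite memv0 => /eqP ->; rewrite eqxx.
by congr (_ *: _); rewrite mulrAC; congr (_ * _); rewrite mulrC.
Qed.

Lemma rho_vect_fun_lin a D : linear (rho_vect_fun a D).
Proof.
move=> c u w; rewrite /rho_vect_fun scaler_sumr -big_split /=.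
apply: eq_bigr => J _; apply/ffunP => K; rewrite !ffunE.
by rewrite coefL_lin !linearP.
Qed.

Lemma rho_vect_lin a : linear (rho_vect a).
Proof.
move=> c X Y; apply/lfunP => w; rewrite add_lfunE scale_lfunE.
rewrite !(linfunE (rho_vect_fun_lin _ _)) /rho_vect_fun scaler_sumr -big_split /=.
apply: eq_bigr => J _; apply/ffunP => K; rewrite !ffunE.
by rewrite add_lfunE scale_lfunE coefL_lin scalerDl scalerA.
Qed.

Lemma rho_vectE a b (D : gl (Lambda F n)) (psi : Lambda F n) (v : V1) :
  v \in part V1 b ->
  rho_vect a D (pure v psi) = (-1) ^+ (a && b) *: pure v (D psi).
Proof.
move=> vb; rewrite (linfunE (rho_vect_fun_lin _ _)) /rho_vect_fun.
apply/ffunP => K; rewrite sum_ffunE [in RHS](Lambda_decomp psi) linear_sum.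
rewrite !ffunE {2}/coefL sum_ffunE scaler_suml scaler_sumr.
apply: eq_bigr => J _; rewrite ffunE coefL_pure linearZ /= (signopE _ vb).
have -> : D (coefL psi J *: xi F J) K = coefL psi J * coefL (D (xi F J)) K.
  by rewrite linearZ /= /coefL; move: (D _) => w; rewrite ffunE.
by rewrite !scalerA; congr (_ *: _); rewrite [RHS]mulrC; congr (_ * _); rewrite mulrC.
Qed.

(* Image in gl(V1 (x) Lambda(n)) of the semidirect sum of gl(V1) (x) Lambda(n)
   and vect(0|n). *)
Definition g_algebra : {vspace gl (tensL V1 n)} :=
  (limg (linfun rho_gl)
   + \sum_(a : bool) linfun (rho_vect a) @: vect n a)%VS.

End Representation.

Section OneVariable.
Variables (F : fieldType) (V1 : superspace F).

(* partial (c + d xi) = d *)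
Definition partial : gl (Lambda F 1) :=
  linfun (fun phi : Lambda F 1 => coefL phi [set: 'I_1] *: xi F (set0 : {set 'I_1})).

Definition sg_algebra : {vspace gl (tensL V1 1)} :=
  (limg (linfun (@rho_gl F V1 1)) + <[rho_vect V1 true partial]>)%VS.

End OneVariable.

(* Main.v *)
Require Import Defs.
From mathcomp Require Import all_boot all_order all_algebra.
From mathcomp Require Import complex reals.
From Stdlib Require Import Classical.

Set Implicit Arguments.
Unset Strict Implicit.
Unset Printing Implicit Defensive.

Import GRing.Theory.
Local Open Scope ring_scope.

(** Let W be a Lie subsuperalgebra that contains g. Along a homogeneous basis
    (e_a) of V1 an operator on V is a matrix of blocks in End Lambda(n), and g
    can be recognized from the blocks (block_g_off, block_g_diag, g_of_blocks):
    the off-diagonal ones are multiplications by elements of Lambda(n), the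
    diagonal ones normalize Lambda(n) in End Lambda(n) and, up to the grading
    automorphism, agree modulo multiplications. This uses that the normalizer
    of Lambda(n) is Lambda(n) + vect(0|n) (normalizes_decomp).

    Maximality says that any operator of W outside g drags sl(V) into W. The
    tool is a minimality argument (minimal_outside). The superbrackets with the
    multiplications xi_i and the derivations del_i, which generate End
    Lambda(n), anticommute and square to zero; so every operator outside a
    subspace stable under them can be replaced by one that all these brackets
    send into the subspace. Such operators are explicit: when the subspace is
    Lambda(n), they are the constant vector fields modulo Lambda(n)
    (first_order).

    Suppose that two basis vectors e_a, e_b have the same parity
    (sl_or_g_same_parity). The idempotents e_aa (x) 1 cut out the off-diagonal
    blocks of elements of W. If all these blocks are multiplications, brackets
    with e_cd (x) phi compare the diagonal blocks and show that W is contained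
    in g. Otherwise an off-diagonal block yields a constant vector field, hence
    all e_ab (x) del_i. Since a and b have the same parity, (e_bb - e_aa) (x)
    del_i is odd and its bracket with e_ab (x) D is, up to sign, e_ab (x) D'
    with the Jordan-type product D' = del_i D + tau(D) del_i. Iterating it from
    1 gives del_1 ... del_n, a matrix unit of Lambda(n); multiplications on the
    two sides turn it into all the matrix units, and these generate sl(V)
    (sl_sub_munit). When dim V1 = 1 (sl_or_g_line) the same minimality argument
    is applied to the normalizer: an operator outside it yields some del_j
    del_k, then the operators xi_q del_q del_m, and again del_1 ... del_n.

    When dim V1 = 1 + epsilon, no two basis vectors have the same parity, and
    for eta the odd nilpotent matrix unit the span of g and of eta (x)
    vect(0|n) is a Lie subsuperalgebra, because the superbracket of eta with
    gl(V1) lies in the span of eta and 1 (g_ext_Lie); its intersection with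
    sl(V) lies strictly between g and sl(V).

    Finally the supertrace is multiplicative on tensor products
    (supertrace_tens). It vanishes on multiplications for n >= 1 and on
    vect(0|n) for n >= 2, whereas xi del has supertrace -1 for n = 1. So g is
    contained in sl(V) unless n = 1 and m1 <> n1, in which case sg is the
    intersection of g and sl(V), and the argument with two basis vectors of the
    same parity applies to it as well. *)

Definition lfun_ev := (add_lfunE, opp_lfunE, scale_lfunE, comp_lfunE, id_lfunE, zero_lfunE).

(** * The grading automorphism *)

Section Parity.
Variables (F : fieldType) (V : superspace F).

Lemma part_zero b (v : V) : v \in part V b -> v \in part V (~~ b) -> v = 0.
Proof.
by move=> vb vnb; apply/eqP; rewrite -memv0 -(part_capN V b) memv_cap vb.
Qed.

Lemma signop_invol (v : V) : signop V true (signop V true v) = v.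
Proof.
rewrite -(proj_add false v) !linearD /=.
have pe := signopE true (proj_in false v).
have po := signopE true (proj_in true v).
rewrite pe po !linearZ /= pe po !scalerA -!exprD /=.
by rewrite expr0 sqrrN expr1n !scale1r.
Qed.

Lemma signop_false : signop V false = \1%VF.
Proof.
apply/lfunP => v; rewrite /signop expr0 scale1r add_lfunE id_lfunE.
exact: proj_add.
Qed.

Lemma signop_signop a b : (signop V a \o signop V b)%VF = signop V (a (+) b).
Proof.
apply/lfunP => v; rewrite comp_lfunE.
case: a; case: b; rewrite ?signop_false ?id_lfunE //=.
by rewrite signop_invol.
Qed.

Fact sgn_key : unit. Proof. exact: tt. Qed.
(** Locked, because simplification would otherwise unfold the parity operator
    into projections. *)
Definition sgn : 'End(V) := locked_with sgn_key (signop V true).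

Lemma sgn_def : signop V true = sgn.
Proof. by rewrite /sgn unlock. Qed.

Lemma sgnE b v : v \in part V b -> sgn v = (-1) ^+ b *: v.
Proof. by rewrite -sgn_def; exact: signopE. Qed.

Lemma sgn_invol (v : V) : sgn (sgn v) = v.
Proof. by rewrite -sgn_def signop_invol. Qed.

Lemma sgn_sgn : (sgn \o sgn)%VF = \1%VF.
Proof. by apply/lfunP => v; rewrite comp_lfunE sgn_invol id_lfunE. Qed.

(** The automorphism of gl(V) which is (-1)^a on the operators of parity a
    (tau_part). It states sign rules for operators without a definite parity:
    the superbracket of an odd u with any x is u x - tau(x) u. *)
Definition tau (f : 'End(V)) : 'End(V) :=
  locked_with sgn_key (sgn \o f \o sgn)%VF.

Lemma tau_def f : tau f = (sgn \o f \o sgn)%VF.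
Proof. by rewrite /tau unlock. Qed.

Lemma tauE f v : tau f v = sgn (f (sgn v)).
Proof. by rewrite tau_def !comp_lfunE. Qed.

Lemma tau_linear : linear tau.
Proof.
move=> c f g; apply/lfunP => v; rewrite !(tauE, add_lfunE, scale_lfunE).
by rewrite linearD linearZ.
Qed.

Lemma tauD f g : tau (f + g) = tau f + tau g.
Proof. by move: (tau_linear 1 f g); rewrite !scale1r. Qed.

Lemma tau0 : tau 0 = 0.
Proof. by apply/lfunP => v; rewrite tauE !lfun_ev linear0. Qed.

Lemma tauZ c f : tau (c *: f) = c *: tau f.
Proof. by move: (tau_linear c f 0); rewrite tau0 !addr0. Qed.

Lemma tauN f : tau (- f) = - tau f.
Proof. by rewrite -scaleN1r tauZ scaleN1r. Qed.

Lemma tauB f g : tau (f - g) = tau f - tau g.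
Proof. by rewrite tauD tauN. Qed.

Lemma tau_comp f g : tau (f \o g)%VF = (tau f \o tau g)%VF.
Proof.
by apply/lfunP => v; rewrite !(comp_lfunE, tauE) sgn_invol.
Qed.

Lemma tauK f : tau (tau f) = f.
Proof. by apply/lfunP => v; rewrite !tauE !sgn_invol. Qed.

Lemma tau_part a (f : gl V) : f \in part (gl V) a -> tau f = (-1) ^+ a *: f.
Proof.
move=> /gl_partP fa; apply/lfunP => v; rewrite tauE scale_lfunE.
have hom b w : w \in part V b ->
    sgn (f (sgn w)) = (-1) ^+ a *: f w.
  move=> wb; rewrite (sgnE wb) linearZ /= linearZ /= (sgnE (fa _ _ wb)).
  by rewrite scalerA -signr_addb addbCA addbb addbF.
by rewrite -(proj_add false v) !linearD /= !(hom _ _ (proj_in _ _)).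
Qed.

Lemma comp_part a b (f g : gl V) :
  f \in part (gl V) a -> g \in part (gl V) b ->
  ((f \o g)%VF : gl V) \in part (gl V) (a (+) b).
Proof.
move=> /gl_partP fa /gl_partP gb; apply/gl_partP => c v vc.
by rewrite comp_lfunE -addbA; apply/fa/gb.
Qed.

Lemma id_part : (\1%VF : gl V) \in part (gl V) false.
Proof. by apply/gl_partP => c v vc; rewrite id_lfunE. Qed.

Lemma sgn_part : (sgn : gl V) \in part (gl V) false.
Proof. by apply/gl_partP => c v vc; rewrite (sgnE vc) memvZ. Qed.

Lemma signop_part a : (signop V a : gl V) \in part (gl V) false.
Proof. by apply/gl_partP => c v vc; rewrite (signopE _ vc) memvZ. Qed.

Lemma proj_part a b (f : gl V) :
  f \in part (gl V) b -> proj (gl V) a f = if a == b then f else 0.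
Proof.
move=> fb; case: eqP => [->|/eqP ab]; first exact: proj_id.
by rewrite (_ : a = ~~ b) ?proj_N //; case: (a) (b) ab => [] [].
Qed.

Lemma sum_proj (f : gl V) : f = proj (gl V) false f + proj (gl V) true f.
Proof. by rewrite (proj_add false). Qed.

(** In characteristic different from 2 the parity of an operator is its
    eigenvalue under tau. *)
Lemma part_of_tau (two : 2 != 0 :> F) (a : bool) (f : 'End(V)) :
  tau f = (-1) ^+ a *: f -> (f : gl V) \in part (gl V) a.
Proof.
move=> tf; rewrite -(proj_eq0 a (f : gl V)).
have : tau f = (-1) ^+ a *: proj (gl V) a f + (-1) ^+ (~~ a) *: proj (gl V) (~~ a) f.
  by rewrite {1}(esym (proj_add a (f : gl V))) tauD !(tau_part (proj_in _ _)).
rewrite tf {1}(esym (proj_add a (f : gl V))) scalerDr => /addrI /eqP.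
rewrite -subr_eq0 -scalerBl signrN opprK -mulr2n scaler_eq0.
by rewrite -mulr_natr mulf_eq0 signr_eq0 (negPf two).
Qed.

Lemma proj_tau (two : 2 != 0 :> F) a (x : 'End(V)) :
  proj (gl V) a x = 2^-1 *: (x + (-1) ^+ a *: tau x).
Proof.
have e : tau x = proj (gl V) false x - proj (gl V) true x.
  by rewrite {1}(sum_proj x) tauD !(tau_part (proj_in _ _)) expr0 scale1r scaleN1r.
have -> : x + (-1) ^+ a *: tau x = 2 *: proj (gl V) a x.
  rewrite e {1}(sum_proj x) scaler_nat mulr2n.
  case: (a); first by rewrite expr1 scaleN1r opprB [X in X + _]addrC addrACA subrr addr0.
  by rewrite expr0 scale1r addrACA subrr addr0.
by rewrite scalerA mulVf // scale1r.
Qed.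

End Parity.

(** * Brackets inside a Lie subsuperalgebra *)

Section SubLie.
Variables (F : fieldType) (V : superspace F) (W : {vspace gl V}).

Definition graded : Prop := forall a f, f \in W -> proj (gl V) a f \in W.

Lemma gradedP :
  (W = W :&: part (gl V) false + W :&: part (gl V) true)%VS <-> graded.
Proof.
split=> [eW a f | gr].
  rewrite {1}eW => /memv_addP[f0 + [f1 + ->]].
  move=> /memv_capP[f0W f0p] /memv_capP[f1W f1p]; rewrite linearD /=.
  by rewrite (proj_part a f0p) (proj_part a f1p) memvD //; case: eqP; rewrite // mem0v.
apply/eqP; rewrite eqEsubv subv_add !capvSl /= andbT; apply/subvP => f fW.
rewrite (sum_proj f); apply: memv_add; apply/memv_capP;
  by split; [exact: gr | exact: (@proj_in _ (gl V))].
Qed.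

Hypothesis LW : Lie_subsuperalgebra W.

Lemma Lie_graded : graded. Proof. by apply/gradedP; case: LW. Qed.

Lemma Lie_bracket a b (f g : gl V) :
  f \in W -> f \in part (gl V) a -> g \in W -> g \in part (gl V) b ->
  sbracket a b f g \in W.
Proof. by case: LW => _ H *; apply: H; apply/memv_capP. Qed.

Lemma Lie_tau (f : gl V) : f \in W -> (tau f : gl V) \in W.
Proof.
move=> fW; rewrite (sum_proj f) tauD.
by rewrite !(tau_part (proj_in _ _)) memvD // memvZ // Lie_graded.
Qed.

Lemma Lie_even (u x : gl V) : u \in W -> u \in part (gl V) false -> x \in W ->
  ((u \o x)%VF - (x \o u)%VF : gl V) \in W.
Proof.
move=> uW u0 xW; have B b := Lie_bracket uW u0 (Lie_graded b xW) (proj_in b x).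
suff -> : ((u \o x)%VF - (x \o u)%VF : gl V) =
    sbracket false false u (proj (gl V) false x) +
    sbracket false true u (proj (gl V) true x) by rewrite memvD.
rewrite {1 2}(sum_proj x) /sbracket /= expr0 !scale1r.
by rewrite comp_lfunDl comp_lfunDr opprD addrACA.
Qed.

Lemma Lie_odd (u x : gl V) : u \in W -> u \in part (gl V) true -> x \in W ->
  ((u \o x)%VF - (tau x \o u)%VF : gl V) \in W.
Proof.
move=> uW u0 xW; have B b := Lie_bracket uW u0 (Lie_graded b xW) (proj_in b x).
suff -> : ((u \o x)%VF - (tau x \o u)%VF : gl V) =
    sbracket true false u (proj (gl V) false x) +
    sbracket true true u (proj (gl V) true x) by rewrite memvD.
rewrite {1 2}(sum_proj x) /sbracket /= expr0 expr1 tauD.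
rewrite !(tau_part (proj_in _ _)) expr0 expr1 !scale1r !scaleN1r.
by rewrite comp_lfunDl comp_lfunDr opprD addrACA comp_lfunNl.
Qed.

(** The twist of x in its superbracket with an operator of parity a. *)
Definition itau (a : bool) (f : 'End(V)) : 'End(V) := if a then tau f else f.

Lemma Lie_ad a (u x : gl V) : u \in W -> u \in part (gl V) a -> x \in W ->
  ((u \o x)%VF - (itau a x \o u)%VF : gl V) \in W.
Proof. by case: a => uW ua xW; [exact: Lie_odd | exact: Lie_even]. Qed.

Lemma Lie_left a (u x : gl V) : u \in W -> u \in part (gl V) a -> x \in W ->
  (itau a x \o u)%VF = 0 -> ((u \o x)%VF : gl V) \in W.
Proof. by move=> uW ua xW z; have := Lie_ad uW ua xW; rewrite z subr0. Qed.

Lemma Lie_right a (u x : gl V) : u \in W -> u \in part (gl V) a -> x \in W ->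
  (u \o itau a x)%VF = 0 -> ((x \o u)%VF : gl V) \in W.
Proof.
move=> uW ua xW z; have tW : (itau a x : gl V) \in W by case: (a); [exact: Lie_tau |].
have := Lie_ad uW ua tW; rewrite z sub0r memvN.
by rewrite (_ : itau a (itau a x) = x) // /itau; case: (a); rewrite ?tauK.
Qed.

(** The corner p f q is a combination of iterated brackets of f with the two
    idempotents, once 2 is invertible. *)
Lemma Lie_corner (two : 2 != 0 :> F) (p q f : gl V) :
  p \in W -> p \in part (gl V) false -> q \in W -> q \in part (gl V) false ->
  (p \o p)%VF = p -> (q \o q)%VF = q -> (p \o q)%VF = 0 -> (q \o p)%VF = 0 ->
  f \in W -> ((p \o (f : 'End(V)) \o q)%VF : gl V) \in W.
Proof.
move=> pW p0 qW q0 pp qq pq qp fW.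
pose x : 'End(V) := (p \o (f : 'End(V)) \o q)%VF; pose y : 'End(V) := (q \o (f : 'End(V)) \o p)%VF.
have gW := Lie_even qW q0 fW.
have hW := Lie_even pW p0 gW.
have eh : ((p \o ((q \o f) - (f \o q))) - (((q \o f) - (f \o q)) \o p))%VF = - x - y.
  rewrite comp_lfunDr comp_lfunDl comp_lfunNr comp_lfunNl !comp_lfunA pq comp_lfun0l.
  by rewrite -[((f \o q) \o p)%VF]comp_lfunA qp comp_lfun0r oppr0 addr0 sub0r.
(* Bracketing -x-y with p once more changes the sign of y only. *)
rewrite eh in hW; have kW := Lie_even pW p0 hW.
have ek : ((p \o (- x - y)) - ((- x - y) \o p))%VF = - x + y.
  rewrite comp_lfunDr comp_lfunDl !comp_lfunNr !comp_lfunNl /x /y !comp_lfunA pp pq !comp_lfun0l.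
  rewrite -[(_ \o p \o p)%VF]comp_lfunA pp -[(_ \o q \o p)%VF]comp_lfunA qp comp_lfun0r.
  by rewrite !oppr0 addr0 sub0r opprK.
rewrite ek in kW; have := memvD hW kW; rewrite addrACA addNr addr0 -opprD memvN.
by rewrite -mulr2n -scaler_nat => /(memvZ 2^-1); rewrite scalerA mulVf // scale1r.
Qed.

End SubLie.

Lemma Lie_cap (F : fieldType) (V : superspace F) (U W : {vspace gl V}) :
  Lie_subsuperalgebra U -> Lie_subsuperalgebra W -> Lie_subsuperalgebra (U :&: W)%VS.
Proof.
move=> LU LW; split.
  apply/gradedP => a f /memv_capP[fU fW]; apply/memv_capP.
  by split; [exact: Lie_graded LU _ _ fU | exact: Lie_graded LW _ _ fW].
move=> a b f g /memv_capP[/memv_capP[fU fW] fa] /memv_capP[/memv_capP[gU gW] gb].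
by apply/memv_capP; split; [exact: (Lie_bracket LU) | exact: (Lie_bracket LW)].
Qed.

Section LieSpan.
Variables (F : fieldType) (V : superspace F) (W : {vspace gl V}).
Variable Gen : bool -> gl V -> Prop.
Hypothesis GenW : forall a f, Gen a f -> f \in W /\ f \in part (gl V) a.
Hypothesis GenS : forall S : {vspace gl V}, (forall a f, Gen a f -> f \in S) -> (W <= S)%VS.
Hypothesis GenB : forall a b f g, Gen a f -> Gen b g -> sbracket a b f g \in W.

Lemma sbracketr_lin a b (f : gl V) : linear (sbracket a b f).
Proof.
move=> c x y; apply/lfunP => v; rewrite /sbracket !(add_lfunE, opp_lfunE, scale_lfunE, comp_lfunE).
rewrite [f (_ + _)]linearP /= scalerBr scalerDr opprD addrACA.
by congr (_ - _ + _); rewrite !scalerA mulrC.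
Qed.

Lemma sbracketl_lin a b (g : gl V) : linear ((sbracket a b)^~ g).
Proof.
move=> c x y; apply/lfunP => v; rewrite /sbracket !(add_lfunE, opp_lfunE, scale_lfunE, comp_lfunE).
rewrite [g (_ + _)]linearP /= scalerBr scalerDr opprD addrACA.
by congr (_ - _ + _); rewrite !scalerA mulrC.
Qed.

(** By bilinearity it is enough to bracket a spanning family of homogeneous
    operators. *)
Lemma Lie_of_gens : Lie_subsuperalgebra W.
Proof.
have gr : graded W.
  have H a : (W <= proj (gl V) a @^-1: W)%VS.
    apply: GenS => b f /GenW[fW fb]; rewrite -memv_preim (proj_part a fb).
    by case: eqP => // _; exact: mem0v.
  by move=> a f /(subvP (H a)); rewrite -memv_preim.
split; first exact/gradedP.
have E1 a b f : linear (fun g => sbracket a b f (proj (gl V) b g)).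
  by move=> c x y; rewrite linearP sbracketr_lin.
have E2 a b g : linear (fun f => sbracket a b (proj (gl V) a f) g).
  by move=> c x y; rewrite linearP; exact: (sbracketl_lin a b g).
have B1 a b f : Gen a f ->
    (W <= linfun (fun g => sbracket a b f (proj (gl V) b g)) @^-1: W)%VS.
  move=> Gf; apply: GenS => c g Gg.
  rewrite -memv_preim (linfunE (E1 a b f)) (proj_part b (GenW Gg).2).
  case: eqP => [e|_]; first by rewrite e in Gf *; exact: GenB.
  by rewrite -(linfunE (sbracketr_lin a b f)) linear0 mem0v.
move=> a b f g /memv_capP[fW fa] /memv_capP[gW gb].
have B2 : (W <= linfun (fun f => sbracket a b (proj (gl V) a f) g) @^-1: W)%VS.
  apply: GenS => c h Gh.
  rewrite -memv_preim (linfunE (E2 a b g)) (proj_part a (GenW Gh).2).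
  case: eqP => [e|_]; last by rewrite -(linfunE (sbracketl_lin a b g)) linear0 mem0v.
  have := subvP (B1 c b h Gh) _ gW; rewrite -memv_preim (linfunE (E1 c b h)).
  by rewrite (proj_id gb) e.
by have := subvP B2 _ fW; rewrite -memv_preim (linfunE (E2 a b g)) (proj_id fa).
Qed.

End LieSpan.

Lemma sbracket_part (F : fieldType) (V : superspace F) a b (f g : gl V) :
  f \in part (gl V) a -> g \in part (gl V) b -> sbracket a b f g \in part (gl V) (a (+) b).
Proof.
move=> fa gb; rewrite /sbracket; apply: memvB; first exact: comp_part.
by rewrite addbC; apply/memvZ/comp_part.
Qed.

Lemma sgn_andb (R : pzRingType) c a b :
  (-1) ^+ (c && (a (+) b)) = (-1) ^+ (c && a) * (-1) ^+ (c && b) :> R.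
Proof. by rewrite andb_addr signr_addb. Qed.

Lemma sbracketC (F : fieldType) (V : superspace F) a b (f g : gl V) :
  sbracket a b f g = - ((-1) ^+ (a && b) *: sbracket b a g f).
Proof.
rewrite /sbracket scalerBr scalerA andbC -expr2 sqrr_sign scale1r opprB.
by [].
Qed.

(** * Homogeneous bases, matrix units and the supertrace *)

(** The index type is arbitrary because the bases below are indexed by a sum
    of two ordinals and, on tensor products, by pairs. *)
Record hbasis (F : fieldType) (V : superspace F) := HBasis {
  hidx : finType;
  hvec : hidx -> V;
  hcrd : hidx -> 'Hom(V, F^o);
  hpar : hidx -> bool;
  hvec_part : forall i, hvec i \in part V (hpar i);
  hcrd_vec : forall i j, hcrd i (hvec j) = (i == j)%:R;
  hsum : forall v, v = \sum_i hcrd i v *: hvec i }.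

Section HBasisTheory.
Variables (F : fieldType) (V : superspace F) (B : hbasis V).
Implicit Types i j k l : hidx B.

Lemma hbasis_ext (U : vectType F) (f g : 'Hom(V, U)) :
  (forall i : hidx B, f (hvec i) = g (hvec i)) -> f = g.
Proof.
move=> fg; apply/lfunP => v; rewrite (hsum B v) !linear_sum.
by apply: eq_bigr => i _; rewrite !linearZ /= fg.
Qed.

Fact munit_lin i j : linear (fun v => hcrd j v *: hvec i).
Proof. by move=> c u w; rewrite linearP scalerDl scalerA. Qed.

Definition munit i j : 'End(V) := linfun (fun v => hcrd j v *: hvec i).

Lemma munitE i j v : munit i j v = hcrd j v *: hvec i.
Proof. exact: (linfunE (@munit_lin i j)). Qed.

Lemma munit_vec i j k : munit i j (hvec k) = (j == k)%:R *: hvec i.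
Proof. by rewrite munitE hcrd_vec. Qed.

Lemma munit_comp i j k l :
  (munit i j \o munit k l)%VF = (j == k)%:R *: munit i l.
Proof.
apply/lfunP => v; rewrite comp_lfunE scale_lfunE !munitE linearZ /= hcrd_vec.
by rewrite scalerA -[_ *: _%:R]mulrC.
Qed.

Lemma hcrd_part b j (v : V) : v \in part V b -> b != hpar j -> hcrd j v = 0.
Proof.
move=> vb bj; pose w : V := \sum_(i : hidx B | hpar i != b) hcrd i v *: hvec i.
have wE : w = v - \sum_(i : hidx B | hpar i == b) hcrd i v *: hvec i.
  have e : \sum_(i : hidx B | hpar i == b) hcrd i v *: hvec i + w = v.
    by rewrite [RHS](hsum B v) [in RHS](bigID (fun i : hidx B => hpar i == b)) /=.
  by apply/(canRL (addrK _)); rewrite addrC.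
have w0 : w = 0.
  apply: (@part_zero _ _ b).
    rewrite wE memvB // memv_suml // => i /eqP <-; exact/memvZ/hvec_part.
  apply: memv_suml => i ib; rewrite (_ : ~~ b = hpar i); last by case: (b) (hpar i) ib => [] [].
  exact/memvZ/hvec_part.
have := congr1 (hcrd j) w0; rewrite linear0 linear_sum (bigD1 j) /=; last by rewrite eq_sym.
rewrite big1 ?addr0 => [|i /andP[_ ij]]; last by rewrite linearZ /= hcrd_vec eq_sym (negPf ij) scaler0.
by rewrite linearZ /= hcrd_vec eqxx /GRing.scale /= mulr1.
Qed.

Lemma hcrd_hom a (f : gl V) i j : f \in part (gl V) a ->
  a != hpar i (+) hpar j -> hcrd i (f (hvec j)) = 0.
Proof.
move=> /gl_partP fa aij; apply: (hcrd_part (fa _ _ (hvec_part j))).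
by apply: contraNneq aij => <-; rewrite -addbA addbb addbF.
Qed.

Lemma munit_part i j : (munit i j : gl V) \in part (gl V) (hpar i (+) hpar j).
Proof.
apply/gl_partP => b v vb; rewrite munitE.
have [e|/(hcrd_part vb) ->] := eqVneq b (hpar j); last by rewrite scale0r mem0v.
by rewrite e -addbA addbb addbF; exact/memvZ/hvec_part.
Qed.

Lemma munit_sum (f : 'End(V)) :
  f = \sum_i \sum_j hcrd i (f (hvec j)) *: munit i j.
Proof.
apply: hbasis_ext => k; rewrite sum_lfunE {1}(hsum B (f (hvec k))).
apply: eq_bigr => i _; rewrite sum_lfunE (bigD1 k) //= big1 => [|j jk].
  by rewrite addr0 scale_lfunE munit_vec eqxx scale1r.
by rewrite scale_lfunE munit_vec (negPf jk) scale0r scaler0.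
Qed.

(** The trace does not depend on the basis: expand the vectors of the basis
    that defines the supertrace along the given one. *)
Lemma supertraceE (f : gl V) :
  supertrace f = \sum_(i : hidx B) (-1) ^+ hpar i * hcrd i (f (hvec i)).
Proof.
have bt b : block_trace b f =
    \sum_(i : hidx B) hcrd i (proj V b (f (hvec i))).
  rewrite /block_trace (eq_bigr (fun k : 'I__ => \sum_(i : hidx B)
      hcrd i (vbasis (part V b))`_k *
        coord (vbasis (part V b)) k (proj V b (f (hvec i))))) => [|k _].
    rewrite exchange_big /=; apply: eq_bigr => i _.
    rewrite [in RHS](coord_vbasis (proj_in b (f (hvec i)))) linear_sum.
    by apply: eq_bigr => k _; rewrite linearZ /= mulrC.
  rewrite [in LHS](hsum B (vbasis (part V b))`_k) !linear_sum /=.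
  by apply: eq_bigr => i _; rewrite !linearZ.
rewrite /supertrace !bt -sumrB; apply: eq_bigr => i _.
transitivity (hcrd i (proj V false (f (hvec i)) - proj V true (f (hvec i)))).
  by rewrite linearB.
have -> : proj V false (f (hvec i)) - proj V true (f (hvec i)) = sgn V (f (hvec i)).
  rewrite -(proj_add false (f (hvec i))) [in RHS]linearD /=.
  by rewrite !(sgnE (proj_in _ _)) expr0 expr1 scale1r scaleN1r (proj_add false).
rewrite [in LHS](hsum B (f (hvec i))) !linear_sum /= (bigD1 i) //= big1 => [|j ji].
  by rewrite addr0 !linearZ /= (sgnE (hvec_part i)) linearZ /= hcrd_vec eqxx
             /GRing.scale /= mulr1 mulrC.
by rewrite !linearZ /= (sgnE (hvec_part j)) linearZ /= hcrd_vec eq_sym (negPf ji)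
           /GRing.scale /= !mulr0.
Qed.

Lemma supertrace_lin : scalar (@supertrace F V).
Proof.
move=> c f g; rewrite !supertraceE mulr_sumr -big_split; apply: eq_bigr => i _ /=.
by rewrite add_lfunE scale_lfunE linearP mulrDr mulrCA.
Qed.

Lemma supertrace_odd (f : gl V) : f \in part (gl V) true -> supertrace f = 0.
Proof.
by move=> f1; rewrite supertraceE big1 // => i _; rewrite (hcrd_hom f1) ?addbb ?mulr0.
Qed.

Lemma supertrace_comm a b (f g : gl V) :
  f \in part (gl V) a -> g \in part (gl V) b ->
  supertrace (f \o g)%VF = (-1) ^+ (a && b) * supertrace (g \o f)%VF.
Proof.
move=> fa gb; have comp_crd (x y : gl V) i : hcrd i ((x \o y)%VF (hvec i)) =
    \sum_(j : hidx B) hcrd i (x (hvec j)) * hcrd j (y (hvec i)).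
  rewrite comp_lfunE {1}(hsum B (y (hvec i))) !linear_sum.
  by apply: eq_bigr => j _; rewrite !linearZ /= mulrC.
rewrite !supertraceE mulr_sumr.
under eq_bigr do rewrite comp_crd mulr_sumr.
under [RHS]eq_bigr do rewrite comp_crd !mulr_sumr.
rewrite exchange_big /=; apply: eq_bigr => i _; apply: eq_bigr => j _.
have [e|/(hcrd_hom fa) ->] := eqVneq a (hpar j (+) hpar i); last by rewrite !(mul0r, mulr0).
have [e'|/(hcrd_hom gb) ->] := eqVneq b (hpar i (+) hpar j); last by rewrite !(mul0r, mulr0).
rewrite [in RHS]mulrA [X in _ = _ * X]mulrC -signr_addb; congr (_ ^+ _ * _).
by rewrite e e'; case: (hpar i); case: (hpar j).
Qed.

End HBasisTheory.

Section CanonicalBasis.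
Variables (F : fieldType) (V : superspace F).
Let I := ('I_(\dim (part V false)) + 'I_(\dim (part V true)))%type.
Let cvec (i : I) : V :=
  match i with inl k => (vbasis (part V false))`_k
             | inr k => (vbasis (part V true))`_k end.
Let cpar (i : I) : bool := if i is inl _ then false else true.
Let ccrd_fun (i : I) (v : V) : F^o :=
  match i with inl k => coord (vbasis (part V false)) k (proj V false v)
             | inr k => coord (vbasis (part V true)) k (proj V true v) end.
Let ccrd i : 'Hom(V, F^o) := linfun (ccrd_fun i).

Fact ccrdE i v : ccrd i v = ccrd_fun i v.
Proof.
by apply: linfunE => c u w; case: i => k; rewrite /ccrd_fun !linearP.
Qed.

Fact cvec_part i : cvec i \in part V (cpar i).
Proof. by case: i => k; apply/vbasis_mem/mem_nth; rewrite size_tuple. Qed.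

Fact ccrd_cvec i j : ccrd i (cvec j) = (i == j)%:R.
Proof.
have fr b := basis_free (vbasisP (part V b)).
have pv b (k : 'I_(\dim (part V b))) : (vbasis (part V b))`_k \in part V b.
  by apply/vbasis_mem/mem_nth; rewrite size_tuple.
rewrite ccrdE; case: i => i; case: j => j; rewrite /ccrd_fun /cvec.
- by rewrite (proj_id (pv _ _)) (coord_free _ _ (fr _)) eq_sym.
- by rewrite (proj_N (pv true j)) linear0.
- by rewrite (proj_N (pv false j)) linear0.
- by rewrite (proj_id (pv _ _)) (coord_free _ _ (fr _)) eq_sym.
Qed.

Fact csum v : v = \sum_i ccrd i v *: cvec i.
Proof.
rewrite big_sumType /= -{1}(proj_add false v); congr (_ + _).
  rewrite {1}(coord_vbasis (proj_in false v)).
  by apply: eq_bigr => i _; rewrite ccrdE.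
rewrite {1}(coord_vbasis (proj_in true v)).
by apply: eq_bigr => i _; rewrite ccrdE.
Qed.

Definition canonical_hbasis := HBasis cvec_part ccrd_cvec csum.

Lemma card_hpar b : #|[set i : hidx canonical_hbasis | hpar i == b]| = \dim (part V b).
Proof.
case: b.
  rewrite -[RHS]card_ord -[RHS](card_imset _ (@inr_inj 'I_(\dim (part V false)) _)).
  apply: eq_card => -[k|k]; rewrite inE /=; apply/esym/imsetP; first by case.
  by exists k.
rewrite -[RHS]card_ord -[RHS](card_imset _ (@inl_inj _ 'I_(\dim (part V true)))).
apply: eq_card => -[k|k]; rewrite inE /=; apply/esym/imsetP; last by case.
by exists k.
Qed.

End CanonicalBasis.

Section SpecialLinear.
Variables (F : fieldType) (V : superspace F) (B : hbasis V).

Lemma sl_graded : graded (sl V).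
Proof.
move=> a f; rewrite !mem_sl => /eqP f0.
have o := supertrace_odd B (proj_in true f).
case: a; first by rewrite o.
move: f0; rewrite {1}(sum_proj f) -[X in X + _]scale1r (supertrace_lin B) mul1r o addr0.
by move=> ->.
Qed.

Lemma sl_Lie : Lie_subsuperalgebra (sl V).
Proof.
split; first exact/gradedP/sl_graded.
move=> a b f g /memv_capP[_ fa] /memv_capP[_ gb]; rewrite mem_sl /sbracket.
rewrite addrC -scaleNr (supertrace_lin B) (supertrace_comm B fa gb) mulNr.
by rewrite addNr.
Qed.

Lemma supertrace_munit i j :
  supertrace (munit i j : gl V) = (i == j)%:R * (-1) ^+ hpar (i : hidx B).
Proof.
rewrite (supertraceE B) (bigD1 i) //= big1 => [|k ki]; last first.
  by rewrite munit_vec linearZ /= hcrd_vec (negPf ki) scaler0 mulr0.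
by rewrite munit_vec linearZ /= hcrd_vec eqxx addr0 /GRing.scale /= mulr1 mulrC eq_sym.
Qed.

Variable W : {vspace gl V}.
Hypothesis LW : Lie_subsuperalgebra W.

Lemma munit_trans (i j k : hidx B) : i != k ->
  (munit i j : gl V) \in W -> (munit j k : gl V) \in W -> (munit i k : gl V) \in W.
Proof.
move=> ik ij jk.
have := Lie_bracket LW ij (munit_part _ _) jk (munit_part _ _).
by rewrite /sbracket !munit_comp eqxx eq_sym (negPf ik) scale1r scale0r scaler0 subr0.
Qed.

(** The diagonal part of an operator of supertrace zero is a combination of
    e_ii - (-1)^(p(i)+p(i0)) e_i0i0, which is the superbracket of e_i,i0 and
    e_i0,i. *)
Lemma sl_sub_munit :
  (forall i j : hidx B, i != j -> (munit i j : gl V) \in W) -> (sl V <= W)%VS.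
Proof.
move=> off; apply/subvP => f; rewrite mem_sl => /eqP f0.
have [i0 _|no] := pickP (predT : pred (hidx B)); last first.
  by rewrite (munit_sum B f) big1 ?mem0v // => i _; have := no i.
have dg (i : hidx B) : (munit i i - (-1) ^+ (hpar i (+) hpar i0) *: munit i0 i0 : gl V) \in W.
  have [->|ii0] := eqVneq i i0; first by rewrite addbb expr0 scale1r subrr mem0v.
  have := Lie_bracket LW (off _ _ ii0) (munit_part _ _)
     (off i0 i (contra_neq (esym (y := i)) ii0)) (munit_part _ _).
  rewrite /sbracket !munit_comp !eqxx !scale1r.
  by rewrite [hpar i0 (+) _]addbC andbb.
have -> : f = \sum_(i : hidx B) \sum_(j : hidx B | i != j) hcrd i (f (hvec j)) *: munit i j
   + \sum_(i : hidx B) hcrd i (f (hvec i)) *: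
       (munit i i - (-1) ^+ (hpar i (+) hpar i0) *: munit i0 i0).
  under [X in _ + X]eq_bigr do rewrite scalerBr.
  rewrite sumrB [X in _ - X](_ : _ = 0) ?subr0; last first.
    transitivity (((-1) ^+ hpar i0 * supertrace (f : gl V)) *: munit i0 i0); last first.
      by rewrite f0 mulr0 scale0r.
    rewrite (supertraceE B) mulr_sumr scaler_suml; apply: eq_bigr => i _.
    rewrite scalerA mulrA -signr_addb; congr (_ *: _).
    by rewrite mulrC addbC.
  rewrite -big_split /= {1}(munit_sum B f); apply: eq_bigr => i _.
  by rewrite (bigD1 i) //= addrC; congr (_ + _); apply: eq_bigl => j; rewrite eq_sym.
apply: memvD; last by apply: memv_suml => i _; exact/memvZ/dg.
apply: memv_suml => i _; apply: memv_suml => j ij; exact/memvZ/off.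
Qed.

End SpecialLinear.

(** * The Grassmann algebra as a module over its multiplications and derivations *)

Section Inversions.
Variable n : nat.
Implicit Types I J K : {set 'I_n}.

Lemma inversionsE I J :
  inversions I J = (\sum_(i in I) \sum_(j in J) (j < i))%N.
Proof.
rewrite pair_big_dep /= /inversions -sum1_card big_mkcond [RHS]big_mkcond /=.
by apply: eq_bigr => -[i j] _; rewrite !inE /=;
  case: (i \in I); case: (j \in J) => //=; case: (_ < _)%N.
Qed.

Lemma inversionsUl I J K : [disjoint I & J] ->
  inversions (I :|: J) K = (inversions I K + inversions J K)%N.
Proof. by move=> IJ; rewrite !inversionsE -bigU //; apply: eq_bigl => i; rewrite !inE. Qed.

Lemma inversionsUr I J K : [disjoint J & K] ->
  inversions I (J :|: K) = (inversions I J + inversions I K)%N.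
Proof.
move=> JK; rewrite !inversionsE -big_split; apply: eq_bigr => i _ /=.
by rewrite -bigU //; apply: eq_bigl => j; rewrite !inE.
Qed.

(** Each pair of elements of I and J is inverted in exactly one of the two
    orders. *)
Lemma inversionsC I J : [disjoint I & J] ->
  (inversions I J + inversions J I)%N = (#|I| * #|J|)%N.
Proof.
move=> IJ; rewrite !inversionsE [X in (_ + X)%N]exchange_big -big_split /=.
rewrite -sum_nat_const; apply: eq_bigr => i iI.
rewrite -big_split /= -sum1_card; apply: eq_bigr => j jJ.
have : i != j by apply: contraTneq jJ => <-; rewrite (disjointFr IJ).
by rewrite -val_eqE /=; case: ltngtP.
Qed.

Lemma inversions0l J : inversions set0 J = 0%N.
Proof. by rewrite inversionsE big_set0. Qed.

Lemma inversions0r J : inversions J set0 = 0%N.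
Proof. by rewrite inversionsE big1 // => i _; rewrite big_set0. Qed.

Lemma disjointUl I J K :
  [disjoint I :|: J & K] = [disjoint I & K] && [disjoint J & K].
Proof. by rewrite -!setI_eq0 setIUl setU_eq0. Qed.

Lemma disjointUr I J K :
  [disjoint K & I :|: J] = [disjoint K & I] && [disjoint K & J].
Proof. by rewrite -!setI_eq0 setIUr setU_eq0. Qed.

End Inversions.

Section GrassmannAlgebra.
Variables (F : fieldType) (n : nat).
Notation L := (Lambda F n).
Notation xi := (xi F).
Implicit Types (I J K : {set 'I_n}) (phi psi chi : L).

Lemma coefL_xi I J : coefL (xi I) J = (J == I)%:R.
Proof. by rewrite /coefL ffunE. Qed.

Fact coef_lin J : linear ((fun phi : L => coefL phi J) : L -> F^o).
Proof. by move=> c u w; rewrite /= coefL_lin. Qed.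

Definition Lcoord J : 'Hom(L, F^o) := linfun ((fun phi : L => coefL phi J) : L -> F^o).

Lemma LcoordE J phi : Lcoord J phi = coefL phi J.
Proof. exact: (linfunE (coef_lin J)). Qed.

Fact Lcoord_xi I J : Lcoord I (xi J) = (I == J)%:R.
Proof. by rewrite LcoordE coefL_xi. Qed.

Fact Lsum phi : phi = \sum_J Lcoord J phi *: xi J.
Proof. by rewrite {1}(Lambda_decomp phi); apply: eq_bigr => J _; rewrite LcoordE. Qed.

Definition Lbasis : hbasis L := HBasis (@xi_part F n) Lcoord_xi Lsum.

Lemma Lambda_ext (U : vectType F) (f g : 'Hom(L, U)) :
  (forall J, f (xi J) = g (xi J)) -> f = g.
Proof. exact: (hbasis_ext (B := Lbasis)). Qed.

Lemma gmul_xi I J : gmul (xi I) (xi J) =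
  if [disjoint I & J] then (-1) ^+ inversions I J *: xi (I :|: J) else 0.
Proof.
apply/ffunP => K; rewrite /gmul ffunE.
have [dIJ|nd] := ifPn; last first.
  rewrite ffunE big1 // => S SK; rewrite !coefL_xi.
  have [->|] := eqVneq S I; last by rewrite !(mul0r, mulr0).
  have [e|] := eqVneq (K :\: I) J; last by rewrite !mulr0.
  by move: nd; rewrite -e disjoint_sym -setI_eq0 setIDAC setDE -setIA setICr !setI0 eqxx.
rewrite !ffunE; have [->|KIJ] := eqVneq K (I :|: J).
  have e : (I :|: J) :\: I = J.
    by rewrite setDUl setDv set0U; apply/setDidPl; rewrite disjoint_sym.
  rewrite (bigD1 I) ?subsetUl //= big1 => [|S /andP[_ SI]].
    by rewrite addr0 !coefL_xi e !eqxx !mulr1 /GRing.scale /= mulr1.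
  by rewrite coefL_xi (negPf SI) mul0r mulr0.
rewrite scaler0 big1 // => S SK; rewrite !coefL_xi.
have [e|] := eqVneq S I; last by rewrite !(mul0r, mulr0).
have [e'|] := eqVneq (K :\: S) J; last by rewrite !mulr0.
by case/eqP: KIJ; rewrite -e' -e -[LHS](setID K S) (setIidPr SK).
Qed.

Definition mu phi : 'End(L) := linfun (gmul phi).

Lemma muE phi psi : mu phi psi = gmul phi psi.
Proof. exact: (linfunE (gmul_linr phi)). Qed.

Lemma mu_lin : linear mu.
Proof.
move=> c phi psi; apply/lfunP => w.
by rewrite add_lfunE scale_lfunE !muE gmul_linl.
Qed.

Lemma muD phi psi : mu (phi + psi) = mu phi + mu psi.
Proof. by have := mu_lin 1 phi psi; rewrite !scale1r. Qed.

Lemma mu0 : mu 0 = 0.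
Proof. by apply: (addrI (mu 0)); rewrite -muD !addr0. Qed.

Lemma muZ c phi : mu (c *: phi) = c *: mu phi.
Proof. by have := mu_lin c phi 0; rewrite !addr0 mu0 addr0. Qed.

Lemma mu_xi I J : mu (xi I) (xi J) =
  if [disjoint I & J] then (-1) ^+ inversions I J *: xi (I :|: J) else 0.
Proof. by rewrite muE gmul_xi. Qed.

Lemma mu_sum (I : finType) (P : pred I) (G : I -> L) :
  mu (\sum_(i | P i) G i) = \sum_(i | P i) mu (G i).
Proof. by apply: (big_morph mu muD mu0). Qed.

Lemma mu_comp phi psi : (mu phi \o mu psi)%VF = mu (gmul phi psi).
Proof.
apply: Lambda_ext => K; rewrite comp_lfunE -(muE phi psi) (Lsum phi) mu_sum !sum_lfunE mu_sum sum_lfunE.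
apply: eq_bigr => I _; rewrite muZ !scale_lfunE muZ scale_lfunE; congr (_ *: _).
rewrite (Lsum psi) mu_sum !sum_lfunE !linear_sum mu_sum sum_lfunE.
apply: eq_bigr => J _; rewrite muZ scale_lfunE !linearZ muZ scale_lfunE; congr (_ *: _).
rewrite /= !mu_xi; case: ifPn => JK; case: ifPn => IJ; rewrite ?linear0 ?mu0 ?zero_lfunE //.
- rewrite linearZ muZ scale_lfunE /= !mu_xi disjointUl disjointUr IJ JK /= andbT.
  case: ifP => IK; rewrite ?scaler0 // !scalerA -!exprD setUA.
  rewrite inversionsUl // inversionsUr // addnCA.
  by rewrite [(inversions J K + _)%N]addnC.
- by rewrite linearZ /= mu_xi disjointUr (negPf IJ) scaler0.
- by rewrite muZ scale_lfunE mu_xi disjointUl (negPf JK) andbF scaler0.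
Qed.

Definition unitL : L := xi set0.

Lemma mu_unit : mu unitL = \1%VF.
Proof.
apply: Lambda_ext => J; rewrite mu_xi id_lfunE inversions0l expr0 scale1r set0U.
by rewrite -setI_eq0 set0I eqxx.
Qed.

Lemma mu_unitr phi : mu phi unitL = phi.
Proof.
rewrite {1}(Lsum phi) mu_sum sum_lfunE [RHS](Lsum phi); apply: eq_bigr => J _.
rewrite muZ scale_lfunE mu_xi inversions0r expr0 scale1r setU0.
by rewrite -setI_eq0 setI0 eqxx.
Qed.

Lemma mu_part a phi : phi \in part L a -> (mu phi : gl L) \in part (gl L) a.
Proof.
move=> pa; rewrite (hsum Lbasis phi) mu_sum; apply: memv_suml => I _; rewrite muZ.
have [e|/(hcrd_part pa) ->] := eqVneq a (hpar (I : hidx Lbasis)); last first.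
  by rewrite scale0r mem0v.
rewrite memvZ // e; apply/gl_partP => b psi pb.
rewrite (hsum Lbasis psi) linear_sum; apply: memv_suml => J _; rewrite linearZ /=.
have [->|/(hcrd_part pb) ->] := eqVneq b (hpar (J : hidx Lbasis)); last first.
  by rewrite scale0r mem0v.
rewrite memvZ // mu_xi; case: ifPn => IJ; rewrite ?mem0v // memvZ //.
have /= := xi_part F (I :|: J).
by rewrite cardsU disjoint_setI0 // cards0 subn0 oddD.
Qed.

(** Reordering xi_I xi_J into xi_J xi_I costs |I| |J| transpositions
    (inversionsC). *)
Lemma gmul_superC a b phi psi : phi \in part L a -> psi \in part L b ->
  gmul phi psi = (-1) ^+ (a && b) *: gmul psi phi.
Proof.
move=> pa pb; rewrite -!muE (hsum Lbasis phi) mu_sum sum_lfunE linear_sum scaler_sumr.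
apply: eq_bigr => I _; rewrite muZ scale_lfunE linearZ /=.
have [ea|/(hcrd_part pa) ->] := eqVneq a (hpar (I : hidx Lbasis)); last first.
  by rewrite !scale0r scaler0.
rewrite scalerA mulrC -scalerA; congr (_ *: _).
rewrite (hsum Lbasis psi) mu_sum sum_lfunE linear_sum scaler_sumr.
apply: eq_bigr => J _; rewrite muZ scale_lfunE linearZ /=.
have [eb|/(hcrd_part pb) ->] := eqVneq b (hpar (J : hidx Lbasis)); last first.
  by rewrite !scale0r scaler0.
rewrite scalerA mulrC -scalerA; congr (_ *: _).
rewrite !mu_xi [in RHS]disjoint_sym; case: ifPn => IJ; rewrite ?scaler0 //.
rewrite scalerA setUC; congr (_ *: _); rewrite ea eb /=.
have e := inversionsC IJ; rewrite -oddM -e -(signr_odd _ (inversions I J)).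
by rewrite !signr_odd exprD -mulrA -expr2 sqrr_sign mulr1.
Qed.

Lemma unitL_part : unitL \in part L false.
Proof. by have := xi_part F (set0 : {set 'I_n}); rewrite cards0. Qed.

Definition xi1 i : L := xi [set i].
Definition xiop i : 'End(L) := mu (xi1 i).

Lemma xi1_part i : xi1 i \in part L true.
Proof. by have := xi_part F [set i]; rewrite cards1. Qed.

Lemma xiop_part i : (xiop i : gl L) \in part (gl L) true.
Proof. exact/mu_part/xi1_part. Qed.

Lemma tau_xiop i : tau (xiop i) = - xiop i.
Proof. by rewrite (tau_part (xiop_part i)) scaleN1r. Qed.

Lemma xiop_xi i J : xiop i (xi J) =
  if i \in J then 0 else (-1) ^+ inversions [set i] J *: xi (i |: J).
Proof. by rewrite /xiop /xi1 mu_xi disjoints1; case: (i \in J). Qed.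

(** Lambda(n) is generated from 1 by the multiplications by xi_k. *)
Lemma Lambda_ind (P : L -> Prop) :
  (forall c phi psi, P phi -> P psi -> P (c *: phi + psi)) ->
  P unitL -> (forall k phi, P phi -> P (xiop k phi)) -> forall phi, P phi.
Proof.
move=> Plin P1 PX.
have P0 : P 0 by have := Plin (-1) _ _ P1 P1; rewrite scaleN1r addNr.
have PZ c phi : P phi -> P (c *: phi) by move=> Pp; have := Plin c _ _ Pp P0; rewrite addr0.
have PD phi psi : P phi -> P psi -> P (phi + psi).
  by move=> Pp Pq; have := Plin 1 _ _ Pp Pq; rewrite scale1r.
suff Pxi J : P (xi J).
  move=> phi; rewrite (Lambda_decomp phi); apply: (big_ind P) => // J _.
  exact/PZ/Pxi.
move: {2}#|J| (leqnn #|J|) => m; elim: m J => [|m IH] J.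
  by rewrite leqn0 cards_eq0 => /eqP ->.
have [->|[i iJ]] := set_0Vmem J; first by [].
rewrite (cardsD1 i) iJ ltnS => /IH /(PX i); rewrite xiop_xi !inE eqxx /= setD1K //.
by move/(PZ ((-1) ^+ inversions [set i] (J :\ i))); rewrite scalerA -expr2 sqrr_sign scale1r.
Qed.

Fact del_lin i : linear (fun phi : L => \sum_(J : {set 'I_n} | i \in J)
  coefL phi J *: ((-1) ^+ inversions [set i] (J :\ i) *: xi (J :\ i))).
Proof.
move=> c u w; rewrite scaler_sumr -big_split; apply: eq_bigr => J _ /=.
by rewrite coefL_lin scalerDl [in RHS]scalerA.
Qed.

Definition del i : 'End(L) := linfun (fun phi : L => \sum_(J : {set 'I_n} | i \in J)
  coefL phi J *: ((-1) ^+ inversions [set i] (J :\ i) *: xi (J :\ i))).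

Lemma del_xi i J : del i (xi J) =
  if i \in J then (-1) ^+ inversions [set i] (J :\ i) *: xi (J :\ i) else 0.
Proof.
rewrite (linfunE (@del_lin i)); case: ifPn => iJ.
  rewrite (bigD1 J) //= coefL_xi eqxx scale1r big1 ?addr0 // => K /andP[_ KJ].
  by rewrite coefL_xi (negPf KJ) scale0r.
rewrite big1 // => K iK; rewrite coefL_xi; case: eqP iK => [-> iJ'|_ _].
  by rewrite iJ' in iJ.
by rewrite scale0r.
Qed.

Lemma del_unit i : del i unitL = 0.
Proof. by rewrite del_xi inE. Qed.

Lemma del_part i : (del i : gl L) \in part (gl L) true.
Proof.
apply/gl_partP => b phi pb.
rewrite (hsum Lbasis phi) linear_sum; apply: memv_suml => J _; rewrite linearZ /=.
have [->|/(hcrd_part pb) ->] := eqVneq b (hpar (J : hidx Lbasis)); last first.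
  by rewrite scale0r mem0v.
rewrite memvZ // del_xi; case: ifPn => iJ; rewrite ?mem0v // memvZ //.
by have := xi_part F (J :\ i); rewrite /= [in odd #|J|](cardsD1 i) iJ /= negbK.
Qed.

Lemma tau_del i : tau (del i) = - del i.
Proof. by rewrite (tau_part (del_part i)) scaleN1r. Qed.

Lemma inversions1 (i j : 'I_n) : inversions [set i] [set j] = (j < i)%N.
Proof. by rewrite inversionsE !big_set1. Qed.

(** The canonical anticommutation relations: with xiop_anti and del_anti they
    say that the xi_i and del_i generate a Clifford algebra. *)
Lemma del_xiop i j phi : del i (xiop j phi) = (i == j)%:R *: phi - xiop j (del i phi).
Proof.
suff: (del i \o xiop j)%VF = (i == j)%:R *: \1%VF - (xiop j \o del i)%VF.
  by move=> /lfunP/(_ phi); rewrite !lfun_ev.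
apply: Lambda_ext => J; rewrite !lfun_ev xiop_xi del_xi.
have [<-{j}|ij] := eqVneq i j.
  rewrite scale1r; case: ifPn => iJ.
    rewrite linear0 linearZ /= xiop_xi !inE eqxx /= setD1K // scalerA -expr2 sqrr_sign.
    by rewrite scale1r subrr.
  rewrite linear0 subr0 linearZ /= del_xi !inE eqxx /= setU1K //.
  by rewrite scalerA -expr2 sqrr_sign scale1r.
rewrite scale0r add0r; case: (boolP (j \in J)) => jJ.
  rewrite linear0; case: ifPn => iJ; last by rewrite linear0 oppr0.
  by rewrite linearZ /= xiop_xi !inE eq_sym ij jJ /= scaler0 oppr0.
rewrite linearZ /= del_xi !inE (negPf ij) /=.
case: ifPn => iJ; last by rewrite scaler0 linear0 oppr0.
rewrite [xiop j _]linearZ /= xiop_xi !inE (negPf jJ) andbF.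
have -> : (j |: J) :\ i = j |: (J :\ i).
  by apply/setP => k; rewrite !inE; case: eqP => //= ->; rewrite (negPf ij).
rewrite !scalerA -scaleNr; congr (_ *: _).
rewrite inversionsUr; last by rewrite disjoints1 !inE (negPf jJ) andbF.
rewrite -[in inversions [set j] J](setD1K iJ) inversionsUr; last by rewrite disjoints1 !inE eqxx.
rewrite !inversions1 !exprD.
have : (-1) ^+ (i < j)%N * (-1) ^+ (j < i)%N = - 1 :> F.
  by move: ij; rewrite -val_eqE /=; case: ltngtP => // _ _; rewrite expr0 expr1 ?mulr1 ?mul1r.
move: (_ ^+ (i < j)%N) (_ ^+ (j < i)%N) => x y xy.
by rewrite mulrACA xy mulN1r mulrC.
Qed.

Lemma xiop_anti i j phi : xiop i (xiop j phi) = - xiop j (xiop i phi).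
Proof.
rewrite -!comp_lfunE !mu_comp (gmul_superC (xi1_part i) (xi1_part j)).
by rewrite muZ scale_lfunE scaleN1r.
Qed.

Lemma addrr_eq0 (U : lmodType F) (two : 2 != 0 :> F) (x : U) : x + x = 0 -> x = 0.
Proof.
move=> xx; apply/eqP; have : 2 *: x == 0 by rewrite scaler_nat mulr2n xx.
by rewrite scaler_eq0 (negPf two).
Qed.

Hypothesis two : 2 != 0 :> F.

Lemma xiop_sq i phi : xiop i (xiop i phi) = 0.
Proof.
by apply: (addrr_eq0 two); rewrite {1}xiop_anti addNr.
Qed.

Fact odd_ad_key : unit. Proof. exact: tt. Qed.
(** The superbracket with an odd operator u, for x of any parity; locked like
    tau. *)
Definition odd_ad (u x : 'End(L)) : 'End(L) :=
  locked_with odd_ad_key ((u \o x)%VF - (tau x \o u)%VF).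

Lemma odd_ad_def u x : odd_ad u x = (u \o x)%VF - (tau x \o u)%VF.
Proof. by rewrite /odd_ad unlock. Qed.

Lemma odd_adE u x phi : odd_ad u x phi = u (x phi) - tau x (u phi).
Proof. by rewrite odd_ad_def !lfun_ev. Qed.

Lemma odd_ad_lin u : linear (odd_ad u).
Proof.
move=> c x y; apply/lfunP => phi; rewrite add_lfunE scale_lfunE !odd_adE tauD tauZ.
rewrite !(add_lfunE, scale_lfunE) linearD linearZ /= scalerBr.
by rewrite opprD addrACA.
Qed.

Lemma odd_adD u x y : odd_ad u (x + y) = odd_ad u x + odd_ad u y.
Proof. by have := odd_ad_lin u 1 x y; rewrite !scale1r. Qed.
Lemma odd_ad0 u : odd_ad u 0 = 0.
Proof. by apply: (addrI (odd_ad u 0)); rewrite -odd_adD !addr0. Qed.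
Lemma odd_adZ u c x : odd_ad u (c *: x) = c *: odd_ad u x.
Proof. by have := odd_ad_lin u c x 0; rewrite odd_ad0 !addr0. Qed.
Lemma odd_adN u x : odd_ad u (- x) = - odd_ad u x.
Proof. by rewrite -scaleN1r odd_adZ scaleN1r. Qed.
Lemma odd_adB u x y : odd_ad u (x - y) = odd_ad u x - odd_ad u y.
Proof. by rewrite odd_adD odd_adN. Qed.
Lemma odd_ad_sum u (I : finType) (P : pred I) (G : I -> 'End(L)) :
  odd_ad u (\sum_(i | P i) G i) = \sum_(i | P i) odd_ad u (G i).
Proof. exact: (big_morph (odd_ad u) (odd_adD u) (odd_ad0 u)). Qed.

Lemma odd_ad_comp u x y : odd_ad u (x \o y)%VF = (odd_ad u x \o y)%VF + (tau x \o odd_ad u y)%VF.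
Proof.
apply/lfunP => phi; rewrite !(odd_adE, lfun_ev) tau_comp comp_lfunE linearB /=.
by rewrite addrA subrK.
Qed.

Lemma tau_odd_ad u x : tau u = - u -> tau (odd_ad u x) = - odd_ad u (tau x).
Proof. by move=> tu; rewrite !odd_ad_def tauB !tau_comp tu tauK comp_lfunNl comp_lfunNr opprB opprK addrC. Qed.

(** The Jacobi identity for two odd operators whose anticommutator is a
    scalar, hence central. *)
Lemma odd_ad_anti u v c x : tau u = - u -> tau v = - v ->
  (forall phi, u (v phi) = c *: phi - v (u phi)) ->
  odd_ad u (odd_ad v x) = - odd_ad v (odd_ad u x).
Proof.
move=> tu tv uv; apply/lfunP => phi.
rewrite opp_lfunE !(odd_adE, tau_odd_ad) // !(opp_lfunE, odd_adE) tauK !linearB /= !opprK.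
rewrite !uv linearB linearZ /=.
by rewrite [LHS](AC (3*2) ((2*4)*(3*(1*5)))).
Qed.

Lemma odd_ad_sq u x : tau u = - u -> (forall phi, u (u phi) = 0) -> odd_ad u (odd_ad u x) = 0.
Proof.
move=> tu uu; apply/lfunP => phi; rewrite zero_lfunE !(odd_adE, tau_odd_ad) // !(opp_lfunE, odd_adE).
by rewrite tauK (uu phi) [x 0]linear0 subr0 linearB /= uu sub0r opprK addNr.
Qed.

Lemma odd_ad_xi_xi i j x : odd_ad (xiop i) (odd_ad (xiop j) x) = - odd_ad (xiop j) (odd_ad (xiop i) x).
Proof.
apply: (odd_ad_anti (c := 0) x (tau_xiop i) (tau_xiop j)) => phi.
by rewrite scale0r sub0r xiop_anti.
Qed.

Lemma odd_ad_del_xi i j x : odd_ad (del i) (odd_ad (xiop j) x) = - odd_ad (xiop j) (odd_ad (del i) x).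
Proof. exact: (odd_ad_anti x (tau_del i) (tau_xiop j) (del_xiop i j)). Qed.

Lemma odd_ad_xi_del_anti i j x : odd_ad (xiop j) (odd_ad (del i) x) = - odd_ad (del i) (odd_ad (xiop j) x).
Proof. by rewrite odd_ad_del_xi opprK. Qed.

Lemma tau_mu phi : tau (mu phi) = mu (sgn L phi).
Proof.
rewrite -(proj_add false phi) linearD !muD tauD /=.
have E b : sgn L (proj L b phi) = (-1) ^+ b *: proj L b phi := sgnE (proj_in b phi).
by rewrite !(tau_part (mu_part (proj_in _ _))) !E !muZ.
Qed.

Lemma odd_ad_xi_mu i phi : odd_ad (xiop i) (mu phi) = 0.
Proof.
rewrite -(proj_add false phi) muD odd_adD.
have E b psi : psi \in part L b -> odd_ad (xiop i) (mu psi) = 0.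
  move=> pb; rewrite odd_ad_def (tau_part (mu_part pb)) /xiop mu_comp.
  rewrite (gmul_superC (xi1_part i) pb) muZ -mu_comp.
  by rewrite comp_lfunZl subrr.
by rewrite !(E _ _ (proj_in _ _)) addr0.
Qed.

Lemma sgn_unit : sgn L unitL = unitL.
Proof. by rewrite (sgnE unitL_part) scale1r. Qed.

Lemma tau_unit x : tau x unitL = sgn L (x unitL).
Proof. by rewrite tauE sgn_unit. Qed.

(** An operator that supercommutes with the xi_k is determined by its value at
    1. Moving it past xi_k replaces it by its image under tau, so the two are
    shown to vanish together. *)
Lemma super_comm_eq0 (x : 'End(L)) :
  (forall k, odd_ad (xiop k) x = 0) -> x unitL = 0 -> x = 0.
Proof.
move=> Tx x1; have TX y k phi : odd_ad (xiop k) y = 0 -> tau y (xiop k phi) = xiop k (y phi).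
  move/lfunP/(_ phi); rewrite odd_adE zero_lfunE => /eqP.
  by rewrite subr_eq0 => /eqP.
have xX k phi := TX x k phi (Tx k).
have txX k phi : x (xiop k phi) = xiop k (tau x phi).
  rewrite -{1}(tauK x); apply: TX; apply/eqP; rewrite -oppr_eq0.
  by rewrite -(tau_odd_ad _ (tau_xiop k)) Tx tau0.
suff H phi : x phi = 0 /\ tau x phi = 0 by apply/lfunP => phi; rewrite zero_lfunE; case: (H phi).
elim/Lambda_ind: phi => [c phi psi [p1 p2] [q1 q2]||k phi [p1 p2]].
- by rewrite !linearP /= p1 p2 q1 q2 scaler0 addr0.
- by rewrite tau_unit x1 linear0.
- by rewrite xX txX p1 p2 linear0.
Qed.

Lemma super_commutant x : (forall k, odd_ad (xiop k) x = 0) -> x = mu (x unitL).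
Proof.
move=> Tx; apply/eqP; rewrite -subr_eq0; apply/eqP/super_comm_eq0 => [k|].
  by rewrite odd_adB Tx odd_ad_xi_mu subrr.
by rewrite add_lfunE opp_lfunE mu_unitr subrr.
Qed.

(** The operators mu phi; phi is recovered as the value at 1. *)
Definition is_mult (x : 'End(L)) := x = mu (x unitL).

Lemma is_mult_mu phi : is_mult (mu phi). Proof. by rewrite /is_mult mu_unitr. Qed.
Lemma is_multP x : is_mult x <-> forall k, odd_ad (xiop k) x = 0.
Proof. by split=> [-> k|]; [exact: odd_ad_xi_mu | exact: super_commutant]. Qed.
Lemma is_mult_lin c x y : is_mult x -> is_mult y -> is_mult (c *: x + y).
Proof. by move=> -> ->; rewrite -muZ -muD; exact: is_mult_mu. Qed.
Lemma is_mult0 : is_mult 0. Proof. by rewrite -mu0; exact: is_mult_mu. Qed.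
Lemma is_multN x : is_mult x -> is_mult (- x).
Proof. by move=> kx; rewrite -[- x]addr0 -scaleN1r; apply: is_mult_lin => //; exact: is_mult0. Qed.
Lemma is_multD x y : is_mult x -> is_mult y -> is_mult (x + y).
Proof. by move=> kx ky; rewrite -[x]scale1r; apply: is_mult_lin. Qed.
Lemma is_mult_comp x y : is_mult x -> is_mult y -> is_mult (x \o y)%VF.
Proof. by move=> -> ->; rewrite mu_comp; exact: is_mult_mu. Qed.
Lemma is_mult_tau x : is_mult x -> is_mult (tau x).
Proof. by move=> ->; rewrite tau_mu; exact: is_mult_mu. Qed.

Lemma odd_ad_del_mu i phi : odd_ad (del i) (mu phi) = mu (del i phi).
Proof.
have K : is_mult (odd_ad (del i) (mu phi)).
  apply/is_multP => k; apply/eqP; rewrite -oppr_eq0 -odd_ad_del_xi odd_ad_xi_mu odd_ad0 eqxx //.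
by rewrite K odd_adE mu_unitr del_unit linear0 subr0.
Qed.

Lemma odd_ad_xi_del i j : odd_ad (xiop i) (del j) = (i == j)%:R *: \1%VF.
Proof.
apply/lfunP => phi; rewrite odd_adE tau_del !lfun_ev opprK del_xiop eq_sym addrCA subrr addr0 //.
Qed.

Lemma del_anti i j phi : del i (del j phi) = - del j (del i phi).
Proof.
suff : ((del i \o del j)%VF + (del j \o del i)%VF : 'End(L)) = 0.
  by move/lfunP/(_ phi); rewrite !lfun_ev => /eqP; rewrite addr_eq0 => /eqP.
apply: super_comm_eq0 => [k|]; last by rewrite !lfun_ev !del_unit !linear0 addr0.
rewrite odd_adD !odd_ad_comp !odd_ad_xi_del !tau_del; apply/lfunP => psi; rewrite !lfun_ev.
by rewrite [del i (_ *: _)]linearZ /= [del j (_ *: _)]linearZ /= addrA subrK subrr.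
Qed.

Lemma del_sq i phi : del i (del i phi) = 0.
Proof. by apply: (addrr_eq0 two); rewrite {1}del_anti addNr. Qed.

Lemma odd_ad_del_del i j x : odd_ad (del i) (odd_ad (del j) x) = - odd_ad (del j) (odd_ad (del i) x).
Proof.
apply: (odd_ad_anti (c := 0) x (tau_del i) (tau_del j)) => phi.
by rewrite scale0r sub0r del_anti.
Qed.

Definition clifford_gen (s : 'I_n + 'I_n) : 'End(L) :=
  match s with inl i => xiop i | inr i => del i end.

Lemma odd_ad_gen_sq s x : odd_ad (clifford_gen s) (odd_ad (clifford_gen s) x) = 0.
Proof.
by case: s => i; apply: odd_ad_sq; rewrite ?tau_xiop ?tau_del // => phi; rewrite ?xiop_sq ?del_sq.
Qed.

Lemma odd_ad_gen_anti s t x : odd_ad (clifford_gen s) (odd_ad (clifford_gen t) x) = - odd_ad (clifford_gen t) (odd_ad (clifford_gen s) x).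
Proof.
by case: s => i; case: t => j; rewrite /clifford_gen; [exact: odd_ad_xi_xi | exact: odd_ad_xi_del_anti | exact: odd_ad_del_xi | exact: odd_ad_del_del].
Qed.

(** Go once through the list of generators and bracket x with a generator
    whenever the result stays outside K. The brackets with earlier generators
    remain in K because the brackets with two generators anticommute, and
    bracketing twice with the same generator gives 0. *)
Lemma minimal_outside (M K : 'End(L) -> Prop) :
  (forall s x, M x -> M (odd_ad (clifford_gen s) x)) -> (forall s x, K x -> K (odd_ad (clifford_gen s) x)) ->
  (forall x, K x -> K (- x)) -> K 0 ->
  forall x, M x -> ~ K x ->
  exists y, [/\ M y, ~ K y & forall s, K (odd_ad (clifford_gen s) y)].
Proof.
move=> MT KT KN K0' x Mx nKx.
suff: forall r : seq ('I_n + 'I_n), exists y, [/\ M y, ~ K y & forall s, s \in r -> K (odd_ad (clifford_gen s) y)].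
  by case/(_ (enum {: 'I_n + 'I_n})) => y [My nKy Ky]; exists y; split=> // s; apply: Ky; rewrite mem_enum.
elim=> [|s r [y [My nKy Ky]]]; first by exists x.
have [Ks|nKs] := classic (K (odd_ad (clifford_gen s) y)).
  by exists y; split=> // t; rewrite inE => /predU1P[->|/Ky].
exists (odd_ad (clifford_gen s) y); split; [exact: MT | by [] | move=> t].
rewrite inE => /predU1P[->|tr]; first by rewrite odd_ad_gen_sq.
by rewrite odd_ad_gen_anti; apply/KN/KT/Ky.
Qed.

(** If xi_J occurs in phi and k is in J, then xi_(J - k) occurs in del_k phi
    with the same coefficient up to sign. *)
Lemma const_of_del phi : (forall k, del k phi = 0) -> exists c, phi = c *: unitL.
Proof.
move=> d0; exists (Lcoord set0 phi); rewrite {1}(Lsum phi) (bigD1 set0) //= big1 ?addr0 // => J J0.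
have [k kJ] : exists k, k \in J by apply/set0Pn.
rewrite LcoordE; suff -> : coefL phi J = 0 by rewrite scale0r.
have := congr1 (Lcoord (J :\ k)) (d0 k).
rewrite (linfunE (@del_lin k)) linear0 linear_sum (bigD1 J) //= big1 ?addr0 => [|K /andP[kK KJ]].
  rewrite !linearZ /= Lcoord_xi eqxx /GRing.scale /= mulr1 => /eqP.
  by rewrite mulf_eq0 signr_eq0 orbF => /eqP.
rewrite !linearZ /= Lcoord_xi (_ : _ == _ = false) ?scaler0 //.
by apply: contraNF KJ => /eqP e; rewrite -(setD1K kJ) e setD1K.
Qed.

(** Subtract from B its value at 1 to get D with D 1 = 0. Then the bracket of
    D with del_k is a multiplication with value 0 at 1, hence 0. So the
    bracket of D with xi_k is a multiplication by an element killed by all the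
    del_l, a constant c_k, and D - sum_i c_i del_i supercommutes with the xi_k
    and vanishes at 1. *)
Lemma first_order (B : 'End(L)) : (forall s, is_mult (odd_ad (clifford_gen s) B)) ->
  exists c : 'I_n -> F, (B = mu (B unitL) + \sum_i c i *: del i) /\
    forall k, odd_ad (xiop k) B = c k *: \1%VF.
Proof.
move=> KB; pose D := B - mu (B unitL).
have D1 : D unitL = 0 by rewrite add_lfunE opp_lfunE mu_unitr subrr.
have TD' k : odd_ad (xiop k) D = odd_ad (xiop k) B by rewrite odd_adB odd_ad_xi_mu subr0.
have KX k : is_mult (odd_ad (xiop k) D) by rewrite TD'; exact: (KB (inl k)).
have Kd k : odd_ad (del k) D = 0.
  have : is_mult (odd_ad (del k) D).
    rewrite odd_adB odd_ad_del_mu; apply: is_multD; [exact: (KB (inr k)) | exact/is_multN/is_mult_mu].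
  by move=> ->; rewrite odd_adE D1 del_unit !linear0 addr0 mu0.
have dX k l : del l (odd_ad (xiop k) D unitL) = 0.
  have := odd_ad_del_xi l k D; rewrite Kd odd_ad0 oppr0 (KX k) odd_ad_del_mu => /(congr1 (fun f : 'End(L) => f unitL)).
  by rewrite !mu_unitr zero_lfunE.
have cX k : exists c, odd_ad (xiop k) D = c *: \1%VF.
  have [c e] := const_of_del (dX k); exists c.
  by rewrite (KX k) e muZ mu_unit.
pose c k := coefL (odd_ad (xiop k) D unitL) set0.
have cE k : odd_ad (xiop k) D = c k *: \1%VF.
  have [d e] := cX k; rewrite e /c e scale_lfunE id_lfunE.
  by rewrite -LcoordE linearZ /= Lcoord_xi eqxx /GRing.scale /= mulr1.
exists c; split; last by move=> k; rewrite -TD'.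
apply/eqP; rewrite -subr_eq0 opprD addrA -/D; apply/eqP/super_comm_eq0 => [k|].
  rewrite odd_adB odd_ad_sum cE (bigD1 k) //= odd_adZ odd_ad_xi_del eqxx scale1r big1 ?addr0 ?subrr // => i ik.
  by rewrite odd_adZ odd_ad_xi_del eq_sym (negPf ik) scale0r scaler0.
rewrite add_lfunE opp_lfunE D1 sum_lfunE big1 ?subrr // => i _.
by rewrite scale_lfunE del_unit scaler0.
Qed.

(** The normalizer of Lambda(n) in End Lambda(n); only the generators xi_k
    need to be tested, see normalizes_decomp. *)
Definition normalizes (x : 'End(L)) := forall k, is_mult (odd_ad (xiop k) x).

Lemma normalizes_mult x : is_mult x -> normalizes x.
Proof. by move=> /is_multP Tx k; rewrite Tx; exact: is_mult0. Qed.
Lemma normalizes_lin c x y : normalizes x -> normalizes y -> normalizes (c *: x + y).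
Proof. by move=> kx ky k; rewrite odd_ad_lin; apply: is_mult_lin. Qed.
Lemma normalizesN x : normalizes x -> normalizes (- x).
Proof. by move=> kx k; rewrite odd_adN; apply: is_multN. Qed.
Lemma normalizes0 : normalizes 0. Proof. exact/normalizes_mult/is_mult0. Qed.
Lemma normalizesD x y : normalizes x -> normalizes y -> normalizes (x + y).
Proof. by move=> kx ky; rewrite -[x]scale1r; apply: normalizes_lin. Qed.
Lemma normalizesZ c x : normalizes x -> normalizes (c *: x).
Proof. by move=> kx; rewrite -[_ *: _]addr0; apply: normalizes_lin => //; exact: normalizes0. Qed.
Lemma normalizes_tau x : normalizes x -> normalizes (tau x).
Proof.
move=> kx k; rewrite -(tauK (odd_ad (xiop k) (tau x))) tau_odd_ad ?tau_xiop // tauK tauN.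
exact/is_multN/is_mult_tau.
Qed.
Lemma normalizes_mull phi x : normalizes x -> normalizes (mu phi \o x)%VF.
Proof.
move=> kx k; rewrite odd_ad_comp odd_ad_xi_mu comp_lfun0l add0r tau_mu.
by apply: is_mult_comp; [exact: is_mult_mu | exact: kx].
Qed.
Lemma normalizes_del i : normalizes (del i).
Proof. by move=> k; rewrite odd_ad_xi_del -mu_unit -muZ; exact: is_mult_mu. Qed.
Lemma is_mult_odd_ad s x : is_mult x -> is_mult (odd_ad (clifford_gen s) x).
Proof.
by move=> ->; case: s => i /=; rewrite ?odd_ad_xi_mu ?odd_ad_del_mu; [exact: is_mult0 | exact: is_mult_mu].
Qed.
Lemma normalizes_odd_ad s x : normalizes x -> normalizes (odd_ad (clifford_gen s) x).
Proof.
by move=> kx k; rewrite (odd_ad_gen_anti (inl k)); apply/is_multN/is_mult_odd_ad/kx.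
Qed.

Lemma vect_part a (D : gl L) : D \in vect n a -> D \in part (gl L) a.
Proof. by case/vectP. Qed.

Lemma vect_unit a (D : gl L) : D \in vect n a -> D unitL = 0.
Proof.
case/vectP => _ /(_ false unitL unitL unitL_part); rewrite andbF expr0 scale1r.
rewrite -!muE mu_unit !id_lfunE mu_unitr => e.
by apply: (addrI (D unitL)); rewrite -e addr0.
Qed.

Lemma vect_mu a b (D : gl L) phi : D \in vect n a -> phi \in part L b ->
  (D \o mu phi)%VF = mu (D phi) + (-1) ^+ (a && b) *: (mu phi \o D)%VF.
Proof.
case/vectP => _ H pb; apply/lfunP => psi; rewrite !lfun_ev !muE.
exact: H.
Qed.

Lemma vect_normalizes a (D : gl L) : D \in vect n a -> normalizes D.
Proof.
move=> vD k; rewrite odd_ad_def (tau_part (vect_part vD)) -comp_lfunZl.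
rewrite (vect_mu vD (xi1_part k)) andbT scalerDr scalerA -expr2 sqrr_sign scale1r.
by rewrite opprD addrCA subrr addr0 -muZ -scaleN1r -muZ; exact: is_mult_mu.
Qed.

(** The bracket of D with mu phi satisfies a Leibniz rule in phi, so that it
    is a multiplication for all phi as soon as it is one for the generators.
    Being a multiplication, it is determined by its value at 1, which is D phi
    because D 1 = 0; this is the Leibniz rule for D. *)
Lemma vect_of_normalizes a (D : gl L) :
  D \in part (gl L) a -> normalizes D -> D unitL = 0 -> D \in vect n a.
Proof.
move=> Da KD D1; pose ta (x : 'End(L)) := if a then tau x else x.
pose A phi := (D \o mu phi)%VF - (ta (mu phi) \o D)%VF.
have taE b phi : phi \in part L b -> ta (mu phi) = (-1) ^+ (a && b) *: mu phi.
  by rewrite /ta => pb; case: (a); rewrite ?(tau_part (mu_part pb)) ?expr0 ?scale1r.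
have taM phi psi : ta (mu (gmul phi psi)) = (ta (mu phi) \o ta (mu psi))%VF.
  by rewrite /ta -mu_comp; case: (a); rewrite ?tau_comp.
have taK phi : is_mult (ta (mu phi)).
  by rewrite /ta; case: (a); [exact/is_mult_tau/is_mult_mu | exact: is_mult_mu].
have A_lin c phi psi : A (c *: phi + psi) = c *: A phi + A psi.
  rewrite /A mu_lin comp_lfunDr -comp_lfunZr.
  have -> : ta (c *: mu phi + mu psi) = c *: ta (mu phi) + ta (mu psi).
    by rewrite /ta; case: (a); rewrite ?tau_linear.
  by rewrite comp_lfunDl -comp_lfunZl opprD addrACA scalerBr.
have AX k : is_mult (A (xi1 k)).
  have := KD k; rewrite odd_ad_def (tau_part Da) -comp_lfunZl => /(is_mult_lin (- (-1) ^+ a))/(_ is_mult0).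
  rewrite addr0 scalerBr scalerA mulNr -expr2 sqrr_sign scaleN1r opprK addrC scaleNr.
  by rewrite /A (taE _ _ (xi1_part k)) andbT comp_lfunZl.
have KA phi : is_mult (A phi).
  elim/Lambda_ind: phi => [c phi psi Kp Kq||k phi Kp]; first by rewrite A_lin; exact: is_mult_lin.
    rewrite /A (taE _ _ unitL_part) andbF expr0 scale1r mu_unit comp_lfun1l comp_lfun1r subrr.
    exact: is_mult0.
  have -> : A (xiop k phi) = (A (xi1 k) \o mu phi)%VF + (ta (xiop k) \o A phi)%VF.
    rewrite /A /xiop muE taM -mu_comp comp_lfunDl comp_lfunDr comp_lfunNl comp_lfunNr !comp_lfunA.
    by rewrite addrA subrK.
  by apply: is_multD; apply: is_mult_comp => //; [exact: is_mult_mu | exact: taK].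
apply/vectP; split=> // b phi psi pb.
have := KA phi; rewrite /is_mult /A !lfun_ev D1 linear0 subr0 mu_unitr.
rewrite (taE _ _ pb) -comp_lfunZl => /eqP; rewrite subr_eq => /eqP/lfunP/(_ psi).
by rewrite !lfun_ev !muE.
Qed.

(** After subtracting the value at 1, the homogeneous components still
    normalize Lambda(n) and vanish at 1, so vect_of_normalizes applies to
    them. *)
Lemma normalizes_decomp x : normalizes x -> exists D : bool -> gl L,
  [/\ D false \in vect n false, D true \in vect n true
    & x = mu (x unitL) + (D false + D true)].
Proof.
move=> kx; pose y := x - mu (x unitL).
have ky : normalizes y by apply: normalizesD => //; apply/normalizesN/normalizes_mult/is_mult_mu.
have y1 : y unitL = 0 by rewrite add_lfunE opp_lfunE mu_unitr subrr.
have v a : proj (gl L) a y \in vect n a.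
  apply: vect_of_normalizes; first exact: proj_in.
    by rewrite (proj_tau two); apply/normalizesZ/normalizesD => //; apply/normalizesZ/normalizes_tau.
  have ty : tau y unitL = 0 by rewrite tau_unit y1 linear0.
  by rewrite (proj_tau two) scale_lfunE add_lfunE y1 scale_lfunE ty scaler0 addr0 scaler0.
exists (fun a => proj (gl L) a y); split; [exact: v | exact: v |].
by rewrite -sum_proj /y addrC subrK.
Qed.

Lemma del_vect i : (del i : gl L) \in vect n true.
Proof. by apply: vect_of_normalizes; [exact: del_part | exact: normalizes_del | exact: del_unit]. Qed.

Lemma xi_del_vect i j : ((xiop i \o del j)%VF : gl L) \in vect n false.
Proof.
apply: vect_of_normalizes; last by rewrite comp_lfunE del_unit linear0.
  exact: (comp_part (xiop_part i) (del_part j)).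
exact/normalizes_mull/normalizes_del.
Qed.

Definition Eunit I J : 'End(L) := munit (B := Lbasis) I J.

Lemma Eunit_xi I J K : Eunit I J (xi K) = (J == K)%:R *: xi I.
Proof. exact: (munit_vec (B := Lbasis)). Qed.

Lemma mu_Eunit0 I J : (mu (xi I) \o Eunit set0 J)%VF = Eunit I J.
Proof.
apply: Lambda_ext => K; rewrite comp_lfunE !Eunit_xi linearZ /= mu_xi.
by rewrite inversions0r expr0 scale1r setU0 -setI_eq0 setI0 eqxx.
Qed.

(** The product xi_K xi_J is a nonzero multiple of the top monomial only if J
    is the complement of K. *)
Lemma Eunit_top_mu I K : exists2 c : F, c != 0 & (Eunit I setT \o mu (xi K))%VF = c *: Eunit I (~: K).
Proof.
exists ((-1) ^+ inversions K (~: K)); first by rewrite signr_eq0.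
apply: Lambda_ext => J; rewrite comp_lfunE scale_lfunE Eunit_xi mu_xi.
have [<-|KJ] := eqVneq (~: K) J.
  rewrite -setI_eq0 setICr eqxx linearZ /= setUCr Eunit_xi eqxx.
  by [].
rewrite scale0r scaler0; case: ifPn => d; last by rewrite linear0.
rewrite linearZ /= Eunit_xi (_ : setT == _ = false) ?scale0r ?scaler0 //.
apply: contraNF KJ => /eqP e; rewrite eqEsubset; apply/andP; split; last first.
  by rewrite -disjoints_subset disjoint_sym.
apply/subsetP => k; rewrite inE => kK; have : k \in setT by rewrite inE.
by rewrite e inE (negPf kK).
Qed.

Lemma mu_top : mu (xi setT) = Eunit setT set0.
Proof.
apply: Lambda_ext => J; rewrite Eunit_xi mu_xi -setI_eq0 setTI eq_sym.
have [->|] := eqVneq J set0; last by rewrite scale0r.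
by rewrite inversions0r expr0 setU0.
Qed.

Definition dels (s : seq 'I_n) : 'End(L) := foldr (fun i f => (del i \o f)%VF) \1%VF s.

Lemma dels_cons i s : dels (i :: s) = (del i \o dels s)%VF. Proof. by []. Qed.

Lemma dels_xi s J : uniq s -> exists2 c : F, c != 0 &
  dels s (xi J) = if [set i in s] \subset J then c *: xi (J :\: [set i in s]) else 0.
Proof.
elim: s => [|i s IH] /=.
  exists 1; rewrite ?oner_neq0 // id_lfunE scale1r set_nil sub0set setD0 //.
case/andP=> iNs /IH[c c0 e]; rewrite comp_lfunE e set_cons subUset sub1set.
case: ifPn => sJ; last by exists 1; rewrite ?oner_neq0 // andbF linear0.
rewrite andbT linearZ /= del_xi !inE iNs /=.
case: ifPn => iJ; last by exists 1; rewrite ?oner_neq0 // scaler0.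
exists (c * (-1) ^+ inversions [set i] ((J :\: [set x in s]) :\ i)).
  by rewrite mulf_neq0 ?signr_eq0.
by rewrite scalerA setDDl setUC.
Qed.

(** Removing all the variables one after the other leaves 1 from the top
    monomial, and kills the monomials in which a variable is missing. *)
Lemma dels_top s : uniq s -> (forall i, i \in s) ->
  exists2 c : F, c != 0 & dels s = c *: Eunit set0 setT.
Proof.
move=> us ss; have sT : [set i in s] = setT by apply/setP => i; rewrite !inE ss.
have [c c0 e] := dels_xi setT us; exists c => //; apply: Lambda_ext => J.
rewrite scale_lfunE Eunit_xi; have [<-|TJ] := eqVneq setT J.
  by rewrite e sT subxx setDv scale1r.
have [d _ ->] := dels_xi J us; rewrite sT subTset eq_sym (negPf TJ).
by rewrite scale0r scaler0.
Qed.

Lemma dels_anti i s phi : dels s (del i phi) = (-1) ^+ size s *: del i (dels s phi).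
Proof.
elim: s => [|j s IH] /=; first by rewrite !id_lfunE expr0 scale1r.
by rewrite !comp_lfunE IH linearZ /= del_anti exprS mulN1r scalerN scaleNr.
Qed.

Lemma tau_dels s : tau (dels s) = (-1) ^+ size s *: dels s.
Proof.
elim: s => [|j s IH].
  by rewrite /= (tau_part (id_part _)).
by rewrite dels_cons tau_comp tau_del IH comp_lfunNl -comp_lfunZr exprS mulN1r scaleNr.
Qed.

(** Write x = x del_k xi_k + x xi_k del_k. The two terms have opposite
    supertraces: xi_k, which commutes with x, can be moved cyclically from the
    end of the first to its beginning. *)
Lemma supertrace_xiop_commute k (x : gl L) : x \in part (gl L) false ->
  odd_ad (xiop k) x = 0 -> supertrace x = 0.
Proof.
move=> x0 Tx.
have Xx : (xiop k \o x)%VF = (x \o xiop k)%VF.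
  by apply/eqP; rewrite -subr_eq0 -[X in _ - (X \o _)%VF]scale1r -[1](expr0 (-1)) -(tau_part x0) -odd_ad_def Tx.
have e : (x : 'End(L)) = ((x \o del k) \o xiop k)%VF + ((x \o xiop k) \o del k)%VF.
  by apply/lfunP => phi; rewrite !lfun_ev del_xiop eqxx scale1r -linearD subrK.
have xd := comp_part x0 (del_part k); have xX := comp_part x0 (xiop_part k).
have slin := supertrace_lin Lbasis.
rewrite e -[X in X + _]scale1r slin mul1r (supertrace_comm Lbasis xd (xiop_part k)).
by rewrite /= expr1 mulN1r comp_lfunA Xx addNr.
Qed.

Lemma supertraceD (x y : gl L) : supertrace (x + y) = supertrace x + supertrace y.
Proof. by have := supertrace_lin Lbasis 1 x y; rewrite scale1r mul1r. Qed.

Lemma supertrace_mu (k : 'I_n) phi : supertrace (mu phi : gl L) = 0.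
Proof.
rewrite -(proj_add false phi) muD supertraceD.
rewrite (supertrace_xiop_commute (k := k) (mu_part (proj_in _ _)) (odd_ad_xi_mu k _)) add0r.
exact: (supertrace_odd Lbasis (mu_part (proj_in _ _))).
Qed.

(** Argue as in supertrace_xiop_commute: D fails to commute with xi_j by
    D(xi_j), hence D and D(xi_j) del_j have the same supertrace, and the
    latter operator commutes with the other variable xi_i. *)
Lemma supertrace_vect (i j : 'I_n) a (D : gl L) : i != j -> D \in vect n a -> supertrace D = 0.
Proof.
move=> ij vD; have Dp := vect_part vD; case: a vD Dp => vD Dp.
  exact: (supertrace_odd Lbasis Dp).
have Dj : D (xi1 j) \in part L true by move/gl_partP: Dp => H; exact: (H _ _ (xi1_part j)).
pose x := (mu (D (xi1 j)) \o del j)%VF.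
have x0 : (x : gl L) \in part (gl L) false := comp_part (mu_part Dj) (del_part j).
have Tx : odd_ad (xiop i) x = 0.
  by rewrite /x odd_ad_comp odd_ad_xi_mu comp_lfun0l add0r odd_ad_xi_del (negPf ij) scale0r comp_lfun0r.
rewrite -(supertrace_xiop_commute x0 Tx).
have e : (D : 'End(L)) = (((D : 'End(L)) \o del j) \o xiop j)%VF + ((xiop j \o (D : 'End(L))) \o del j)%VF + x.
  apply/lfunP => phi; rewrite !lfun_ev del_xiop eqxx scale1r linearB /=.
  have /lfunP/(_ (del j phi)) := vect_mu vD (xi1_part j).
  by rewrite andFb expr0 scale1r !lfun_ev -/(xiop j) => ->; rewrite -addrA [X in _ + X]addrC subrK.
have Dd := comp_part Dp (del_part j); have XD := comp_part (xiop_part j) Dp.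
rewrite {1}e !supertraceD (supertrace_comm Lbasis Dd (xiop_part j)) /= expr1 mulN1r comp_lfunA.
by rewrite addNr add0r.
Qed.

Lemma mu_vect b c (phi : L) (D : gl L) : phi \in part L b -> D \in vect n c ->
  ((mu phi \o D)%VF : gl L) \in vect n (b (+) c).
Proof.
move=> pb vD.
have Kx : normalizes (mu phi \o (D : 'End(L)))%VF := normalizes_mull phi (vect_normalizes vD).
have x1 : (mu phi \o (D : 'End(L)))%VF unitL = 0 by rewrite comp_lfunE (vect_unit vD) linear0.
exact: (vect_of_normalizes (comp_part (mu_part pb) (vect_part vD)) Kx x1).
Qed.

(** The cancellation of the mixed terms in the Leibniz rule for a superbracket
    of derivations. *)
Lemma leibniz_signs (U : lmodType F) (s p q : F) (x1 x2 x3 x4 y1 y4 : U) : s * s = 1 ->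
  (x1 + (s * p) *: x2 + q *: (x3 + p *: x4))
    - s *: (y1 + (s * q) *: x3 + p *: (x2 + q *: y4)) =
  x1 - s *: y1 + (p * q) *: (x4 - s *: y4).
Proof.
move=> ss; rewrite !scalerDr !scalerN !scalerA !mulrA ss mul1r.
rewrite [q * p]mulrC -[s * p * q]mulrA [s * (p * q)]mulrC !opprD.
rewrite (AC ((2*2)*(2*2)) (((1*5)*(4*8))*((2*7)*(3*6)))).
by rewrite /= !subrr !addr0.
Qed.

Lemma vect_bracket c d (D D' : gl L) : D \in vect n c -> D' \in vect n d ->
  sbracket c d D D' \in vect n (c (+) d).
Proof.
move=> vD vD'; apply/vectP; split; first exact: (sbracket_part (vect_part vD) (vect_part vD')).
move=> b phi psi pb.
have [/gl_partP Dh lD] := (vectP _ _).1 vD; have [/gl_partP D'h lD'] := (vectP _ _).1 vD'.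
have sE (f g : 'End(L)) (x : L) :
    (sbracket c d (f : gl L) g) x = f (g x) - (-1) ^+ (c && d) *: g (f x).
  by rewrite /sbracket add_lfunE opp_lfunE scale_lfunE !comp_lfunE.
have pDD x : gmul (D (D' phi) - (-1) ^+ (c && d) *: D' (D phi)) x =
    gmul (D (D' phi)) x - (-1) ^+ (c && d) *: gmul (D' (D phi)) x.
  by rewrite -!(linfunE (gmul_linl x)) linearB linearZ.
have pDDr x y : gmul phi (x - (-1) ^+ (c && d) *: y) = gmul phi x - (-1) ^+ (c && d) *: gmul phi y.
  by rewrite -!(linfunE (gmul_linr phi)) linearB linearZ.
rewrite !sE pDD pDDr (lD' _ _ _ pb) (lD _ _ _ pb).
have lDD : D (gmul (D' phi) psi + (-1) ^+ (d && b) *: gmul phi (D' psi)) =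
    D (gmul (D' phi) psi) + (-1) ^+ (d && b) *: D (gmul phi (D' psi)).
  by rewrite linearD linearZ.
have lDD' : D' (gmul (D phi) psi + (-1) ^+ (c && b) *: gmul phi (D psi)) =
    D' (gmul (D phi) psi) + (-1) ^+ (c && b) *: D' (gmul phi (D psi)).
  by rewrite linearD linearZ.
rewrite lDD lDD' (lD _ _ _ (D'h _ _ pb)) (lD _ _ _ pb) (lD' _ _ _ (Dh _ _ pb)) (lD' _ _ _ pb).
rewrite [(c (+) d) && b]andbC !sgn_andb [d && c]andbC ![b && _]andbC.
by apply: leibniz_signs; rewrite -expr2 sqrr_sign.
Qed.

End GrassmannAlgebra.

Arguments Lcoord {F n} J.
Arguments xi1 {F n} i.
Arguments xiop {F n} i.
Arguments del {F n} i.
Arguments clifford_gen {F n} s.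
Arguments Eunit {F n} I J.
Arguments dels {F n} s.

(** * Tensor products of operators and the algebra g *)

Section Tensor.
Variables (F : fieldType) (V1 : superspace F) (n : nat).
Hypothesis two : 2 != 0 :> F.
Notation L := (Lambda F n).
Notation xi := (xi F).
Notation V := (tensL V1 n).
Implicit Types (A B : 'End(V1)) (D : 'End(L)).

Lemma pure_linl (E : superspace F) (phi : L) : linear (fun v : E => pure v phi).
Proof. by move=> c u w; apply/ffunP => I; rewrite !ffunE scalerDr !scalerA mulrC. Qed.

Lemma pure_linr (E : superspace F) (v : E) : linear (pure (n := n) v).
Proof. by move=> c u w; apply/ffunP => I; rewrite !ffunE coefL_lin scalerDl scalerA. Qed.

Lemma pure_sumr (E : superspace F) (v : E) (I : finType) (P : pred I) (G : I -> L) :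
  pure v (\sum_(i | P i) G i) = \sum_(i | P i) pure v (G i).
Proof.
rewrite -(linfunE (pure_linr v)) linear_sum; apply: eq_bigr => i _.
exact: (linfunE (pure_linr v)).
Qed.

Lemma pure_suml (E : superspace F) (phi : L) (I : finType) (P : pred I) (G : I -> E) :
  pure (\sum_(i | P i) G i) phi = \sum_(i | P i) pure (G i) phi.
Proof.
rewrite -(linfunE (pure_linl phi)) linear_sum; apply: eq_bigr => i _.
exact: (linfunE (pure_linl phi)).
Qed.

Lemma pureZr (E : superspace F) (v : E) c (phi : L) : pure v (c *: phi) = c *: pure v phi.
Proof. by rewrite -!(linfunE (pure_linr v)) linearZ. Qed.
Lemma pureZl (E : superspace F) (v : E) c (phi : L) : pure (c *: v) phi = c *: pure v phi.
Proof. by rewrite -!(linfunE (pure_linl phi)) linearZ. Qed.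

Lemma tens_decomp (E : superspace F) (w : tensL E n) :
  w = \sum_(J : {set 'I_n}) pure (coefL w J) (xi J).
Proof.
apply/ffunP => K; rewrite sum_ffunE (bigD1 K) //= !ffunE coefL_xi eqxx scale1r.
rewrite big1 ?addr0 // => J JK.
by rewrite !ffunE coefL_xi eq_sym (negPf JK) scale0r.
Qed.

Definition tens_fun A D (w : V) : V := \sum_(J : {set 'I_n}) pure (A (coefL w J)) (D (xi J)).

Fact tens_fun_lin A D : linear (tens_fun A D).
Proof.
move=> c u w; rewrite /tens_fun scaler_sumr -big_split; apply: eq_bigr => J _ /=.
by rewrite coefL_lin linearP /= pure_linl.
Qed.

(** The tensor product of operators without the sign rule. Composition is then
    componentwise (tens_comp), and the signs of the representation become
    powers of the parity operator of V1 in the left factor (rho_gl_pure,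
    rho_vect_tens). *)
Definition tens A D : 'End(V) := linfun (tens_fun A D).

Lemma tens_pure A D (v : V1) (psi : L) : tens A D (pure v psi) = pure (A v) (D psi).
Proof.
rewrite (linfunE (tens_fun_lin _ _)) /tens_fun {2}(Lambda_decomp psi) linear_sum pure_sumr.
by apply: eq_bigr => J _; rewrite coefL_pure !linearZ pureZl pureZr.
Qed.

Lemma tens_ext (U : vectType F) (f g : 'Hom(V, U)) :
  (forall (v : V1) J, f (pure v (xi J)) = g (pure v (xi J))) -> f = g.
Proof.
move=> fg; apply/lfunP => w; rewrite (tens_decomp w) !linear_sum.
by apply: eq_bigr => J _; exact: fg.
Qed.

Lemma tens_linl D : linear (tens^~ D).
Proof.
move=> c A B; apply: tens_ext => v J; rewrite add_lfunE scale_lfunE !tens_pure.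
by rewrite add_lfunE scale_lfunE pure_linl.
Qed.

Lemma tens_linr A : linear (tens A).
Proof.
move=> c D D'; apply: tens_ext => v J; rewrite add_lfunE scale_lfunE !tens_pure.
by rewrite add_lfunE scale_lfunE pure_linr.
Qed.

Lemma tensZl c A D : tens (c *: A) D = c *: tens A D.
Proof. by rewrite -!(linfunE (tens_linl D)) linearZ. Qed.
Lemma tensZr c A D : tens A (c *: D) = c *: tens A D.
Proof. by rewrite -!(linfunE (tens_linr A)) linearZ. Qed.
Lemma tensDl A B D : tens (A + B) D = tens A D + tens B D.
Proof. by rewrite -!(linfunE (tens_linl D)) linearD. Qed.
Lemma tensDr A D D' : tens A (D + D') = tens A D + tens A D'.
Proof. by rewrite -!(linfunE (tens_linr A)) linearD. Qed.
Lemma tensNl A D : tens (- A) D = - tens A D.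
Proof. by rewrite -!(linfunE (tens_linl D)) linearN. Qed.
Lemma tensNr A D : tens A (- D) = - tens A D.
Proof. by rewrite -!(linfunE (tens_linr A)) linearN. Qed.
Lemma tensBr A D D' : tens A (D - D') = tens A D - tens A D'.
Proof. by rewrite tensDr tensNr. Qed.
Lemma tensBl A B D : tens (A - B) D = tens A D - tens B D.
Proof. by rewrite tensDl tensNl. Qed.
Lemma tens0l D : tens 0 D = 0.
Proof. by rewrite -(linfunE (tens_linl D)) linear0. Qed.
Lemma tens0r A : tens A 0 = 0.
Proof. by rewrite -(linfunE (tens_linr A)) linear0. Qed.
Lemma tens_suml (I : finType) (P : pred I) (G : I -> 'End(V1)) D :
  tens (\sum_(i | P i) G i) D = \sum_(i | P i) tens (G i) D.
Proof. exact: (big_morph (tens^~ D) (fun x y => tensDl x y D) (tens0l D)). Qed.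
Lemma tens_sumr (I : finType) (P : pred I) (G : I -> 'End(L)) A :
  tens A (\sum_(i | P i) G i) = \sum_(i | P i) tens A (G i).
Proof. exact: (big_morph (tens A) (tensDr A) (tens0r A)). Qed.

Lemma tens_comp A B D D' : (tens A D \o tens B D')%VF = tens (A \o B)%VF (D \o D')%VF.
Proof. by apply: tens_ext => v J; rewrite comp_lfunE !tens_pure !comp_lfunE. Qed.

Section TensorBasis.
Variable B : hbasis V1.
Let I := (hidx B * {set 'I_n})%type.
Let tvec (p : I) : V := pure (hvec p.1) (xi p.2).
Let tpar (p : I) : bool := hpar p.1 (+) odd #|p.2|.
Let tcrd_fun (p : I) (w : V) : F^o := hcrd p.1 (coefL w p.2).
Let tcrd p : 'Hom(V, F^o) := linfun (tcrd_fun p).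

Fact tcrdE p w : tcrd p w = hcrd p.1 (coefL w p.2).
Proof. by apply: linfunE => c u v; rewrite /tcrd_fun coefL_lin linearP. Qed.

Fact tvec_part p : tvec p \in part V (tpar p).
Proof.
apply/tens_partP => J; rewrite ffunE coefL_xi; have [->|] := eqVneq J p.2; last first.
  by rewrite scale0r mem0v.
by rewrite scale1r -addbA addbb addbF hvec_part.
Qed.

Fact tcrd_tvec p q : tcrd p (tvec q) = (p == q)%:R.
Proof.
case: p q => [i J] [j K]; rewrite tcrdE coefL_pure coefL_xi linearZ /= hcrd_vec.
by rewrite -pair_eqE /= /GRing.scale /= -natrM mulnb andbC.
Qed.

Fact tsum w : w = \sum_p tcrd p w *: tvec p.
Proof.
rewrite {1}(tens_decomp w) -(pair_bigA _ (fun i J => tcrd (i, J) w *: tvec (i, J))) exchange_big.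
apply: eq_bigr => J _ /=; rewrite {1}(hsum B (coefL w J)) pure_suml; apply: eq_bigr => i _.
by rewrite pureZl tcrdE.
Qed.

Definition tbasis : hbasis V := HBasis tvec_part tcrd_tvec tsum.

Lemma munit_tens i j P Q :
  munit (B := tbasis) (i, P) (j, Q) = tens (munit i j) (Eunit P Q).
Proof.
apply: tens_ext => v K; rewrite tens_pure munitE munitE Eunit_xi pureZl pureZr scalerA /=.
by rewrite tcrdE /= coefL_pure coefL_xi linearZ /= /GRing.scale /= mulrC.
Qed.

Lemma supertrace_tens A D :
  supertrace (tens A D : gl V) = supertrace (A : gl V1) * supertrace (D : gl L).
Proof.
rewrite (supertraceE tbasis) (supertraceE B) (supertraceE (Lbasis F n)).
rewrite mulr_suml -(pair_bigA _ (fun i J => (-1) ^+ tpar (i, J) * tcrd (i, J) (tens A D (tvec (i, J))))).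
apply: eq_bigr => i _; rewrite mulr_sumr; apply: eq_bigr => J _ /=.
rewrite tcrdE tens_pure coefL_pure /= linearZ /= signr_addb LcoordE.
by rewrite /GRing.scale /= [X in _ * X]mulrC mulrACA.
Qed.

End TensorBasis.

Lemma sgn_tens : sgn V = tens (sgn V1) (sgn L).
Proof.
move: (canonical_hbasis V1) => B; apply: (hbasis_ext (B := tbasis B)) => p.
rewrite (sgnE (hvec_part p)) /= tens_pure.
rewrite (sgnE (hvec_part _)) (sgnE (xi_part F p.2)) pureZl pureZr scalerA.
by rewrite -signr_addb.
Qed.

Lemma tau_tens A D : tau (tens A D) = tens (tau A) (tau D).
Proof. by rewrite !tau_def sgn_tens !tens_comp. Qed.

Lemma tens_part a b (A : gl V1) (D : gl L) :
  A \in part (gl V1) a -> D \in part (gl L) b ->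
  (tens A D : gl V) \in part (gl V) (a (+) b).
Proof.
move=> Aa Db; apply: (part_of_tau two); rewrite tau_tens (tau_part Aa) (tau_part Db).
by rewrite tensZl tensZr scalerA -signr_addb.
Qed.

Lemma signop_sgn a : signop V1 a = if a then sgn V1 else \1%VF.
Proof. by case: a; rewrite ?signop_false // -sgn_def. Qed.

Lemma rho_vect_tens a (D : gl L) : rho_vect V1 a D = tens (signop V1 a) D.
Proof. by []. Qed.

Lemma rho_gl_pure (A : gl V1) J :
  rho_gl (pure (A : gl V1) (xi J)) = tens (A \o signop V1 (odd #|J|))%VF (mu (xi J)).
Proof.
move: (canonical_hbasis V1) => B; apply: (hbasis_ext (B := tbasis B)) => p /=.
rewrite (rho_glE _ _ (xi_part F J) (hvec_part p.1)) tens_pure muE comp_lfunE.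
by rewrite (signopE _ (hvec_part _)) linearZ pureZl.
Qed.

Definition gl_tens : {vspace gl V} := limg (linfun (@rho_gl F V1 n)).

Lemma gl_tensP f : f \in gl_tens -> exists A : {set 'I_n} -> 'End(V1),
  f = \sum_J tens (A J) (mu (xi J)).
Proof.
case/memv_imgP => X _ ->; rewrite (linfunE (@rho_gl_lin F V1 n)).
exists (fun J => (coefL X J \o signop V1 (odd #|J|))%VF).
rewrite -(linfunE (@rho_gl_lin F V1 n)) {1}(tens_decomp X) linear_sum /=.
by apply: eq_bigr => J _; rewrite (linfunE (@rho_gl_lin F V1 n)) rho_gl_pure.
Qed.

Lemma mem_gl_tens A phi : (tens A (mu phi) : gl V) \in gl_tens.
Proof.
rewrite (Lambda_decomp phi) mu_sum tens_sumr; apply: memv_suml => J _.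
rewrite muZ tensZr memvZ //.
have -> : A = ((A \o signop V1 (odd #|J|)) \o signop V1 (odd #|J|))%VF.
  by rewrite -comp_lfunA signop_signop addbb signop_false comp_lfun1r.
rewrite -rho_gl_pure -(linfunE (@rho_gl_lin F V1 n)).
exact/memv_img/memvf.
Qed.

Lemma sbracket_tens a b A B D D' :
  sbracket a b (tens A D : gl V) (tens B D') =
  tens (A \o B)%VF (D \o D')%VF - (-1) ^+ (a && b) *: tens (B \o A)%VF (D' \o D)%VF.
Proof. by rewrite /sbracket !tens_comp. Qed.

(** For eta = 0 this is g itself (g_ext0); for eta an odd matrix unit of a
    superspace of dimension 1 + epsilon it is larger than g. A single
    computation of brackets covers both. *)
Definition g_ext (eta : 'End(V1)) : {vspace gl V} :=
  (g_algebra V1 n +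
   \sum_(a : bool) linfun (fun D : gl L => tens (eta \o signop V1 a)%VF D : gl V) @: vect n a)%VS.

Lemma gl_tens_g : (gl_tens <= g_algebra V1 n)%VS.
Proof. exact: addvSl. Qed.

Lemma mem_g_vect a (D : gl L) : D \in vect n a -> (tens (signop V1 a) D : gl V) \in g_algebra V1 n.
Proof.
move=> vD; apply: (subvP (addvSr _ _)); apply: (subvP (sumv_sup a isT (subvv _))) => //.
by rewrite -rho_vect_tens -(linfunE (@rho_vect_lin F V1 n a)); exact: memv_img.
Qed.

Lemma g_sub (S : {vspace gl V}) : (forall A phi, (tens A (mu phi) : gl V) \in S) ->
  (forall a (D : gl L), D \in vect n a -> (tens (signop V1 a) D : gl V) \in S) ->
  (g_algebra V1 n <= S)%VS.
Proof.
move=> SE SV; rewrite subv_add; apply/andP; split.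
  by apply/subvP => f /gl_tensP[A ->]; apply: memv_suml => J _; exact: SE.
apply/subv_sumP => a _; apply/subvP => f /memv_imgP[D vD ->].
by rewrite (linfunE (@rho_vect_lin F V1 n a)) rho_vect_tens; exact: SV.
Qed.

Lemma mem_gP f : f \in g_algebra V1 n -> exists (A : {set 'I_n} -> 'End(V1)) (D : bool -> gl L),
  (forall a, D a \in vect n a) /\
  f = \sum_J tens (A J) (mu (xi J)) + (tens \1%VF (D false) + tens (sgn V1) (D true)).
Proof.
case/memv_addP => x /gl_tensP[A ->] [y /memv_sumP[z zP ->] ->].
have H a : exists D : gl L, D \in vect n a /\ z a = tens (signop V1 a) D.
  have /memv_imgP[D vD ->] := zP a isT; exists D; split=> //.
  by rewrite (linfunE (@rho_vect_lin F V1 n a)) rho_vect_tens.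
have [[D0 [v0 e0]] [D1 [v1 e1]]] := (H false, H true).
exists A, (fun a => if a then D1 else D0); split; first by case.
rewrite big_bool /= e0 e1 !signop_sgn; congr (_ + _).
exact: addrC.
Qed.

Section Extension.
Variable eta : 'End(V1).
Hypothesis eta_odd : (eta : gl V1) \in part (gl V1) true.
Hypothesis eta2 : (eta \o eta)%VF = 0.
Hypothesis eta_ad : forall a (A : gl V1), A \in part (gl V1) a ->
  exists p q, ((A : 'End(V1)) \o eta)%VF - (-1) ^+ a *: (eta \o A)%VF = p *: eta + q *: \1%VF.

Fact etav_lin a : linear (fun D : gl L => tens (eta \o signop V1 a)%VF D : gl V).
Proof. exact: tens_linr. Qed.

Lemma g_sub_ext : (g_algebra V1 n <= g_ext eta)%VS.
Proof. exact: addvSl. Qed.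

Lemma mem_ext_vect a (D : gl L) : D \in vect n a ->
  (tens (eta \o signop V1 a)%VF D : gl V) \in g_ext eta.
Proof.
move=> vD; apply: (subvP (addvSr _ _)); apply: (subvP (sumv_sup a isT (subvv _))) => //.
by rewrite -(linfunE (etav_lin a)); exact: memv_img.
Qed.

Lemma ext_sub (S : {vspace gl V}) : (g_algebra V1 n <= S)%VS ->
  (forall a (D : gl L), D \in vect n a -> (tens (eta \o signop V1 a)%VF D : gl V) \in S) ->
  (g_ext eta <= S)%VS.
Proof.
move=> SE SV; rewrite subv_add SE; apply/subv_sumP => a _; apply/subvP => f /memv_imgP[D vD ->].
by rewrite (linfunE (etav_lin a)); exact: SV.
Qed.

(** Homogeneous spanning families of gl(V1) (x) Lambda(n), of vect(0|n) and of
    eta (x) vect(0|n). *)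
Inductive ext_gen : bool -> gl V -> Prop :=
| ExtGl a b (A : gl V1) (phi : L) of A \in part (gl V1) a & phi \in part L b :
    ext_gen (a (+) b) (tens A (mu phi))
| ExtVect c (D : gl L) of D \in vect n c : ext_gen c (tens (signop V1 c) D)
| ExtEta c (D : gl L) of D \in vect n c : ext_gen (~~ c) (tens (eta \o signop V1 c)%VF D).

Lemma signop_comm c a (A : gl V1) : A \in part (gl V1) a ->
  (signop V1 c \o A)%VF = (-1) ^+ (c && a) *: ((A : 'End(V1)) \o signop V1 c)%VF.
Proof.
move=> Aa; rewrite signop_sgn; case: c; last by rewrite comp_lfun1l comp_lfun1r scale1r.
rewrite andTb; have := tau_part Aa; rewrite tau_def => e.
rewrite -[LHS]comp_lfun1r -sgn_sgn comp_lfunA e.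
by rewrite comp_lfunZl.
Qed.

Lemma ext_gen_in a f : ext_gen a f -> f \in g_ext eta /\ f \in part (gl V) a.
Proof.
case=> {a f} [a b A phi Aa pb|c D vD|c D vD].
- split; last exact/tens_part/mu_part.
  exact/(subvP g_sub_ext)/(subvP gl_tens_g)/mem_gl_tens.
- split; first exact/(subvP g_sub_ext)/mem_g_vect.
  exact: (tens_part (a := false) (signop_part _ _) (vect_part vD)).
split; first exact: mem_ext_vect.
have ec : ((eta \o signop V1 c)%VF : gl V1) \in part (gl V1) true.
  exact: (comp_part eta_odd (signop_part _ _)).
exact: (tens_part ec (vect_part vD)).
Qed.

Lemma ext_gen_span (S : {vspace gl V}) :
  (forall a f, ext_gen a f -> f \in S) -> (g_ext eta <= S)%VS.
Proof.
move=> SG; have S1 a b (A : gl V1) (phi : L) :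
    A \in part (gl V1) a -> phi \in part L b -> (tens A (mu phi) : gl V) \in S.
  by move=> Aa pb; exact: (SG _ _ (ExtGl Aa pb)).
apply: ext_sub => [|a D vD]; last exact: (SG _ _ (ExtEta vD)).
apply: g_sub => [A phi|a D vD]; last exact: (SG _ _ (ExtVect vD)).
rewrite (sum_proj A) -(proj_add false phi) muD tensDl !tensDr.
by apply: memvD; apply: memvD; apply: S1; apply: proj_in.
Qed.

Lemma bracket_gl_gl a b (A B : 'End(V1)) (phi psi : L) :
  sbracket a b (tens A (mu phi) : gl V) (tens B (mu psi)) \in g_ext eta.
Proof.
apply/(subvP g_sub_ext)/(subvP gl_tens_g); rewrite sbracket_tens !mu_comp.
by apply: memvB; [|apply: memvZ]; exact: mem_gl_tens.
Qed.

Lemma tens_swap c a b (A : gl V1) (phi : L) (D : gl L) :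
  A \in part (gl V1) a -> phi \in part L b -> D \in vect n c ->
  tens (signop V1 c \o A)%VF (D \o mu phi)%VF =
  (-1) ^+ (c && a) *: tens (A \o signop V1 c)%VF (mu (D phi))
  + (-1) ^+ (c && (a (+) b)) *: tens (A \o signop V1 c)%VF (mu phi \o D)%VF.
Proof.
move=> Aa pb vD; rewrite (signop_comm c Aa) (vect_mu vD pb) tensZl tensDr tensZr scalerDr.
by rewrite scalerA -sgn_andb.
Qed.

Lemma bracket_vect_gl c a b (A : gl V1) (phi : L) (D : gl L) :
  A \in part (gl V1) a -> phi \in part L b -> D \in vect n c ->
  sbracket c (a (+) b) (tens (signop V1 c) D : gl V) (tens A (mu phi)) \in g_ext eta.
Proof.
move=> Aa pb vD; apply/(subvP g_sub_ext)/(subvP gl_tens_g).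
rewrite sbracket_tens (tens_swap Aa pb vD) addrK.
exact/memvZ/mem_gl_tens.
Qed.

Lemma bracket_vect_vect c d (D D' : gl L) : D \in vect n c -> D' \in vect n d ->
  sbracket c d (tens (signop V1 c) D : gl V) (tens (signop V1 d) D') \in g_ext eta.
Proof.
move=> vD vD'; apply: (subvP g_sub_ext).
rewrite sbracket_tens !signop_signop [d (+) c]addbC -tensZr -tensBr.
exact: (mem_g_vect (vect_bracket vD vD')).
Qed.

Lemma bracket_vect_eta c d (D D' : gl L) : D \in vect n c -> D' \in vect n d ->
  sbracket c (~~ d) (tens (signop V1 c) D : gl V) (tens (eta \o signop V1 d)%VF D')
    \in g_ext eta.
Proof.
move=> vD vD'; rewrite sbracket_tens comp_lfunA (signop_comm c eta_odd) andbT.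
rewrite -comp_lfunZl -!comp_lfunA !signop_signop [d (+) c]addbC tensZl.
have -> : (-1) ^+ (c && ~~ d) = (-1) ^+ c * (-1) ^+ (c && d) :> F.
  by case: (c); case: (d); rewrite ?expr0 ?expr1 ?mulr1 // mulrNN mulr1.
rewrite -scalerA -scalerBr -tensZr -tensBr memvZ //.
exact: (mem_ext_vect (vect_bracket vD vD')).
Qed.

(** Write eta (x) D as the product of eta (x) 1 and of the action of D, and
    move D past phi by the Leibniz rule. The derivative term lies in gl(V1)
    (x) Lambda(n); what remains is the superbracket of eta with A, tensored
    with phi D, and this is where eta_ad enters. *)
Lemma bracket_eta_gl c a b (A : gl V1) (phi : L) (D : gl L) :
  A \in part (gl V1) a -> phi \in part L b -> D \in vect n c ->
  sbracket (~~ c) (a (+) b) (tens (eta \o signop V1 c)%VF D : gl V) (tens A (mu phi))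
    \in g_ext eta.
Proof.
move=> Aa pb vD; pose A' : 'End(V1) := (A \o signop V1 b)%VF.
have A'a : (A' : gl V1) \in part (gl V1) a.
  by rewrite -[a]addbF; exact: (comp_part Aa (signop_part _ _)).
have AE : (A : 'End(V1)) = (A' \o signop V1 b)%VF.
  by rewrite /A' -comp_lfunA signop_signop addbb signop_false comp_lfun1r.
have eN : tens (eta \o signop V1 c) D = (tens eta \1 \o tens (signop V1 c) D)%VF.
  by rewrite tens_comp comp_lfun1l.
rewrite /sbracket {1}eN -comp_lfunA tens_comp (tens_swap Aa pb vD) comp_lfunDr -!comp_lfunZr.
rewrite !tens_comp !comp_lfun1l -addrA; apply: memvD.
  apply/memvZ; apply/(subvP g_sub_ext)/(subvP gl_tens_g); rewrite comp_lfunA; exact: mem_gl_tens.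
have -> : (-1) ^+ (~~ c && (a (+) b)) = (-1) ^+ (c && (a (+) b)) * (-1) ^+ (a (+) b) :> F.
  by case: (c); case: (a (+) b); rewrite ?expr0 ?expr1 ?mulr1 ?mul1r // mulrNN mulr1.
rewrite -scalerA -scalerBr -tensZl -tensBl memvZ // !comp_lfunA.
have [p [q pq]] := eta_ad A'a.
(* The parity operator of exponent b in A accounts for the sign of moving phi
   past eta. *)
have -> : ((eta \o A) \o signop V1 c)%VF - (-1) ^+ (a (+) b) *: ((A \o eta) \o signop V1 c)%VF
   = - (-1) ^+ a *: ((p *: eta + q *: \1) \o signop V1 (b (+) c))%VF.
  rewrite -pq comp_lfunDl comp_lfunNl scalerBr -comp_lfunZl scalerA mulNr -expr2 sqrr_sign.
  rewrite scaleN1r opprK addrC; congr (_ + _); last first.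
    by rewrite -signop_signop AE !comp_lfunA.
  rewrite scaleNr -signop_signop; congr (- _).
  rewrite AE -[((_ \o signop V1 b) \o eta)%VF]comp_lfunA (signop_comm b eta_odd) andbT.
  rewrite -comp_lfunZr -comp_lfunZl scalerA.
  rewrite signr_addb -mulrA -expr2 sqrr_sign mulr1; congr (_ *: _).
  by rewrite !comp_lfunA.
rewrite comp_lfunDl -!comp_lfunZl comp_lfun1l scalerDr tensDl !scalerA !tensZl.
have vb := mu_vect pb vD.
apply: memvD; apply: memvZ; first exact: (mem_ext_vect vb).
exact: (subvP g_sub_ext _ (mem_g_vect vb)).
Qed.

Lemma bracket_eta_eta c d (D D' : 'End(L)) :
  sbracket (~~ c) (~~ d) (tens (eta \o signop V1 c)%VF D : gl V)
    (tens (eta \o signop V1 d)%VF D') \in g_ext eta.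
Proof.
have z a b : ((eta \o signop V1 a) \o (eta \o signop V1 b))%VF = 0.
  rewrite comp_lfunA -[((eta \o _) \o eta)%VF]comp_lfunA (signop_comm a eta_odd).
  by rewrite -comp_lfunZr comp_lfunA eta2 comp_lfun0l scaler0 comp_lfun0l.
by rewrite sbracket_tens !z !tens0l scaler0 subr0 mem0v.
Qed.

Lemma g_ext_Lie : Lie_subsuperalgebra (g_ext eta).
Proof.
apply: (Lie_of_gens ext_gen_in ext_gen_span) => a b f g Gf Gg.
have C x y u v : sbracket x y u v \in g_ext eta -> sbracket y x v u \in g_ext eta.
  by rewrite [sbracket y x v u]sbracketC memvN => /memvZ.
case: Gf => {a f} [a a' A phi Aa pa|c D vD|c D vD];
case: Gg => {b g} [b b' B psi Bb pb|d D' vD'|d D' vD'].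
- exact: bracket_gl_gl.
- exact/C/bracket_vect_gl.
- exact/C/bracket_eta_gl.
- exact: bracket_vect_gl.
- exact: bracket_vect_vect.
- exact: bracket_vect_eta.
- exact: bracket_eta_gl.
- exact/C/bracket_vect_eta.
- exact: bracket_eta_eta.
Qed.

End Extension.

Lemma g_ext0 : g_ext 0 = g_algebra V1 n.
Proof.
apply/eqP; rewrite eqEsubv; apply/andP; split; last exact: addvSl.
apply: ext_sub => // a D _; rewrite comp_lfun0l tens0l; exact: mem0v.
Qed.

Lemma g_Lie : Lie_subsuperalgebra (g_algebra V1 n).
Proof.
rewrite -g_ext0; apply: g_ext_Lie; first exact: mem0v.
  exact: comp_lfun0l.
by move=> a A _; exists 0, 0; rewrite comp_lfun0l comp_lfun0r !scaler0 !scale0r subrr addr0.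
Qed.

End Tensor.

(** * Blocks of the operators of g *)

Section Blocks.
Variables (F : fieldType) (V1 : superspace F) (n : nat) (B : hbasis V1).
Hypothesis two : 2 != 0 :> F.
Notation L := (Lambda F n).
Notation xi := (xi F).
Notation V := (tensL V1 n).
Implicit Types (a b c d : hidx B) (D : 'End(L)) (f : 'End(V)).

Definition tinj b : 'Hom(L, V) := linfun ((fun psi => pure (hvec b) psi) : L -> V).
Fact tout_lin a : linear ((fun w : V => \sum_(J : {set 'I_n}) hcrd a (coefL w J) *: xi J) : V -> L).
Proof.
move=> c u w; rewrite scaler_sumr -big_split; apply: eq_bigr => J _ /=.
by rewrite coefL_lin linearP scalerDl scalerA.
Qed.
Definition tout a : 'Hom(V, L) :=
  linfun ((fun w : V => \sum_(J : {set 'I_n}) hcrd a (coefL w J) *: xi J) : V -> L).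

Lemma tinjE b psi : tinj b psi = pure (hvec b) psi.
Proof. by apply: linfunE; exact: pure_linr. Qed.

Lemma tout_pure a v psi : tout a (pure v psi) = hcrd a v *: psi.
Proof.
rewrite (linfunE (@tout_lin a)) {2}(Lambda_decomp psi) scaler_sumr.
by apply: eq_bigr => J _; rewrite coefL_pure linearZ /= !scalerA mulrC.
Qed.

(** An operator on V as a matrix over End Lambda(n), indexed by the basis of
    V1. *)
Definition block a b f : 'End(L) := (tout a \o f \o tinj b)%VF.

Lemma blockE a b f psi : block a b f psi = tout a (f (pure (hvec b) psi)).
Proof. by rewrite !comp_lfunE tinjE. Qed.

Lemma block_lin a b : linear (block a b).
Proof.
by move=> c f g; apply/lfunP => psi; rewrite add_lfunE scale_lfunE !blockE add_lfunE scale_lfunE linearP.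
Qed.
Lemma blockD a b f g : block a b (f + g) = block a b f + block a b g.
Proof. by have := block_lin a b 1 f g; rewrite !scale1r. Qed.
Lemma block0 a b : block a b 0 = 0.
Proof. by apply: (addrI (block a b 0)); rewrite -blockD !addr0. Qed.
Lemma blockZ a b (c : F) f : block a b (c *: f) = c *: block a b f.
Proof. by have := block_lin a b c f 0; rewrite block0 !addr0. Qed.
Lemma blockB a b f g : block a b (f - g) = block a b f - block a b g.
Proof. by rewrite blockD -scaleN1r blockZ scaleN1r. Qed.
Lemma block_sum a b (I : finType) (P : pred I) (G : I -> 'End(V)) :
  block a b (\sum_(i | P i) G i) = \sum_(i | P i) block a b (G i).
Proof. exact: (big_morph (block a b) (blockD a b) (block0 a b)). Qed.

Lemma block_tens a b (A : 'End(V1)) D : block a b (tens A D) = hcrd a (A (hvec b)) *: D.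
Proof. by apply/lfunP => psi; rewrite blockE tens_pure tout_pure scale_lfunE. Qed.

Definition eunit a b : 'End(V1) := munit a b.

Lemma eunit_vec a b c : eunit a b (hvec c) = (b == c)%:R *: hvec a.
Proof. exact: munit_vec. Qed.
Lemma eunit_comp a b c d : (eunit a b \o eunit c d)%VF = (b == c)%:R *: eunit a d.
Proof. exact: munit_comp. Qed.
Lemma eunit_part a b : (eunit a b : gl V1) \in part (gl V1) (hpar a (+) hpar b).
Proof. exact: munit_part. Qed.
Lemma tau_eunit a b : tau (eunit a b) = (-1) ^+ (hpar a (+) hpar b) *: eunit a b.
Proof. exact: (tau_part (eunit_part a b)). Qed.
Lemma hcrd_eunit a b c d : hcrd a (eunit c d (hvec b)) = ((a == c) && (d == b))%:R.
Proof. by rewrite eunit_vec linearZ /= hcrd_vec /GRing.scale /= -natrM mulnb andbC. Qed.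

Lemma sum_eunit : \sum_a eunit a a = \1%VF.
Proof.
apply: (hbasis_ext (B := B)) => b; rewrite sum_lfunE (bigD1 b) //= big1 => [|a ab].
  by rewrite eunit_vec eqxx scale1r addr0 id_lfunE.
by rewrite eunit_vec (negPf ab) scale0r.
Qed.

Lemma sgn_eunit : sgn V1 = \sum_a (-1) ^+ hpar a *: eunit a a.
Proof.
apply: (hbasis_ext (B := B)) => b; rewrite sum_lfunE (bigD1 b) //= big1 => [|a ab].
  by rewrite scale_lfunE eunit_vec eqxx scale1r addr0 (sgnE (hvec_part b)).
by rewrite scale_lfunE eunit_vec (negPf ab) scale0r scaler0.
Qed.

Lemma sum_pure_tout w : w = \sum_a pure (hvec a) (tout a w).
Proof.
rewrite {1}(tens_decomp w); under [RHS]eq_bigr => a _ do rewrite (linfunE (@tout_lin a)) pure_sumr.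
rewrite exchange_big /=; apply: eq_bigr => K _.
rewrite {1}(hsum B (coefL w K)) pure_suml; apply: eq_bigr => a _.
by rewrite pureZl pureZr.
Qed.

Lemma block_decomp f : f = \sum_a \sum_b tens (eunit a b) (block a b f).
Proof.
apply: tens_ext => v J; rewrite (hsum B v) pure_suml !linear_sum.
apply: eq_bigr => c _ /=; rewrite pureZl !linearZ /=; congr (_ *: _).
rewrite sum_lfunE {1}(sum_pure_tout (f _)).
apply: eq_bigr => a _; rewrite sum_lfunE (bigD1 c) //= big1 => [|b bc].
  by rewrite tens_pure eunit_vec eqxx scale1r addr0 blockE.
by rewrite tens_pure eunit_vec (negPf bc) scale0r -[0](scale0r (0 : V1)) pureZl scale0r.
Qed.

Lemma block_mull a b c d D f : block a b (tens (eunit c d) D \o f)%VF = (a == c)%:R *: (D \o block d b f)%VF.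
Proof.
apply/lfunP => psi; rewrite blockE comp_lfunE scale_lfunE comp_lfunE blockE.
rewrite (tens_decomp (f _)) !linear_sum; apply: eq_bigr => J _ /=.
rewrite tens_pure !tout_pure /eunit munitE !linearZ /= hcrd_vec scalerA.
by rewrite /GRing.scale /= mulrC.
Qed.

Lemma block_mulr a b c d D f : block a b (f \o tens (eunit c d) D)%VF = (d == b)%:R *: (block a c f \o D)%VF.
Proof.
apply/lfunP => psi; rewrite blockE comp_lfunE scale_lfunE comp_lfunE blockE.
by rewrite tens_pure eunit_vec pureZl !linearZ.
Qed.

Lemma block_tau a b f : block a b (tau f) = (-1) ^+ (hpar a (+) hpar b) *: tau (block a b f).
Proof.
rewrite {1}(block_decomp f).
have -> : tau (\sum_a \sum_b tens (eunit a b) (block a b f)) =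
    \sum_a \sum_b tens (tau (eunit a b)) (tau (block a b f)).
  rewrite (big_morph _ (@tauD _ _) (@tau0 _ _)); apply: eq_bigr => c _.
  rewrite (big_morph _ (@tauD _ _) (@tau0 _ _)); apply: eq_bigr => d _.
  by rewrite tau_tens.
rewrite block_sum (bigD1 a) //= [X in _ + X]big1 => [|c ca]; last first.
  rewrite block_sum big1 // => d _.
  by rewrite tau_eunit tensZl blockZ block_tens hcrd_eunit eq_sym (negPf ca) scale0r scaler0.
rewrite addr0 block_sum (bigD1 b) //= [X in _ + X]big1 => [|d db]; last first.
  by rewrite tau_eunit tensZl blockZ block_tens hcrd_eunit (negPf db) andbF scale0r scaler0.
by rewrite addr0 tau_eunit tensZl blockZ block_tens hcrd_eunit !eqxx scale1r.
Qed.

Lemma tens_corner a b f :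
  (tens (eunit a a) \1%VF \o f \o tens (eunit b b) \1%VF)%VF = tens (eunit a b) (block a b f).
Proof.
rewrite [LHS]block_decomp (bigD1 a) //= [X in _ + X]big1 => [|c ca]; last first.
  rewrite big1 // => d _; rewrite -comp_lfunA block_mull (negPf ca) scale0r.
  exact: tens0r.
rewrite addr0 (bigD1 b) //= [X in _ + X]big1 => [|d db]; last first.
  by rewrite block_mulr eq_sym (negPf db) scale0r tens0r.
by rewrite addr0 -comp_lfunA block_mull eqxx scale1r block_mulr eqxx scale1r comp_lfun1r comp_lfun1l.
Qed.

Lemma block_g_off a b f : a != b -> f \in g_algebra V1 n -> is_mult (block a b f).
Proof.
move=> ab /mem_gP[A [D [_ ->]]]; rewrite !blockD block_sum !block_tens id_lfunE hcrd_vec (negPf ab).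
rewrite (sgnE (hvec_part b)) linearZ /= hcrd_vec (negPf ab) scaler0 !scale0r !addr0.
apply: (big_ind (@is_mult F n)); [exact: is_mult0 | exact: is_multD |] => J _.
by rewrite block_tens -muZ; exact: is_mult_mu.
Qed.

Lemma block_g_diag a f : f \in g_algebra V1 n -> normalizes (block a a f).
Proof.
move=> /mem_gP[A [D [vD ->]]]; rewrite !blockD block_sum !block_tens.
apply: normalizesD.
  apply: (big_ind (@normalizes F n)); [exact: normalizes0 | exact: normalizesD |] => J _.
  by rewrite block_tens -muZ; exact/normalizes_mult/is_mult_mu.
apply: normalizesD; apply: normalizesZ; exact: (vect_normalizes (vD _)).
Qed.

(** The multiplications contained in the blocks make up an element of gl(V1)
    (x) Lambda(n). By normalizes_decomp h is a vector field D modulo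
    multiplications, and the action of D on V is block diagonal, with D in the
    even places and tau D in the odd ones. *)
Lemma g_of_blocks f :
  (forall a b, a != b -> is_mult (block a b f)) ->
  (exists h, normalizes h /\ forall a, exists phi, block a a f = itau (hpar a) h + mu phi) ->
  f \in g_algebra V1 n.
Proof.
move=> off [h [Kh dg]]; have [D [v0 v1 eh]] := normalizes_decomp two Kh.
rewrite (block_decomp f); pose r a b := if a == b then itau (hpar a) (D false + D true) else 0.
have K a b : is_mult (block a b f - r a b).
  rewrite /r; case: eqVneq => [<-|ab]; last by rewrite subr0; exact: off.
  have [phi ->] := dg a; rewrite {1}eh.
  have -> : itau (hpar a) (mu (h (unitL F n)) + (D false + D true)) =
     itau (hpar a) (mu (h (unitL F n))) + itau (hpar a) (D false + D true).
    by rewrite /itau; case: (hpar a) => //; rewrite tauD.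
  rewrite addrAC addrK; apply: is_multD; last exact: is_mult_mu.
  by rewrite /itau; case: (hpar a); [exact/is_mult_tau/is_mult_mu | exact: is_mult_mu].
have -> : \sum_a \sum_b tens (eunit a b) (block a b f) =
    \sum_a \sum_b tens (eunit a b) (block a b f - r a b) +
    (tens (signop V1 false) (D false) + tens (signop V1 true) (D true)).
  have -> : tens (signop V1 false) (D false) + tens (signop V1 true) (D true) =
      \sum_a \sum_b tens (eunit a b) (r a b).
    rewrite signop_false -sum_eunit signop_sgn sgn_eunit !tens_suml -big_split.
    apply: eq_bigr => a _ /=; rewrite (bigD1 a) //= big1 => [|b ba].
      rewrite /r eqxx addr0 tensZl -tensZr -tensDr /itau; congr (tens _ _).
      case: (hpar a); last by rewrite scale1r.
      by rewrite tauD (tau_part (vect_part v0)) (tau_part (vect_part v1)) scale1r.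
    by rewrite /r eq_sym (negPf ba) tens0r.
  rewrite -big_split; apply: eq_bigr => a _; rewrite -big_split; apply: eq_bigr => b _ /=.
  by rewrite -tensDr subrK.
apply: memvD; last by apply: memvD; exact: mem_g_vect.
apply: memv_suml => a _; apply: memv_suml => b _.
by rewrite (K a b); exact/(subvP (@gl_tens_g _ _ _))/mem_gl_tens.
Qed.

End Blocks.

(** * Overalgebras when two basis vectors have the same parity *)

Section Corners.
Variables (F : fieldType) (V1 : superspace F) (n : nat) (B : hbasis V1).
Hypothesis two : 2 != 0 :> F.
Notation L := (Lambda F n).
Notation V := (tensL V1 n).
Implicit Types (a b c d : hidx B) (D : 'End(L)) (f : 'End(V)).
Variable W : {vspace gl V}.
Hypothesis LW : Lie_subsuperalgebra W.
Hypothesis W_gl : forall A phi, (tens A (mu phi) : gl V) \in W.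
Hypothesis W_del : forall i, (tens (sgn V1) (del i) : gl V) \in W.
Hypothesis W_xidel : forall i j, i != j -> (tens \1%VF (xiop i \o del j)%VF : gl V) \in W.

Definition corner a b D : Prop := (tens (eunit a b) D : gl V) \in W.

Lemma W_tens1 A : (tens A \1%VF : gl V) \in W.
Proof. by rewrite -(mu_unit F n); exact: W_gl. Qed.

Lemma corner_lin a b (c : F) D D' : corner a b D -> corner a b D' -> corner a b (c *: D + D').
Proof. by move=> MD MD'; rewrite /corner tensDr tensZr memvD // memvZ. Qed.
Lemma corner_mu a b phi : corner a b (mu phi). Proof. exact: W_gl. Qed.
Lemma corner0 a b : corner a b 0. Proof. by rewrite -(mu0 F n); exact: corner_mu. Qed.
Lemma cornerD a b D D' : corner a b D -> corner a b D' -> corner a b (D + D').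
Proof. by move=> ? ?; rewrite -[D]scale1r; exact: corner_lin. Qed.
Lemma cornerZ a b (c : F) D : corner a b D -> corner a b (c *: D).
Proof. by move=> ?; rewrite -[c *: D]addr0; apply: corner_lin => //; exact: corner0. Qed.
Lemma cornerN a b D : corner a b D -> corner a b (- D).
Proof. by move=> ?; rewrite -scaleN1r; exact: cornerZ. Qed.
Lemma cornerB a b D D' : corner a b D -> corner a b D' -> corner a b (D - D').
Proof. by move=> ? ?; apply: cornerD => //; exact: cornerN. Qed.
Lemma cornerZ_inv a b (c : F) D : c != 0 -> corner a b (c *: D) -> corner a b D.
Proof. by move=> c0 /(cornerZ c^-1); rewrite scalerA mulVf // scale1r. Qed.
Lemma corner_sum a b (I : finType) (P : pred I) (G : I -> 'End(L)) :
  (forall i, P i -> corner a b (G i)) -> corner a b (\sum_(i | P i) G i).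
Proof. by move=> MG; apply: big_ind => //; [exact: corner0 | exact: cornerD]. Qed.

Lemma corner_tau a b D : corner a b D -> corner a b (tau D).
Proof.
move=> /(Lie_tau LW); rewrite tau_tens tau_eunit tensZl => /(memvZ ((-1) ^+ (hpar a (+) hpar b))).
by rewrite scalerA -expr2 sqrr_sign scale1r.
Qed.

Lemma tens_eunit_part a b q (D : gl L) : hpar a = hpar b -> D \in part (gl L) q ->
  (tens (eunit a b) D : gl V) \in part (gl V) q.
Proof. by move=> ab Dq; have := tens_part two (eunit_part a b) Dq; rewrite ab addbb. Qed.

(** The idempotents are e_aa (x) 1 and e_bb (x) 1. *)
Lemma corner_block a b f : a != b -> f \in W -> corner a b (block a b f).
Proof.
move=> ab fW; rewrite /corner -tens_corner.
have p0 c : (tens (eunit c c) \1%VF : gl V) \in part (gl V) false.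
  exact: (tens_eunit_part erefl (id_part L)).
apply: (Lie_corner LW two) => //; try exact: W_tens1; rewrite tens_comp eunit_comp ?eqxx ?scale1r ?comp_lfun1l //.
  by rewrite (negPf ab) scale0r tens0l.
by rewrite eq_sym (negPf ab) scale0r tens0l.
Qed.

Lemma itau_tens_eunit q a b D : exists s : F, itau q (tens (eunit a b) D) = s *: tens (eunit a b) (itau q D).
Proof.
case: q => /=; last by exists 1; rewrite scale1r.
by exists ((-1) ^+ (hpar a (+) hpar b)); rewrite tau_tens tau_eunit tensZl.
Qed.

Lemma mu_tens_part a b q phi : phi \in part L q ->
  (tens (eunit a b) (mu phi) : gl V) \in part (gl V) ((hpar a (+) hpar b) (+) q).
Proof. by move=> pq; apply: (tens_part two (eunit_part a b) (mu_part pq)). Qed.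

(** In the superbracket of e_ca (x) phi and e_ab (x) D the second product
    contains e_ab e_ca, which vanishes for c <> b. *)
Lemma corner_mull a b c D phi : c != b -> corner a b D -> corner c b (mu phi \o D)%VF.
Proof.
move=> cb MabD.
have H q psi : psi \in part L q -> corner c b (mu psi \o D)%VF.
  move=> pq; rewrite /corner -(scale1r (eunit c b)) -[1]/(true%:R) -[true](eqxx a) -eunit_comp -tens_comp.
  apply: (Lie_left LW (W_gl _ _) (mu_tens_part c a pq) MabD).
  have [s ->] := itau_tens_eunit (hpar c (+) hpar a (+) q) a b D.
  by rewrite -comp_lfunZl tens_comp eunit_comp eq_sym (negPf cb) scale0r tens0l scaler0.
rewrite -(proj_add false phi) muD comp_lfunDl.
by apply: cornerD; apply: H; exact: proj_in.
Qed.

Lemma corner_mulr a b c D phi : a != c -> corner a b D -> corner a c (D \o mu phi)%VF.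
Proof.
move=> ac MabD.
have H q psi : psi \in part L q -> corner a c (D \o mu psi)%VF.
  move=> pq; rewrite /corner -(scale1r (eunit a c)) -[1]/(true%:R) -[true](eqxx b) -eunit_comp -tens_comp.
  apply: (Lie_right LW (W_gl _ _) (mu_tens_part b c pq) MabD).
  have [s ->] := itau_tens_eunit (hpar b (+) hpar c (+) q) a b D.
  by rewrite -comp_lfunZr tens_comp eunit_comp eq_sym (negPf ac) scale0r tens0l scaler0.
rewrite -(proj_add false phi) muD comp_lfunDr.
by apply: cornerD; apply: H; exact: proj_in.
Qed.

Lemma corner_row a b c D : c != b -> corner a b D -> corner c b D.
Proof. by move=> cb /(corner_mull (unitL F n) cb); rewrite mu_unit comp_lfun1l. Qed.
Lemma corner_col a b c D : a != c -> corner a b D -> corner a c D.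
Proof. by move=> ac /(corner_mulr (unitL F n) ac); rewrite mu_unit comp_lfun1r. Qed.

Lemma corner_odd_ad_xi a b k D : a != b -> corner a b D -> corner a b (odd_ad (xiop k) D).
Proof.
by move=> ab MD'; rewrite odd_ad_def; apply: cornerB; [exact: (corner_mull (xi1 k) ab MD') | exact: (corner_mulr (xi1 k) ab (corner_tau MD'))].
Qed.

Lemma corner_odd_ad_del a b k D : corner a b D -> corner a b (odd_ad (del k) D).
Proof.
move=> MabD.
have od : (tens (sgn V1) (del k) : gl V) \in part (gl V) true.
  exact: (tens_part two (sgn_part V1) (del_part F k)).
have := Lie_odd LW (W_del k) od MabD.
rewrite tau_tens tau_eunit tensZl -comp_lfunZl !tens_comp.
have -> : (sgn V1 \o eunit a b)%VF = (-1) ^+ hpar a *: eunit a b.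
  apply: (hbasis_ext (B := B)) => c; rewrite comp_lfunE scale_lfunE eunit_vec !linearZ /=.
  by rewrite (sgnE (hvec_part a)) !scalerA mulrC.
have -> : (eunit a b \o sgn V1)%VF = (-1) ^+ hpar b *: eunit a b.
  apply: (hbasis_ext (B := B)) => c; rewrite comp_lfunE scale_lfunE (sgnE (hvec_part c)).
  by rewrite linearZ /= eunit_vec; case: eqP => [->|_]; rewrite ?scale0r ?scaler0.
rewrite !tensZl scalerA signr_addb -mulrA -expr2 sqrr_sign mulr1 -scalerBr -tensBr -odd_ad_def.
by move=> /(memvZ ((-1) ^+ hpar a)); rewrite scalerA -expr2 sqrr_sign scale1r.
Qed.

Lemma corner_ad_xi_del a b i j D : i != j -> corner a b D ->
  corner a b (((xiop i \o del j) \o D) - (D \o (xiop i \o del j)))%VF.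
Proof.
move=> ij MabD.
have ev : (tens \1%VF (xiop i \o del j)%VF : gl V) \in part (gl V) false.
  apply: (tens_part two (id_part V1)); exact: (comp_part (xiop_part F i) (del_part F j)).
have := Lie_even LW (W_xidel ij) ev MabD.
by rewrite !tens_comp comp_lfun1l comp_lfun1r -tensBr.
Qed.

Lemma ad_xi_del_del i j m :
  (((xiop i \o del j) \o del m) - (del m \o (xiop i \o del j)))%VF =
  - ((m == i)%:R *: del j) :> 'End(L).
Proof.
apply/lfunP => phi; rewrite !lfun_ev (del_xiop m i) (del_anti j m) !linearN /=.
by rewrite opprB addrA addNr add0r.
Qed.

(** Apply minimal_outside to the corner and to the multiplications. By
    first_order this gives a field sum_m c_m del_m with some c_(i0) nonzero;
    the bracket with xi_(i0) del_j isolates del_j for j <> i0, and del_(i0) is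
    what is left. *)
Lemma corner_del a b D : a != b -> corner a b D -> ~ is_mult D -> forall i, corner a b (del i).
Proof.
move=> ab MabD nK.
have [||||D' [MD' nK' KT]] := @minimal_outside F n two (corner a b) (@is_mult F n) _ _ _ _ D MabD nK.
- by move=> [k|k] x Mx; [exact: corner_odd_ad_xi | exact: corner_odd_ad_del].
- by move=> s x; exact: is_mult_odd_ad.
- by move=> x; exact: is_multN.
- exact: is_mult0.
have [c [eD' _]] := first_order KT.
have Md : corner a b (\sum_i c i *: del i).
  rewrite (_ : \sum_i c i *: del i = D' - mu (D' (unitL F n))); last by rewrite {1}eD' addrC addKr.
  by apply: cornerB => //; exact: corner_mu.
have [i0 ci0] : exists i0, c i0 != 0.
  apply/existsP; apply: contra_notT nK' => /existsPn c0.
  rewrite eD' big1 ?addr0 => [|i _]; first exact: is_mult_mu.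
  by move: (c0 i); rewrite negbK => /eqP ->; rewrite scale0r.
have Mj j : j != i0 -> corner a b (del j).
  move=> ji; have ij : i0 != j by rewrite eq_sym.
  have := corner_ad_xi_del ij Md.
  rewrite (_ : (_ - _)%R = - (c i0 *: del j)) => [/cornerN|].
    by rewrite opprK; exact: cornerZ_inv.
  apply/lfunP => phi; rewrite opp_lfunE scale_lfunE.
  transitivity (\sum_m c m *: ((((xiop i0 \o del j) \o del m) - (del m \o (xiop i0 \o del j)))%VF phi)).
    rewrite add_lfunE opp_lfunE !comp_lfunE !sum_lfunE !linear_sum -big_split /=.
    apply: eq_bigr => m _; rewrite add_lfunE opp_lfunE !scale_lfunE !comp_lfunE.
    by rewrite [del j (_ *: _)]linearZ /= [xiop i0 (_ *: _)]linearZ /= scalerBr.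
  rewrite (bigD1 i0) //= big1 => [|m mi]; rewrite ad_xi_del_del opp_lfunE scale_lfunE.
    by rewrite eqxx scale1r addr0 scalerN.
  by rewrite (negPf mi) scale0r oppr0 scaler0.
move=> i; have [->|] := eqVneq i i0; last exact: Mj.
apply: (cornerZ_inv ci0).
rewrite (_ : c i0 *: del i0 = \sum_i c i *: del i - \sum_(i | i != i0) c i *: del i); last first.
  by rewrite (bigD1 i0) //= addrK.
by apply: cornerB => //; apply: corner_sum => j ji; exact/cornerZ/Mj.
Qed.

Section SameParity.
Variables a b : hidx B.
Hypothesis ab : a != b.
Hypothesis pab : hpar a = hpar b.
Hypothesis Mdel : forall i, corner a b (del i).

(** The bracket of e_ba (x) 1, which is even, with e_ab (x) del_i is the odd
    operator (e_bb - e_aa) (x) del_i. Because of the difference of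
    idempotents, its superbracket with e_ab (x) D adds the two products of
    del_i and D instead of subtracting them. *)
Lemma corner_jordan i D : corner a b D -> corner a b ((del i \o D) + (tau D \o del i))%VF.
Proof.
move=> MabD; have y0 : (tens (eunit b a) \1%VF : gl V) \in part (gl V) false.
  exact: (tens_eunit_part (esym pab) (id_part L)).
have := Lie_even LW (W_tens1 (eunit b a)) y0 (Mdel i).
rewrite !tens_comp !eunit_comp !eqxx !scale1r comp_lfun1l comp_lfun1r => uW.
have ud c : (tens (eunit c c) (del i) : gl V) \in part (gl V) true.
  exact: (tens_eunit_part erefl (del_part F i)).
have u1 := memvB (ud b) (ud a).
have := Lie_odd LW uW u1 MabD.
rewrite tau_tens tau_eunit pab addbb expr0 scale1r comp_lfunDl comp_lfunDr comp_lfunNl comp_lfunNr !tens_comp !eunit_comp.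
rewrite eqxx [b == a]eq_sym (negPf ab) !scale1r !scale0r !tens0l eqxx scale1r subr0 sub0r.
by rewrite -opprD -tensDr memvN.
Qed.

(** For D a product of derivations, del_i D and tau(D) del_i are equal, so the
    product of corner_jordan is 2 del_i D. *)
Lemma corner_dels s : corner a b (dels s).
Proof.
elim: s => [|i s /(corner_jordan i)]; first by rewrite /= -(mu_unit F n); exact: corner_mu.
rewrite tau_dels -comp_lfunZl (_ : (dels s \o del i)%VF = (-1) ^+ size s *: (del i \o dels s)%VF).
  rewrite scalerA -exprD addnn -mul2n exprM sqrrN expr1n expr1n scale1r -mulr2n -scaler_nat.
  exact: cornerZ_inv.
by apply/lfunP => phi; rewrite scale_lfunE !comp_lfunE dels_anti.
Qed.

(** By dels_top the corner contains the matrix unit from the top monomial to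
    1. Multiplications on the right and on the left, which preserve the
    corner, turn it into all the matrix units. *)
Lemma corner_full D : corner a b D.
Proof.
have [c c0 eT] := dels_top F (enum_uniq 'I_n) (mem_enum predT).
have MT : corner a b (Eunit set0 setT) by apply: (cornerZ_inv c0); rewrite -eT; exact: corner_dels.
have ME I J : corner a b (Eunit I J).
  have [d d0 e1] := Eunit_top_mu F I (~: J); apply: (cornerZ_inv d0).
  rewrite setCK in e1; rewrite -e1 -mu_Eunit0.
  exact: (corner_mulr _ ab (corner_mull _ ab MT)).
rewrite (munit_sum (Lbasis F n) D).
by apply: corner_sum => I _; apply: corner_sum => J _; exact/cornerZ/ME.
Qed.

(** Bracketing e_ab (x) D twice with e_ba (x) 1 gives -2 e_ba (x) D. *)
Lemma corner_full_opp D : corner b a D.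
Proof.
have y0 : (tens (eunit b a) \1%VF : gl V) \in part (gl V) false.
  exact: (tens_eunit_part (esym pab) (id_part L)).
have := Lie_even LW (W_tens1 (eunit b a)) y0 (corner_full D).
rewrite !tens_comp !eunit_comp !eqxx !scale1r comp_lfun1l comp_lfun1r => uW.
have := Lie_even LW (W_tens1 (eunit b a)) y0 uW.
rewrite comp_lfunDl comp_lfunDr comp_lfunNl comp_lfunNr !tens_comp !eunit_comp.
rewrite !eqxx [a == b]eq_sym [b == a]eq_sym (negPf ab) !scale1r !scale0r !tens0l.
rewrite comp_lfun1l comp_lfun1r sub0r subr0 -opprD -mulr2n -scaler_nat memvN.
by move=> /(memvZ 2^-1); rewrite scalerA mulVf // scale1r.
Qed.

(** By munit_trans the matrix units of V that lie in W connect the indices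
    transitively. The corners (a, b) and (b, a) connect everything in these
    two rows, and corner_row and corner_col connect every other row with b. *)
Lemma sl_sub_same_parity : (sl V <= W)%VS.
Proof.
pose TB := @tbasis F V1 n B.
pose conn (p q : hidx TB) := p = q \/ (munit p q : gl V) \in W.
have ctrans q p r : conn p q -> conn q r -> conn p r.
  case=> [->|pq] // [<-|qr]; first by right.
  have [->|pr] := eqVneq p r; first by left.
  by right; exact: (munit_trans LW pr pq qr).
have cM c d I J : (forall D, corner c d D) -> conn (c, I) (d, J).
  by move=> Mcd; right; rewrite munit_tens; exact: Mcd.
have Mab := corner_full; have Mba := corner_full_opp.
suff base p : conn p (a, set0) /\ conn (a, set0) p.
  apply: (sl_sub_munit LW (B := TB)) => p q pq.
  by case: (ctrans _ _ _ (base p).1 (base q).2) => [e1|//]; rewrite e1 eqxx in pq.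
case: p => c I; have [->|ca] := eqVneq c a.
  by split; apply: (ctrans (b, set0)); exact: cM.
have [->|cb] := eqVneq c b; first by split; exact: cM.
have Mcb D : corner c b D by exact: (corner_row cb (Mab D)).
have Mbc D : corner b c D by apply: (corner_col (b := a)); [rewrite eq_sym | exact: Mba].
by split; apply: (ctrans (b, set0)); exact: cM.
Qed.

End SameParity.

(** If some off-diagonal block of an element of W is not a multiplication,
    sl_sub_same_parity applies; if all of them are, the diagonal blocks are
    related as g_of_blocks requires. The hypotheses on W only ask for gl(V1)
    (x) Lambda(n), the del_i, and the xi_i del_j with i <> j. For n = 1 they
    hold when W contains sg. *)
Theorem sl_or_g_same_parity (a b : hidx B) : a != b -> hpar a = hpar b ->
  (sl V <= W)%VS \/ (W <= g_algebra V1 n)%VS.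
Proof.
move=> ab pab.
have [[c [d [D [cd McdD nK]]]]|no] :=
  classic (exists c d D, [/\ c != d, corner c d D & ~ is_mult D]).
  (* Moving the corner to the row a, and then to the column b, is possible
     unless d = a; in that case the roles of a and b are exchanged. *)
  left; have Mc := corner_del cd McdD nK.
  have [da|da] := eqVneq d a.
    rewrite da in cd Mc.
    have Mba i : corner b a (del i) by apply: (corner_row (a := c)) => //; rewrite eq_sym.
    by apply: (sl_sub_same_parity (a := b) (b := a)) => //; rewrite eq_sym.
  have Mad i : corner a d (del i) by apply: (corner_row (a := c)) => //; rewrite eq_sym.
  by apply: (sl_sub_same_parity ab pab) => i; apply: (corner_col (b := d)).
right; apply/subvP => f fW.
have off c d g : c != d -> g \in W -> is_mult (block c d g).
  move=> cd gW; apply: NNPP => nK; apply: no; exists c, d, (block c d g).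
  by split=> //; exact: corner_block.
(* The c,d block of the bracket with e_cd (x) phi must be a multiplication;
   it compares the two diagonal blocks c and d. *)
have rel c d q phi : phi \in part L q -> c != d ->
    is_mult ((mu phi \o block d d f) - (itau (hpar c (+) hpar d (+) q) (block c c f) \o mu phi))%VF.
  move=> pq cd; have := Lie_ad LW (W_gl (eunit c d) phi) (mu_tens_part c d pq) fW.
  move=> /(off _ _ _ cd); rewrite blockB block_mull block_mulr !eqxx !scale1r.
  rewrite (_ : block c c (itau _ f) = itau (hpar c (+) hpar d (+) q) (block c c f)) //.
  by rewrite /itau; case: ifP => // _; rewrite block_tau addbb expr0 scale1r.
pose g c d := itau (hpar c (+) hpar d) (block c c f).
have diag c d : c != d -> is_mult (block d d f - g c d).
  move=> cd; have := rel c d false _ (unitL_part F n) cd.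
  by rewrite mu_unit comp_lfun1l comp_lfun1r addbF.
have itauK2 q x : normalizes x -> normalizes (itau q x) by case: q => //; exact: normalizes_tau.
have itauK q x : itau q (itau q x) = x by case: q => //=; rewrite tauK.
(* Combining phi = 1 and phi = xi_k in rel shows that a single diagonal block
   normalizes Lambda(n). *)
have diag2 c d : c != d -> normalizes (block c c f).
  move=> cd; rewrite -(itauK _ _ (hpar c (+) hpar d) (block c c f)); apply: itauK2 => k.
  have := rel c d true _ (xi1_part F k) cd; rewrite addbT.
  rewrite -[block d d f](subrK (g c d)) comp_lfunDr -addrA.
  have KA : is_mult (mu (xi1 k) \o (block d d f - g c d))%VF.
    by apply: is_mult_comp; [exact: is_mult_mu | exact: diag].
  move=> H; have := is_multD H (is_multN KA); rewrite addrAC subrr add0r odd_ad_def.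
  have -> : itau (~~ (hpar c (+) hpar d)) (block c c f) = tau (g c d).
    by rewrite /g /itau; case: (_ (+) _) => //=; rewrite tauK.
  by [].
apply: (g_of_blocks two (B := B)) => [c d cd|]; first exact: off.
exists (itau (hpar a) (block a a f)); split; first exact/itauK2/(diag2 a b).
move=> c; have [->|ca] := eqVneq c a.
  by exists 0; rewrite mu0 addr0 itauK.
have ac : a != c by rewrite eq_sym.
exists ((block c c f - g a c) (unitL F n)); rewrite -(diag _ _ ac).
have -> : itau (hpar c) (itau (hpar a) (block a a f)) = g a c.
  by rewrite /g /itau; case: (hpar a); case: (hpar c) => //=; rewrite tauK.
by rewrite addrC subrK.
Qed.

End Corners.

(** * Overalgebras when V1 has dimension one *)

Section SecondOrderOperators.
Variables (F : fieldType) (n : nat).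
Hypothesis two : 2 != 0 :> F.
Notation L := (Lambda F n).
Notation xi := (xi F).
Implicit Types (D x y u : 'End(L)).
Variable M : 'End(L) -> Prop.
Hypothesis M_lin : forall (c : F) x y, M x -> M y -> M (c *: x + y).
Hypothesis M_ad : forall a (u : gl L) x, u \in part (gl L) a -> M u -> M x ->
  M ((u \o x)%VF - (itau a x \o u)%VF).
Hypothesis M_normalizes : forall x, normalizes x -> M x.

Lemma closed0 : M 0. Proof. exact/M_normalizes/normalizes0. Qed.
Lemma closedZ (c : F) x : M x -> M (c *: x).
Proof. by move=> Mx; rewrite -[_ *: _]addr0; apply: M_lin => //; exact: closed0. Qed.
Lemma closedN x : M x -> M (- x).
Proof. by move=> Mx; rewrite -scaleN1r; exact: closedZ. Qed.
Lemma closedD x y : M x -> M y -> M (x + y).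
Proof. by move=> Mx My; rewrite -[x]scale1r; exact: M_lin. Qed.
Lemma closedB x y : M x -> M y -> M (x - y).
Proof. by move=> Mx My; apply: closedD => //; exact: closedN. Qed.
Lemma closedZ_inv (c : F) x : c != 0 -> M (c *: x) -> M x.
Proof. by move=> c0 /(closedZ c^-1); rewrite scalerA mulVf // scale1r. Qed.

Lemma closed_sign k x : M ((-1) ^+ k *: x) -> M x.
Proof. by apply: closedZ_inv; rewrite signr_eq0. Qed.

Lemma closed_gen s : M (clifford_gen s).
Proof. by apply: M_normalizes; case: s => i; [exact/normalizes_mult/is_mult_mu | exact: normalizes_del]. Qed.

Lemma clifford_gen_part (s : 'I_n + 'I_n) : (clifford_gen s : gl L) \in part (gl L) true.
Proof. by case: s => i; [exact: xiop_part | exact: del_part]. Qed.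

Lemma closed_odd_ad s x : M x -> M (odd_ad (clifford_gen s) x).
Proof. by move=> Mx; rewrite odd_ad_def; exact: (M_ad (clifford_gen_part s) (closed_gen s) Mx). Qed.

Lemma xidel_part i : ((xiop i \o del i)%VF : gl L) \in part (gl L) false.
Proof. exact: (comp_part (xiop_part F i) (del_part F i)). Qed.

Lemma closed_ad_xidel i x : M x -> M (((xiop i \o del i) \o x) - (x \o (xiop i \o del i)))%VF.
Proof.
by move=> Mx; exact: (M_ad (xidel_part i) (M_normalizes (normalizes_mull _ (@normalizes_del F n i))) Mx).
Qed.

Lemma unitL_neq0 : unitL F n != 0.
Proof.
apply/eqP => z; have := Lcoord_xi F (set0 : {set 'I_n}) set0.
by rewrite -/(unitL F n) z linear0 eqxx => /esym/eqP; rewrite oner_eq0.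
Qed.

(** Let D in M be outside the normalizer, with all its brackets with the xi_i
    and del_i in it (minimal_outside). Some bracket B' of D with xi_k is not a
    multiplication, and first_order gives B' = phi + sum_i c_i del_i, where
    c_k = 0 because bracketing twice with xi_k gives 0. The bracket of D with
    xi_k del_k is xi_k C - tau(B') del_k, where C, the bracket of D with
    del_k, normalizes Lambda(n); so sum_i c_i del_i del_k is in M, and the
    bracket with xi_j del_j isolates one term. *)
Lemma closed_del_del x : M x -> ~ normalizes x -> exists j k, j != k /\ M (del j \o del k)%VF.
Proof.
move=> Mx nK.
have [||||D [MD nKD KT]] := @minimal_outside F n two M (@normalizes F n) _ _ _ _ x Mx nK.
- by move=> s y; exact: closed_odd_ad.
- by move=> s y; exact: normalizes_odd_ad.
- by move=> y; exact: normalizesN.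
- exact: normalizes0.
have [k nKk] : exists k, ~ is_mult (odd_ad (xiop k) D) by apply: not_all_ex_not.
pose B' := odd_ad (xiop k) D; have KB s : is_mult (odd_ad (clifford_gen s) B').
  case: s => i; first exact: (KT (inl k)).
  rewrite /B' (odd_ad_del_xi i k) -(odd_adN (xiop k)); rewrite odd_adN; apply/is_multN.
  exact: (KT (inr i)).
have [c [eB TB']] := first_order KB.
have ck : c k = 0.
  have := TB' k; rewrite /B' (odd_ad_gen_sq two (inl k)) => /lfunP/(_ (unitL F n)).
  rewrite zero_lfunE scale_lfunE id_lfunE => /esym/eqP.
  by rewrite scaler_eq0 (negPf unitL_neq0) orbF => /eqP.
have [j cj] : exists j, c j != 0.
  apply/existsP; apply: contra_notT nKk => /existsPn c0.
  rewrite -/B' eB big1 ?addr0 => [|i _]; first exact: is_mult_mu.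
  by move: (c0 i); rewrite negbK => /eqP ->; rewrite scale0r.
have jk : j != k by apply: contra_neq cj => ->.
exists j, k; split=> //.
have DX phi : D (xiop k phi) = xiop k (tau D phi) + tau B' phi.
  by rewrite /B' (tau_odd_ad D (tau_xiop F k)) opp_lfunE odd_adE tauK opprB addrC subrK.
pose C := odd_ad (del k) D; have dD phi : del k (D phi) = tau D (del k phi) + C phi.
  by rewrite /C odd_adE addrC subrK.
have MBd : M (tau B' \o del k)%VF.
  have := closed_ad_xidel k MD.
  have -> : (((xiop k \o del k) \o D) - (D \o (xiop k \o del k)))%VF =
      (xiop k \o C)%VF - (tau B' \o del k)%VF.
    by apply/lfunP => phi; rewrite !lfun_ev DX dD linearD /= opprD addrACA subrr add0r.
  have MXC : M (xiop k \o C)%VF by apply/M_normalizes/normalizes_mull; exact: (KT (inr k)).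
  by move=> /(closedB MXC); rewrite opprB addrCA subrr addr0.
pose Y := (\sum_i c i *: (del i \o del k)%VF).
have MY : M Y.
  have MK : M (mu (sgn L (B' (unitL F n))) \o del k)%VF by apply/M_normalizes/normalizes_mull/normalizes_del.
  rewrite (_ : Y = (mu (sgn L (B' (unitL F n))) \o del k)%VF - (tau B' \o del k)%VF); first exact: closedB.
  have -> : tau B' = mu (sgn L (B' (unitL F n))) - \sum_i c i *: del i.
    rewrite {1}eB tauD tau_mu -sumrN; congr (_ + _).
    rewrite (big_morph _ (@tauD _ _) (@tau0 _ _)); apply: eq_bigr => i _.
    by rewrite tauZ tau_del scalerN.
  apply/lfunP => phi; rewrite !lfun_ev opprB addrC subrK !sum_lfunE.
  by apply: eq_bigr => i _; rewrite !lfun_ev.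
have := closed_ad_xidel j MY.
have -> : (((xiop j \o del j) \o Y) - (Y \o (xiop j \o del j)))%VF = - (c j *: (del j \o del k)%VF).
  apply/lfunP => phi; rewrite !lfun_ev /Y !sum_lfunE !linear_sum -big_split /=.
  rewrite (bigD1 j) //= big1 => [|i ij]; rewrite !lfun_ev [del k (xiop j _)]del_xiop eq_sym (negPf jk) scale0r sub0r.
    rewrite [del j (_ *: _)]linearZ /= del_sq // scaler0 linear0 add0r addr0.
    rewrite [del j (- _)]linearN /= del_xiop eqxx scale1r [del k (del j phi)]del_anti linearN /=.
    by rewrite [del j (- _)]linearN /= del_sq // oppr0 [xiop j 0]linear0 subr0 scalerN opprK.
  rewrite [del j (_ *: _)]linearZ /= [xiop j (_ *: _)]linearZ /= -scalerBr.
  rewrite [del i (- _)]linearN /= del_xiop (negPf ij) scale0r sub0r opprK.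
  rewrite [del k (del j phi)]del_anti [del i (- _)]linearN /= [del i (del j _)]del_anti opprK.
  by rewrite subrr scaler0.
by move=> /closedN; rewrite opprK; exact: closedZ_inv.
Qed.

Section FromSecondOrder.
Variables p q : 'I_n.
Hypothesis pq : p != q.
Hypothesis Mpq : M (del p \o del q)%VF.

(** The bracket of del_p del_q with the field xi_p xi_q del_p is xi_q del_q
    del_p - del_p, and the bracket with xi_p del_m replaces p by m. *)
Lemma closed_xidel_del m : m != q -> M ((xiop q \o del q) \o del m)%VF.
Proof.
have K3 i j k : normalizes (xiop i \o (xiop j \o del k) : 'End(L))%VF.
  by apply/normalizes_mull/normalizes_mull/normalizes_del.
have Mqp : M ((xiop q \o del q) \o del p)%VF.
  have ev : ((del p \o del q)%VF : gl L) \in part (gl L) false.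
    exact: (comp_part (del_part F p) (del_part F q)).
  have := M_ad ev Mpq (M_normalizes (K3 p q p)).
  have -> : (((del p \o del q) \o (xiop p \o (xiop q \o del p)))
       - (itau false (xiop p \o (xiop q \o del p)) \o (del p \o del q)))%VF =
       ((xiop q \o del q) \o del p)%VF - del p :> 'End(L).
    apply/lfunP => phi; rewrite /itau !lfun_ev.
    have z : del p (del p (del q phi)) = 0 by rewrite del_sq.
    rewrite z !linear0 ?oppr0 addr0.
    move: (del_sq two p phi); move: (del p phi) => w dw.
    rewrite [del q (xiop p _)]del_xiop eq_sym (negPf pq) scale0r sub0r.
    rewrite [del q (xiop q _)]del_xiop eqxx scale1r linearN /= del_xiop eqxx scale1r.
    rewrite [del p (_ - _)]linearB /= dw [del p (xiop q _)]del_xiop (negPf pq) scale0r !sub0r.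
    by rewrite [del p (del q _)]del_anti dw [del q 0]linear0 oppr0 [xiop q 0]linear0 !oppr0 [xiop p 0]linear0 subr0 opprB.
  move=> Mm; have := closedD Mm (closed_gen (inr p)).
  by rewrite subrK.
move=> mq; have [->//|mp] := eqVneq m p.
have ev : ((xiop p \o del m)%VF : gl L) \in part (gl L) false.
  exact: (comp_part (xiop_part F p) (del_part F m)).
have := M_ad ev (M_normalizes (normalizes_mull _ (@normalizes_del F n m))) Mqp.
have -> : (((xiop p \o del m) \o ((xiop q \o del q) \o del p))
     - (itau false ((xiop q \o del q) \o del p) \o (xiop p \o del m)))%VF =
    - ((xiop q \o del q) \o del m)%VF :> 'End(L).
  apply/lfunP => phi; rewrite /itau !lfun_ev.
  rewrite [del m (xiop q _)]del_xiop (negPf mq) scale0r sub0r.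
  rewrite [del p (xiop p _)]del_xiop eqxx scale1r [del q (_ - _)]linearB /=.
  rewrite [del q (xiop p _)]del_xiop eq_sym (negPf pq) scale0r sub0r opprK.
  rewrite [xiop p (- _)]linearN [xiop q (_ + _)]linearD /= opprD.
  have -> : del m (del q (del p phi)) = del q (del p (del m phi)).
    by rewrite del_anti [del m (del p _)]del_anti linearN opprK.
  by rewrite [xiop q (xiop p _)]xiop_anti opprK addrCA addNr addr0.
by move=> /closedN; rewrite opprK.
Qed.

Lemma dels_del_del0 s (phi : L) : del q (dels s (del q phi)) = 0.
Proof. by rewrite dels_anti [del q (_ *: _)]linearZ /= del_sq // scaler0. Qed.

(** In the bracket of xi_q del_q del_m with del_s del_q one of the products is
    0 because del_q occurs twice; in the other one del_q xi_q del_q = del_q,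
    so that del_m is added to the product. *)
Lemma closed_dels s : q \notin s -> M (dels s \o del q)%VF.
Proof.
elim: s => [_|m s IH]; first by rewrite comp_lfun1l; exact: (closed_gen (inr q)).
rewrite inE negb_or eq_sym => /andP[mq /IH Ms].
have od : (((xiop q \o del q) \o del m)%VF : gl L) \in part (gl L) true.
  exact: (comp_part (xidel_part q) (del_part F m)).
have := M_ad od (closed_xidel_del mq) Ms.
set u := ((xiop q \o del q) \o del m)%VF; set w := (dels s \o del q)%VF.
have -> : (u \o w)%VF = 0.
  apply/lfunP => phi; rewrite !lfun_ev [del q (del m _)]del_anti.
  by rewrite dels_del_del0 linear0 oppr0 linear0.
have -> : itau true w = (-1) ^+ (size s).+1 *: w.
  by rewrite /= /w tau_comp tau_dels tau_del comp_lfunNr -comp_lfunZl exprS mulN1r scaleNr.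
rewrite sub0r -comp_lfunZl => /closedN; rewrite opprK => /closed_sign.
have -> : (w \o u)%VF = - ((-1) ^+ size s *: (dels (m :: s) \o del q)%VF).
  apply/lfunP => phi; rewrite !lfun_ev [del q (xiop q _)]del_xiop eqxx scale1r del_sq // linear0 subr0.
  by rewrite [del q (del m _)]del_anti linearN /= dels_anti.
by move=> /closedN; rewrite opprK => /closed_sign.
Qed.

Lemma closed_Etop : M (Eunit set0 setT).
Proof.
pose s := rem q (enum 'I_n).
have us : uniq s by rewrite rem_uniq // enum_uniq.
have qs : q \notin s by rewrite mem_rem_uniq ?enum_uniq // !inE eqxx.
have [|i|c c0 e] := @dels_top F n (q :: s).
- by rewrite /= qs us.
- by rewrite inE mem_rem_uniq ?enum_uniq // !inE mem_enum andbT orbN.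
have := closed_dels qs.
have -> : (dels s \o del q)%VF = (-1) ^+ size s *: dels (q :: s) :> 'End(L).
  by apply/lfunP => phi; rewrite !lfun_ev dels_anti.
by move=> /closed_sign; rewrite e; exact: closedZ_inv.
Qed.

Lemma mu_xi_part I : (mu (xi I) : gl L) \in part (gl L) (odd #|I|).
Proof. exact/mu_part/xi_part. Qed.

Lemma Eunit_part I J : (Eunit I J : gl L) \in part (gl L) (odd #|I| (+) odd #|J|).
Proof. exact: (munit_part (B := Lbasis F n)). Qed.

Lemma itau_Eunit a I J : exists2 s : F, s != 0 & itau a (Eunit I J) = s *: Eunit I J :> 'End(L).
Proof.
case: a => /=; last by exists 1; rewrite ?oner_neq0 ?scale1r.
by rewrite (tau_part (Eunit_part I J)); exists ((-1) ^+ (odd #|I| (+) odd #|J|)); rewrite ?signr_eq0.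
Qed.

(** Bracket the matrix unit from the top monomial to 1 with the field xi_K
    xi_j del_j, where K is the complement of J and j is in J. The field
    vanishes at 1, so only one product survives, and xi_j del_j fixes xi_J. *)
Lemma closed_E0 J : J != set0 -> M (Eunit set0 J).
Proof.
case/set0Pn => j jJ.
have [c c0 e1] := Eunit_top_mu F set0 (~: J).
have pu : ((mu (xi (~: J)) \o (xiop j \o del j))%VF : gl L) \in part (gl L) (odd #|~: J|).
  by have := comp_part (mu_xi_part (~: J)) (xidel_part j); rewrite addbF.
have := M_ad pu (M_normalizes (normalizes_mull _ (normalizes_mull _ (@normalizes_del F n j)))) closed_Etop.
have -> : ((mu (xi (~: J)) \o (xiop j \o del j)) \o Eunit set0 setT)%VF = 0.
  apply: Lambda_ext => K; rewrite !lfun_ev Eunit_xi [del j _]linearZ /= del_unit.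
  by rewrite !(scaler0, linear0).
have [s s0 ->] := itau_Eunit (odd #|~: J|) set0 setT.
rewrite sub0r -comp_lfunZl [(Eunit set0 setT \o _)%VF]comp_lfunA e1 setCK => /closedN; rewrite opprK => /(closedZ_inv s0).
rewrite -comp_lfunZl => /(closedZ_inv c0).
have -> // : (Eunit set0 J \o (xiop j \o del j))%VF = Eunit set0 J :> 'End(L).
apply: Lambda_ext => K; rewrite !lfun_ev del_xi.
case: ifPn => jK; last first.
  rewrite !linear0 Eunit_xi (_ : J == K = false) ?scale0r //.
  by apply: contraNF jK => /eqP <-.
by rewrite !linearZ /= xiop_xi !inE eqxx /= setD1K // !linearZ /= scalerA -expr2 sqrr_sign scale1r.
Qed.

(** The bracket of E_(0,T), with T the full set, and of the multiplication by
    xi_I is E_(I,T) up to a multiple of E_(0,K), with K the complement of I. *)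
Lemma closed_ET I : I != setT -> M (Eunit I setT).
Proof.
move=> IT; have [->|I0] := eqVneq I set0; first exact: closed_Etop.
have := M_ad (mu_xi_part I) (M_normalizes (normalizes_mult (is_mult_mu _))) closed_Etop.
have [s s0 ->] := itau_Eunit (odd #|I|) set0 setT.
have [c c0 e1] := Eunit_top_mu F set0 I.
rewrite mu_Eunit0 -comp_lfunZl e1 => H.
have MC : M (Eunit set0 (~: I)).
  by apply: closed_E0; apply: contra_neq IT => e; rewrite -(setCK I) e setC0.
by have := closedD H (closedZ s (closedZ c MC)); rewrite subrK.
Qed.

Lemma closed_Etrans I J K : I != K -> M (Eunit I J) -> M (Eunit J K) -> M (Eunit I K).
Proof.
move=> IK MIJ MJK; have := M_ad (Eunit_part I J) MIJ MJK.
have [s s0 ->] := itau_Eunit (odd #|I| (+) odd #|J|) J K.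
rewrite -comp_lfunZl !munit_comp eqxx scale1r eq_sym (negPf IK) scale0r scaler0 subr0.
by [].
Qed.

(** The path from I to J passes through the full set and the empty set; the
    middle step is the multiplication by the top monomial. *)
Lemma closed_Eunit I J : I != J -> M (Eunit I J).
Proof.
have MT0 : M (Eunit setT set0) by rewrite -mu_top; exact/M_normalizes/normalizes_mult/is_mult_mu.
pose conn I J := I = J \/ M (Eunit I J).
have ctrans J' I' K' : conn I' J' -> conn J' K' -> conn I' K'.
  case=> [->|IJ] // [<-|JK]; first by right.
  have [->|IK] := eqVneq I' K'; first by left.
  by right; exact: (closed_Etrans IK IJ JK).
have c1 : conn I setT by have [->|/closed_ET] := eqVneq I setT; [left | right].
have c2 : conn set0 J by have [->|/closed_E0] := eqVneq J set0; [left | right].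
have c3 : conn setT set0 by right.
by case: (ctrans _ _ _ (ctrans _ _ _ c1 c3) c2) => // -> /eqP.
Qed.

End FromSecondOrder.

Lemma normalizes_or_all_units : (forall x, M x -> normalizes x) \/ (forall I J, I != J -> M (Eunit I J)).
Proof.
have [h|h] := classic (forall x, M x -> normalizes x); first by left.
have [x nx] := not_all_ex_not _ _ h; have [Mx nK] := imply_to_and _ _ nx.
by right=> I J; have [j [k [jk Mjk]]] := closed_del_del Mx nK; exact: (closed_Eunit jk Mjk).
Qed.

End SecondOrderOperators.

Section Line.
Variables (F : fieldType) (V1 : superspace F) (n : nat) (B : hbasis V1).
Hypothesis two : 2 != 0 :> F.
Notation L := (Lambda F n).
Notation V := (tensL V1 n).
Variable W : {vspace gl V}.
Hypothesis LW : Lie_subsuperalgebra W.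
Hypothesis gW : (g_algebra V1 n <= W)%VS.
Variable o : hidx B.
Hypothesis single : forall a : hidx B, a = o.

Let M (x : 'End(L)) : Prop := (tens \1%VF x : gl V) \in W.

Fact sgn_single : sgn V1 = (-1) ^+ hpar o *: \1%VF.
Proof.
rewrite (sgn_eunit B) (bigD1 o) //= big1 ?addr0 => [|a ao]; last by rewrite (single a) eqxx in ao.
by rewrite -(sum_eunit B) (bigD1 o) //= big1 ?addr0 // => a ao; rewrite (single a) eqxx in ao.
Qed.

Fact eunit_single : eunit o o = \1%VF.
Proof.
by rewrite -(sum_eunit B) (bigD1 o) //= big1 ?addr0 // => a ao; rewrite (single a) eqxx in ao.
Qed.

Lemma tens_single (f : 'End(V)) : f = tens \1%VF (block o o f).
Proof.
rewrite {1}(block_decomp B f) (bigD1 o) //= [X in _ + X]big1 => [|a ao]; last by rewrite (single a) eqxx in ao.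
rewrite addr0 (bigD1 o) //= big1 => [|a ao]; last by rewrite (single a) eqxx in ao.
by rewrite addr0 eunit_single.
Qed.

(** Here every operator on V has the form 1 (x) x, and W is a subspace of End
    Lambda(n) that contains the normalizer of Lambda(n). *)
Theorem sl_or_g_line : (sl V <= W)%VS \/ (W <= g_algebra V1 n)%VS.
Proof.
have Mlin (c : F) x y : M x -> M y -> M (c *: x + y).
  by move=> Mx My; rewrite /M tensDr tensZr memvD // memvZ.
have tau1 : tau (\1%VF : 'End(V1)) = \1%VF by rewrite (tau_part (id_part V1)) scale1r.
have Mad a (u : gl L) x : u \in part (gl L) a -> M u -> M x ->
    M ((u \o x)%VF - (itau a x \o u)%VF).
  move=> ua Mu Mx; have := Lie_ad LW Mu (tens_part two (id_part V1) ua) Mx.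
  have -> : itau (false (+) a) (tens \1%VF x : 'End(V)) = tens \1%VF (itau a x).
    by case: (a) => //=; rewrite tau_tens tau1.
  by rewrite !tens_comp comp_lfun1l -tensBr.
have MK2 x : normalizes x -> M x.
  move=> /(normalizes_decomp two)[D [v0 v1 ->]]; rewrite /M !tensDr.
  apply: memvD; first exact/(subvP gW)/(subvP (@gl_tens_g _ _ _))/mem_gl_tens.
  apply: memvD.
    by have := subvP gW _ (mem_g_vect V1 v0); rewrite signop_false.
  have := subvP gW _ (mem_g_vect V1 v1); rewrite signop_sgn sgn_single tensZl.
  by move=> /(memvZ ((-1) ^+ hpar o)); rewrite scalerA -expr2 sqrr_sign scale1r.
have MW f : f \in W -> M (block o o f) by move=> fW; rewrite /M -tens_single.
case: (normalizes_or_all_units two Mlin Mad MK2) => [MK|ME]; [right | left].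
  apply/subvP => f /MW/MK Kf; apply: (g_of_blocks two (B := B)) => [a b|].
    by rewrite (single a) (single b) eqxx.
  exists (itau (hpar o) (block o o f)); split.
    by rewrite /itau; case: ifP => // _; exact: normalizes_tau.
  move=> a; rewrite (single a); exists 0; rewrite mu0 addr0 /itau.
  by case: (hpar o); rewrite ?tauK.
apply: (sl_sub_munit LW (B := @tbasis F V1 n B)) => -[a I] [b J].
rewrite (single a) (single b) xpair_eqE eqxx /= => IJ.
by rewrite munit_tens [munit o o]eunit_single; exact: ME.
Qed.

End Line.

(** * Operators outside g *)

Section TopUnit.
Variables (F : fieldType) (n : nat).
Notation L := (Lambda F n).
Notation Etop := (@Eunit F n set0 [set: 'I_n]).

Lemma setT_neq0 (k : 'I_n) : [set: 'I_n] != set0.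
Proof. by apply/set0Pn; exists k; rewrite inE. Qed.

Lemma not_is_mult (k : 'I_n) (x : 'End(L)) : x != 0 -> x (unitL F n) = 0 -> ~ is_mult x.
Proof. by move=> /eqP x0 x1; rewrite /is_mult x1 mu0. Qed.

Lemma Etop_neq0 : Etop != 0.
Proof.
apply/eqP => /lfunP/(_ (xi F setT)); rewrite Eunit_xi eqxx scale1r zero_lfunE => /eqP.
by rewrite (negPf (unitL_neq0 F n)).
Qed.

Lemma Etop_not_mult (k : 'I_n) : ~ is_mult Etop.
Proof.
apply: (not_is_mult k Etop_neq0).
by rewrite Eunit_xi (negPf (setT_neq0 k)) scale0r.
Qed.

(** The bracket with xi_k is a multiplication whose value at 1 is, up to sign,
    the image of xi_k, and this is 0 when there are at least two variables. So
    the operator would be a multiplication; it vanishes at 1 without being 0. *)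
Lemma Etop_not_normalizes (i j : 'I_n) : i != j -> ~ normalizes Etop.
Proof.
move=> ij KE; apply: (Etop_not_mult i); apply/is_multP => k; rewrite (KE k) odd_adE.
rewrite Eunit_xi (negPf (setT_neq0 k)) scale0r linear0 sub0r mu_unitr.
have Tk : [set: 'I_n] == [set k] = false.
  apply/negP => /eqP T1; have : (i \in [set k]) && (j \in [set k]) by rewrite -T1 !inE.
  by rewrite !inE => /andP[/eqP ik /eqP jk]; rewrite ik jk eqxx in ij.
have -> : tau Etop = (-1) ^+ (odd #|set0 : {set 'I_n}| (+) odd #|[set: 'I_n]|) *: Etop.
  exact: (tau_part (Eunit_part F set0 setT)).
by rewrite scale_lfunE Eunit_xi Tk scale0r scaler0 oppr0 mu0.
Qed.

Lemma supertrace_Etop (k : 'I_n) : supertrace (Etop : gl L) = 0.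
Proof. by rewrite supertrace_munit eq_sym (negPf (setT_neq0 k)) mul0r. Qed.

Lemma del_neq0 (k : 'I_n) : del k != 0 :> 'End(L).
Proof.
apply/eqP => /lfunP/(_ (xi1 k)); rewrite del_xi set11 setDv inversions0r expr0 scale1r zero_lfunE.
by move/eqP; rewrite (negPf (unitL_neq0 F n)).
Qed.

Lemma del_not_mult (k : 'I_n) : ~ is_mult (del k : 'End(L)).
Proof. exact: (not_is_mult k (del_neq0 k) (del_unit F k)). Qed.

End TopUnit.

(** * Superdimension 1 + epsilon *)

Section OddPair.
Variables (F : fieldType) (V1 : superspace F) (n : nat) (B : hbasis V1).
Hypothesis two : 2 != 0 :> F.
Notation L := (Lambda F n).
Notation V := (tensL V1 n).

Lemma tens_str0_sl A (D : gl L) : supertrace (A : gl V1) = 0 -> (tens A D : gl V) \in sl V.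
Proof. by move=> A0; rewrite mem_sl (supertrace_tens B) A0 mul0r. Qed.

Variables i0 i1 : hidx B.
Hypotheses (p0 : hpar i0 = false) (p1 : hpar i1 = true).
Hypothesis idx : forall i : hidx B, i = if hpar i then i1 else i0.

(** With eta = e_(i1,i0), the intersection of sl(V) and g_ext eta contains eta
    (x) del_k, which is not in g; it does not contain e_(i0,i1) (x) del_k,
    which is in sl(V). *)
Lemma not_maximal_odd_pair (k : 'I_n) :
  ~ maximal_Lie_subsuperalgebra V (g_algebra V1 n) (sl V).
Proof.
case=> [_ gs gnsl max].
have i01 : i0 != i1 by apply: contra_eqN p1 => /eqP <-; rewrite p0.
have i10 : i1 != i0 by rewrite eq_sym.
pose eta : 'End(V1) := eunit i1 i0.
have eta_odd : (eta : gl V1) \in part (gl V1) true by have := eunit_part i1 i0; rewrite p0 p1.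
have eta2 : (eta \o eta)%VF = 0 by rewrite eunit_comp (negPf i01) scale0r.
have v2 v : v = hcrd i0 v *: hvec i0 + hcrd i1 v *: hvec i1.
  rewrite {1}(hsum B v) (bigD1 i0) //= (bigD1 i1) //= big1 ?addr0 // => i /andP[n0 n1'].
  by move: n0 n1'; rewrite (idx i); case: ifP; rewrite eqxx.
have eta_ad a (A : gl V1) : A \in part (gl V1) a ->
    exists p q, ((A : 'End(V1)) \o eta)%VF - (-1) ^+ a *: (eta \o A)%VF = p *: eta + q *: \1%VF.
  move=> Aa; have h i j := @hcrd_hom F V1 B a A i j Aa.
  (* An odd A has only off-diagonal entries, and its superbracket with eta is
     a scalar; an even A is diagonal, and its bracket with eta is a multiple
     of eta. *)
  case: a Aa h => Aa h.
    have z0 : hcrd i0 (A (hvec i0)) = 0 by apply: h; rewrite addbb.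
    have z1 : hcrd i1 (A (hvec i1)) = 0 by apply: h; rewrite addbb.
    exists 0, (hcrd i0 (A (hvec i1))); apply: (hbasis_ext (B := B)) => i.
    rewrite expr1 scaleN1r opprK scale0r add0r add_lfunE scale_lfunE id_lfunE !comp_lfunE.
    rewrite (v2 (A (hvec i))) linearD !linearZ /= !eunit_vec (idx i); case: (hpar i).
      rewrite (negPf i01) eqxx scale0r linear0 add0r z1 scale0r addr0 scale1r.
      by [].
    rewrite eqxx (negPf i01) scale1r scale0r scaler0 addr0 z0 scale0r addr0.
    by rewrite {1}(v2 (A (hvec i1))) z1 scale0r addr0.
  have z0 : hcrd i0 (A (hvec i1)) = 0 by apply: h; rewrite p0 p1.
  have z1 : hcrd i1 (A (hvec i0)) = 0 by apply: h; rewrite p0 p1.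
  exists (hcrd i1 (A (hvec i1)) - hcrd i0 (A (hvec i0))), 0; apply: (hbasis_ext (B := B)) => i.
  rewrite expr0 scale1r scale0r addr0 scale_lfunE add_lfunE opp_lfunE !comp_lfunE.
  rewrite (v2 (A (hvec i))) linearD !linearZ /= !eunit_vec (idx i); case: (hpar i).
    by rewrite (negPf i01) scale0r linear0 z0 scale0r !scaler0 addr0 subrr.
  rewrite eqxx (negPf i01) scale1r scale0r scaler0 addr0 {1}(v2 (A (hvec i1))) z0.
  by rewrite scale0r add0r scalerBl.
pose U := (g_ext n eta :&: sl V)%VS.
have LU : Lie_subsuperalgebra U.
  by apply: Lie_cap; [exact: g_ext_Lie | exact: (sl_Lie (tbasis n B))].
have gU : (g_algebra V1 n <= U)%VS by rewrite subv_cap gs andbT; exact: g_sub_ext.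
have str_e a b : a != b -> supertrace (eunit a b : gl V1) = 0.
  by move=> ab; rewrite supertrace_munit (negPf ab) mul0r.
have block_del a b : a != b -> is_mult (block a b (tens (eunit a b) (del k) : gl V)) -> False.
  by move=> ab; rewrite block_tens hcrd_eunit !eqxx scale1r; exact: del_not_mult.
case: (max U LU gU (capvSr _ _)) => eU.
  have : (tens eta (del k) : gl V) \in U.
    rewrite memv_cap; apply/andP; split; last exact/tens_str0_sl/str_e.
    have := mem_ext_vect eta (del_vect F k).
    rewrite (_ : (eta \o signop V1 true)%VF = eta) //.
    apply: (hbasis_ext (B := B)) => i; rewrite comp_lfunE (signopE _ (hvec_part i)) linearZ /= eunit_vec.
    by rewrite (idx i); case: (hpar i); rewrite ?(negPf i01) ?scale0r ?scaler0 // p0 scale1r.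
  by rewrite eU => /(block_g_off i10); exact: block_del.
have : (tens (eunit i0 i1) (del k) : gl V) \in U.
  by rewrite eU; exact/tens_str0_sl/str_e.
move=> /memv_capP[/memv_addP[x xg [y /memv_sumP[z zP ->] e1]] _].
apply: (block_del B _ _ i01); rewrite e1 blockD; apply: is_multD; first exact: block_g_off.
rewrite block_sum; apply: (big_ind (@is_mult F n)); [exact: is_mult0 | exact: is_multD |] => a _.
have /memv_imgP[D _ ->] := zP a isT; rewrite (linfunE (etav_lin eta a)) block_tens comp_lfunE.
rewrite /eta /eunit munitE linearZ /= hcrd_vec (negPf i01) scaler0 scale0r; exact: is_mult0.
Qed.

End OddPair.

(** * Maximality in sl(V) *)

Section Maximality.
Variables (F : fieldType) (V1 : superspace F).
Hypothesis two : 2 != 0 :> F.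
Hypothesis nat_inj : forall m n : nat, m%:R = n%:R :> F -> m = n.
Let B := canonical_hbasis V1.
Let m1 := \dim (part V1 false).
Let n1 := \dim (part V1 true).

Lemma supertrace_id : supertrace (\1%VF : gl V1) = m1%:R - n1%:R.
Proof.
rewrite (supertraceE B) big_sumType /=; congr (_ + _).
  rewrite (eq_bigr (fun _ => 1)) ?sumr_const ?card_ord // => i _.
  rewrite id_lfunE -[LHS]mulr1 expr0 mul1r.
  by have := @hcrd_vec _ _ B (inl i) (inl i); rewrite eqxx => ->; rewrite mul1r.
rewrite (eq_bigr (fun _ => - 1)) ?sumr_const ?card_ord ?mulNrn // => i _.
by rewrite id_lfunE; have := @hcrd_vec _ _ B (inr i) (inr i); rewrite eqxx => ->; rewrite mulr1.
Qed.

Lemma card_hidx : #|{: hidx B}| = (m1 + n1)%N.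
Proof. by rewrite card_sum !card_ord. Qed.

Lemma same_parity : (1 < m1 + n1)%N -> ~ (m1 = 1%N /\ n1 = 1%N) ->
  exists a b : hidx B, a != b /\ hpar a = hpar b.
Proof.
have H p : (1 < \dim (part V1 p))%N -> exists a b : hidx B, a != b /\ hpar a = hpar b.
  rewrite -card_hpar => /card_gt1P[a [b []]]; rewrite !inE => /eqP pa /eqP pb ab.
  by exists a, b; split=> //; rewrite pa pb.
move=> d2 n11; have [/H //|m1le] := ltnP 1 m1; have [/H //|n1le] := ltnP 1 n1.
case: n11; move: d2 m1le n1le.
by case: m1 => [|[|]] //; case: n1 => [|[|]].
Qed.

Variable n : nat.
Notation L := (Lambda F n).
Notation V := (tensL V1 n).

Lemma gl_tens_sl (k : 'I_n) : (gl_tens V1 n <= sl V)%VS.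
Proof.
apply/subvP => f /gl_tensP[A ->]; apply: memv_suml => J _.
by rewrite mem_sl (supertrace_tens B) (supertrace_mu k) mulr0.
Qed.

Lemma tens_sgn_sl (D : gl L) : D \in part (gl L) true -> forall A, (tens A D : gl V) \in sl V.
Proof. by move=> D1 A; rewrite mem_sl (supertrace_tens B) (supertrace_odd (Lbasis F n) D1) mulr0. Qed.

(** The only elements of g that may have a nonzero supertrace come from even
    vector fields. It is 0 on fields in at least two variables, and the
    supertrace of 1 on V1 is m1 - n1. *)
Lemma g_sl (k : 'I_n) : (exists i j : 'I_n, i != j) \/ m1 = n1 ->
  (g_algebra V1 n <= sl V)%VS.
Proof.
move=> H; apply: g_sub => [A phi|a D vD].
  exact/(subvP (gl_tens_sl k))/mem_gl_tens.
case: H => [[i [j ij]]|e].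
  by rewrite mem_sl (supertrace_tens B) (supertrace_vect ij vD) mulr0.
case: a vD => vD; first exact: tens_sgn_sl (vect_part vD) _.
by apply: (tens_str0_sl B); rewrite signop_false supertrace_id e subrr.
Qed.

Lemma Etop_sl (k : 'I_n) A : (tens A (Eunit set0 setT) : gl V) \in sl V.
Proof. by rewrite mem_sl (supertrace_tens B) (supertrace_Etop F k) mulr0. Qed.

Lemma Etop_notin_g (k : 'I_n) (a b : hidx B) : a != b ->
  (tens (eunit a b) (Eunit set0 setT) : gl V) \notin g_algebra V1 n.
Proof.
move=> ab; apply/negP => /(block_g_off ab).
by rewrite block_tens hcrd_eunit !eqxx scale1r; exact: Etop_not_mult.
Qed.

Lemma sl_or_g_of_same_parity (a b : hidx B) (W : {vspace gl V}) : a != b -> hpar a = hpar b ->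
  Lie_subsuperalgebra W -> (g_algebra V1 n <= W)%VS ->
  (sl V <= W)%VS \/ W = g_algebra V1 n.
Proof.
move=> ab pab LW gW; have := @sl_or_g_same_parity F V1 n B two W LW _ _ _ a b ab pab.
case=> [A phi|i|i j ij||Wg]; last by right; apply/eqP; rewrite eqEsubv Wg.
- exact/(subvP gW)/(subvP (@gl_tens_g _ _ _))/mem_gl_tens.
- by have := subvP gW _ (mem_g_vect V1 (del_vect F i)); rewrite signop_sgn.
- by have := subvP gW _ (mem_g_vect V1 (xi_del_vect F i j)); rewrite signop_false.
- by left.
Qed.

Lemma maximal_same_parity (k : 'I_n) (a b : hidx B) : a != b -> hpar a = hpar b ->
  (g_algebra V1 n <= sl V)%VS -> maximal_Lie_subsuperalgebra V (g_algebra V1 n) (sl V).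
Proof.
move=> ab pab gs; split=> //; first exact: g_Lie.
  move=> e1; have := Etop_notin_g k ab; rewrite e1 => /negP[]; exact: Etop_sl.
move=> W LW gW Wsl; case: (sl_or_g_of_same_parity ab pab LW gW) => [slW|]; last by left.
by right; apply/eqP; rewrite eqEsubv Wsl.
Qed.

Lemma maximal_line (i j : 'I_n) : i != j -> (m1 + n1)%N = 1%N ->
  maximal_Lie_subsuperalgebra V (g_algebra V1 n) (sl V).
Proof.
move=> ij d1; have /fintype1[o so] : #|{: hidx B}| = 1%N by rewrite card_hidx.
have gs : (g_algebra V1 n <= sl V)%VS by apply: (g_sl i); left; exists i, j.
split=> //; first exact: g_Lie.
  move=> e1; have := Etop_sl i \1%VF; rewrite -e1 => /(block_g_diag o).
  by rewrite block_tens id_lfunE hcrd_vec eqxx scale1r; exact: (Etop_not_normalizes ij).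
move=> W LW gW Wsl; case: (sl_or_g_line two LW gW so) => [slW|Wg].
  by right; apply/eqP; rewrite eqEsubv Wsl.
by left; apply/eqP; rewrite eqEsubv Wg.
Qed.

Section OneOne.
Hypotheses (m11 : m1 = 1%N) (n11 : n1 = 1%N).

Lemma one_one_idx : exists i0 i1 : hidx B, [/\ hpar i0 = false, hpar i1 = true &
  forall i, i = if hpar i then i1 else i0].
Proof.
have /eqP/cards1P[i0 e0] : #|[set i : hidx B | hpar i == false]| = 1%N by rewrite card_hpar.
have /eqP/cards1P[i1 e1] : #|[set i : hidx B | hpar i == true]| = 1%N by rewrite card_hpar.
exists i0, i1; split.
- by have := set11 i0; rewrite -e0 inE => /eqP.
- by have := set11 i1; rewrite -e1 inE => /eqP.
move=> i; case: ifP => pi; apply/eqP; rewrite -in_set1 -?e0 -?e1 inE pi //.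
Qed.

Lemma not_maximal_one_one (k : 'I_n) :
  ~ maximal_Lie_subsuperalgebra V (g_algebra V1 n) (sl V).
Proof.
have [i0 [i1 [p0 p1 idx]]] := one_one_idx.
exact: (not_maximal_odd_pair two p0 p1 idx k).
Qed.

End OneOne.

End Maximality.

(** * One variable *)

Section OneVariable.
Variables (F : fieldType) (V1 : superspace F).
Hypothesis two : 2 != 0 :> F.
Hypothesis nat_inj : forall m n : nat, m%:R = n%:R :> F -> m = n.
Let B := canonical_hbasis V1.
Notation m1 := (\dim (part V1 false)).
Notation n1 := (\dim (part V1 true)).
Notation L := (Lambda F 1).
Notation V := (tensL V1 1).
Notation xi := (xi F).
Notation o := (@ord0 0).
Notation q := (@xiop F 1 o \o del o)%VF.

Lemma set1_cases (J : {set 'I_1}) : J = if o \in J then setT else set0.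
Proof. by apply/setP => k; rewrite (ord1 k); case: ifP => oJ; rewrite ?inE. Qed.

Lemma xi_setT1 : xi [set: 'I_1] = xi1 o :> L.
Proof. by congr Defs.xi; apply/setP => k; rewrite (ord1 k) !inE. Qed.

Lemma del_xi1 : del o (xi1 o) = unitL F 1.
Proof. by rewrite del_xi set11 setDv inversions0r expr0 scale1r. Qed.

Lemma Lambda1_ext (U : vectType F) (f g : 'Hom(L, U)) :
  f (unitL F 1) = g (unitL F 1) -> f (xi1 o) = g (xi1 o) -> f = g.
Proof.
move=> e0 e1; apply: Lambda_ext => J; rewrite (set1_cases J).
by case: ifP => _; rewrite ?xi_setT1.
Qed.

(** A derivation is determined by its value at the only variable. *)
Lemma vect1E a (D : gl L) : D \in vect 1 a -> (D : 'End(L)) = (mu (D (xi1 o)) \o del o)%VF.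
Proof.
move=> vD; apply: Lambda1_ext; rewrite comp_lfunE; first by rewrite del_unit linear0 (vect_unit vD).
by rewrite del_xi1 mu_unitr.
Qed.

Lemma Lambda1E phi : phi = Lcoord set0 phi *: unitL F 1 + Lcoord [set: 'I_1] phi *: (xi1 o : L).
Proof.
rewrite {1}(Lsum phi) (bigD1 set0) //= (bigD1 setT) /=; last exact: (setT_neq0 o).
rewrite -xi_setT1 big1 ?addr0 // => J /andP[J0 JT].
by move: J0 JT; rewrite (set1_cases J); case: ifP; rewrite eqxx.
Qed.

Lemma vect1_odd (D : gl L) : D \in vect 1 true -> exists c, (D : 'End(L)) = c *: del o.
Proof.
move=> vD; rewrite (vect1E vD); exists (Lcoord set0 (D (xi1 o))).
have De : D (xi1 o) \in part L false.
  by have /gl_partP H := vect_part vD; exact: (H _ _ (xi1_part F o)).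
have z : Lcoord [set: 'I_1] (D (xi1 o)) = 0.
  by apply: (@hcrd_part _ _ (Lbasis F 1) false setT _ De); rewrite /= cardsT card_ord.
by rewrite {1}(Lambda1E (D (xi1 o))) z scale0r addr0 muZ mu_unit -comp_lfunZl comp_lfun1l.
Qed.

Lemma vect1_even (D : gl L) : D \in vect 1 false -> exists c, (D : 'End(L)) = c *: q.
Proof.
move=> vD; rewrite (vect1E vD); exists (Lcoord setT (D (xi1 o))).
have De : D (xi1 o) \in part L true.
  by have /gl_partP H := vect_part vD; exact: (H _ _ (xi1_part F o)).
have z : Lcoord set0 (D (xi1 o)) = 0.
  by apply: (@hcrd_part _ _ (Lbasis F 1) true set0 _ De); rewrite /= cards0.
by rewrite {1}(Lambda1E (D (xi1 o))) z scale0r add0r muZ -comp_lfunZl.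
Qed.

Lemma supertrace_xidel : supertrace (q : gl L) = - 1.
Proof.
rewrite (supertraceE (Lbasis F 1)) (bigD1 setT) //= big1 ?addr0 => [|J JT].
  rewrite cardsT card_ord /= expr1 xi_setT1 comp_lfunE del_xi1 /xiop mu_unitr -xi_setT1.
  by rewrite Lcoord_xi eqxx mulr1.
rewrite comp_lfunE (set1_cases J); case: ifP => oJ; last by rewrite del_unit !linear0 mulr0.
by rewrite (set1_cases J) oJ eqxx in JT.
Qed.

Lemma partial_del : partial F = del o.
Proof.
have pl : linear (fun phi : L => coefL phi [set: 'I_1] *: xi (set0 : {set 'I_1})).
  by move=> c u w; rewrite coefL_lin scalerDl [in RHS]scalerA.
apply: Lambda1_ext; rewrite (linfunE pl).
  by rewrite del_unit coefL_xi (negPf (setT_neq0 o)) scale0r.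
by rewrite del_xi1 -xi_setT1 coefL_xi eqxx scale1r.
Qed.

Lemma mem_g1P f : f \in g_algebra V1 1 -> exists x c d, x \in gl_tens V1 1 /\
  f = x + (c *: tens \1%VF q + d *: tens (sgn V1) (del o)).
Proof.
move=> /mem_gP[A [D [vD ->]]]; have [c e0] := vect1_even (vD false); have [d e1] := vect1_odd (vD true).
exists (\sum_J tens (A J) (mu (xi J))), c, d; rewrite e0 e1 !tensZr; split=> //.
by apply: memv_suml => J _; exact: mem_gl_tens.
Qed.

Lemma sg_algebraE : sg_algebra V1 = (gl_tens V1 1 + <[tens (sgn V1) (del o) : gl V]>)%VS.
Proof. by rewrite /sg_algebra rho_vect_tens signop_sgn partial_del. Qed.

Hypothesis mn : m1 <> n1.

Lemma supertrace_tens_xidel : supertrace (tens \1%VF q : gl V) != 0.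
Proof.
rewrite (supertrace_tens B) supertrace_id supertrace_xidel mulrN1 oppr_eq0 subr_eq0.
by apply/eqP => /nat_inj.
Qed.

Lemma tens_xidel_g : (tens \1%VF q : gl V) \in g_algebra V1 1.
Proof. by have := mem_g_vect V1 (xi_del_vect F o o); rewrite signop_false. Qed.

Lemma g_not_sl : ~ (g_algebra V1 1 <= sl V)%VS.
Proof.
move=> /subvP/(_ _ tens_xidel_g); rewrite mem_sl; exact/negP/supertrace_tens_xidel.
Qed.

(** Modulo sg, the algebra g is spanned by the action of xi del, whose
    supertrace is n1 - m1. *)
Lemma sg_algebra_cap : sg_algebra V1 = (g_algebra V1 1 :&: sl V)%VS.
Proof.
have vg : (tens (sgn V1) (del o) : gl V) \in g_algebra V1 1.
  by have := mem_g_vect V1 (del_vect F o); rewrite signop_sgn.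
have vs : (tens (sgn V1) (del o) : gl V) \in sl V by apply: tens_sgn_sl; exact: del_part.
rewrite sg_algebraE; apply/eqP; rewrite eqEsubv; apply/andP; split.
  rewrite subv_add !subv_cap (@gl_tens_g _ _ _) (gl_tens_sl V1 o) /=.
  by rewrite -!memvE vg vs.
apply/subvP => f /memv_capP[/mem_g1P[x [c [d [xE ->]]]] fs].
have slin := supertrace_lin (tbasis 1 B).
have c0 : c = 0.
  move: fs; rewrite mem_sl -[x + _]scale1r; move: (subvP (gl_tens_sl V1 o) _ xE) vs.
  rewrite !mem_sl => /eqP x0 /eqP v0.
  rewrite scale1r -[X in X + _]scale1r slin slin x0 mulr0 add0r.
  rewrite -[d *: _]addr0 slin v0 mulr0 add0r.
  have -> : supertrace (0 : gl V) = 0.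
    by have := slin 0 0 0; rewrite !scale0r add0r mul0r add0r => ->; rewrite (supertraceE (tbasis 1 B)) big1 // => i _; rewrite zero_lfunE linear0 mulr0.
  by rewrite addr0 mulf_eq0 (negPf supertrace_tens_xidel) orbF => /eqP.
rewrite c0 scale0r add0r memv_add // memvZ //; exact: memv_line.
Qed.

Variables a b : hidx B.
Hypotheses (ab : a != b) (pab : hpar a = hpar b).

(** An overalgebra that contains sl(V) and the action of xi del, of nonzero
    supertrace, is everything. *)
Lemma maximal_gl : maximal_Lie_subsuperalgebra V (g_algebra V1 1) fullv.
Proof.
split; [exact: g_Lie | exact: subvf | |].
  move=> e1; have := Etop_notin_g o ab; rewrite e1 memvf //.
move=> W LW gW _; case: (sl_or_g_of_same_parity two ab pab LW gW) => [slW|]; last by left.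
right; apply/vspaceP => f; rewrite memvf; apply/idP.
pose c := supertrace (f : gl V) / supertrace (tens \1%VF q : gl V).
rewrite -(subrK (c *: tens \1%VF q) f); apply: memvD; last first.
  exact/memvZ/(subvP gW)/tens_xidel_g.
apply: (subvP slW); rewrite mem_sl addrC -scaleNr (supertrace_lin (tbasis 1 B)).
by rewrite mulNr /c divfK ?supertrace_tens_xidel // addNr.
Qed.

Lemma maximal_sg : maximal_Lie_subsuperalgebra V (sg_algebra V1) (sl V).
Proof.
split; rewrite ?sg_algebra_cap ?capvSr //.
- by apply: Lie_cap; [exact: g_Lie | exact: (sl_Lie (tbasis 1 B))].
- move=> e1; have := Etop_notin_g o ab; have := Etop_sl o (eunit a b).
  by rewrite -e1 => /memv_capP[-> _].
move=> W LW; rewrite -sg_algebra_cap sg_algebraE => sgW Wsl.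
have := @sl_or_g_same_parity F V1 1 B two W LW _ _ _ a b ab pab.
case=> [A phi|i|i j||Wg].
- exact/(subvP sgW)/(subvP (addvSl _ _))/mem_gl_tens.
- by rewrite (ord1 i); apply/(subvP sgW)/(subvP (addvSr _ _))/memv_line.
- by rewrite (ord1 i) (ord1 j) eqxx.
- by move=> slW; right; apply/eqP; rewrite eqEsubv Wsl.
by left; apply/eqP; rewrite -sg_algebraE sg_algebra_cap eqEsubv -sg_algebra_cap sg_algebraE sgW andbT -sg_algebraE sg_algebra_cap subv_cap Wg.
Qed.

End OneVariable.

Theorem theorem3p2p1 (R : realType) (V1 : superspace R[i]) (m1 n1 : nat)
    (dim_even : \dim (part V1 false) = m1)
    (dim_odd : \dim (part V1 true) = n1)
    (V1_neq0 : (fullv : {vspace V1}) <> 0%VS) :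
  (forall n : nat, (1 <= n)%N ->
     maximal_Lie_subsuperalgebra (tensL V1 n) (g_algebra V1 n) (sl (tensL V1 n))
     <-> ~ ((m1 = 1%N /\ n1 = 1%N) \/ (n = 1%N /\ m1 <> n1)))
  /\
  (m1 <> n1 -> (1 < m1 + n1)%N ->
     maximal_Lie_subsuperalgebra (tensL V1 1) (g_algebra V1 1) fullv /\
     maximal_Lie_subsuperalgebra (tensL V1 1) (sg_algebra V1) (sl (tensL V1 1))).
Proof.
have two : 2 != 0 :> R[i] by rewrite Num.Theory.pnatr_eq0.
have nat_inj (m n : nat) : m%:R = n%:R :> R[i] -> m = n.
  by move=> /eqP; rewrite Num.Theory.eqr_nat => /eqP.
split=> [[//|n] _|]; last first.
  rewrite -dim_even -dim_odd => mn d2.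
  have [a [b [ab pab]]] : exists a b : hidx (canonical_hbasis V1), a != b /\ hpar a = hpar b.
    by apply: same_parity d2 _ => -[e1 e2]; apply: mn; rewrite e1 e2.
  by split; [exact: (maximal_gl two nat_inj mn ab pab) | exact: (maximal_sg two nat_inj mn ab pab)].
have d0 : (0 < m1 + n1)%N.
  rewrite lt0n addn_eq0 -dim_even -dim_odd !dimv_eq0; apply/negP => /andP[/eqP e0 /eqP e1].
  by apply: V1_neq0; rewrite -part_add e0 e1 addv0.
split=> [mx [[e0 e1]|[n0 mn]] | nex].
- by move: mx; apply: not_maximal_one_one ord0; rewrite ?dim_even ?dim_odd.
- move: mx; rewrite n0 => -[_ gs _ _].
  by apply: (g_not_sl nat_inj _ gs); rewrite dim_even dim_odd.
have n11 : ~ (m1 = 1%N /\ n1 = 1%N) by move=> h; apply: nex; left.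
have n1mn : n.+1 = 1%N -> m1 = n1.
  by move=> en; apply/eqP; apply/negP => /negP/eqP mn; apply: nex; right.
have cond : (exists i j : 'I_n.+1, i != j) \/ \dim (part V1 false) = \dim (part V1 true).
  case: (n) n1mn => [|k] h; first by right; rewrite dim_even dim_odd h.
  by left; exists ord0, ord_max.
have [d2|d1] := ltnP 1 (m1 + n1).
  have [a [b [ab pab]]] : exists a b : hidx (canonical_hbasis V1), a != b /\ hpar a = hpar b.
    by apply: same_parity; rewrite dim_even dim_odd.
  exact: (maximal_same_parity two ord0 ab pab (g_sl ord0 cond)).
have d1' : (m1 + n1)%N = 1%N by apply/eqP; rewrite eqn_leq d1.
case: cond => [[i [j ij]]|e]; last by move: d1'; rewrite -dim_even -dim_odd e addnn; case: (\dim _) => [|[|]].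
by apply: (maximal_line two ij); rewrite dim_even dim_odd.
Qed.
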